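(* Let $G,G'$ be groups, $A$ a $G$-graded $k$-algebra, $A'$ a $G'$-graded $k$-algebra, $X$ a right $G$-set, $X'$ a right $G'$-set, and let $P$ be an $X\times X'$-graded $(A,A')$-bimodule. The following are equivalent: (1) $(-\widehat{\otimes}_AP,\mathrm{H}(P_{A'},-))$ is a pair of inverse equivalences between $gr\text{-}(A,X,G)$ and $gr\text{-}(A',X',G')$; (2) (a) ${}_xP$ is finitely generated projective in $\mathcal{M}_{A'}$ for every $x\in X$, and $P_{x'}$ is finitely generated projective in ${}_A\mathcal{M}$ for every $x'\in X'$ (resp. and moreover $P$ is a generator in both $gr\text{-}(A',X',G')$ and $(G,X,A)\text{-}gr$), and (b) the bigraded bimodule maps $\psi:\widehat{A}\to\mathrm{H}(P_{A'},P)$, $\psi(a\otimes x)(p)=a({}_xp)$ $(a\in A,x\in X,p\in P)$, and $\psi':\widehat{A'}\to\mathrm{H}({}_AP,P)$, $\psi'(a'\otimes x')(p)=(p_{x'})a'$ $(a'\in A',x'\in X',p\in P)$, are isomorphisms (resp. are surjective maps); (3) (a) ${}_xP$ is finitely generated projective in $\mathcal{M}_{A'}$ for every $x\in X$, (b) the evaluation map $\varepsilon_{\widehat{A'}}:\mathrm{H}(P_{A'},\widehat{A'})\widehat{\otimes}_AP\to\widehat{A'}$, $\varepsilon_{\widehat{A'}}(f\otimes_Ap)=f(p)$ $(f\in\mathrm{H}(P_{A'},\widehat{A'})_x,\ p\in{}_xP,\ x\in X)$, is an isomorphism, and (c) the functor $-\widehat{\otimes}_AP$ is faithful. (Thus (1),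 (3), the version of (2) without the parentheses, and the version of (2) with ''resp.'' are all equivalent.)
   Context: $k$ is a commutative ring. $gr\text{-}(A,X,G)$: right $A$-modules $M=\bigoplus_{x\in X}M_x$ with $M_xA_g\subset M_{xg}$; morphisms are $A$-linear maps preserving the grading. The right $G$-set $X$ is a left $G$-set via $g.x=xg^{-1}$. $(G,X,A)\text{-}gr$: left $A$-modules $N=\bigoplus_{x\in X}{}_xN$ with $A_g\,{}_xN\subset{}_{g.x}N$, and grading-preserving $A$-linear maps. An $X\times X'$-graded $(A,A')$-bimodule is an $(A,A')$-bimodule $P=\bigoplus P_{(x,x')}$ with $A_gP_{(x,x')}A'_{g'}\subset P_{(g.x,\,x'g')}$. Put ${}_xP=\bigoplus_{x'}P_{(x,x')}$, $P_{x'}=\bigoplus_xP_{(x,x')}$; for $p\in P$, ${}_xp$ and $p_{x'}$ are the components of $p$ in ${}_xP$ and $P_{x'}$. $P$ is an object of $gr\text{-}(A',X',G')$ via the $P_{x'}$ and of $(G,X,A)\text{-}gr$ via the ${}_xP$. For $M\in gr\text{-}(A,X,G)$ and $N\in(G,X,A)\text{-}gr$, $M\widehat\otimes_AN$ is the $k$-submodule of $M\otimes_AN$ generated by all $m\otimes n$ with $m\in M_x$, $n\in{}_xN$, $x\in X$. The functor $-\widehat\otimes_AP:gr\text{-}(A,X,G)\to gr\text{-}(A',X',G')$ has grading $(M\widehat\otimes_AP)_{x'}=M\widehat\otimes_AP_{x'}$. Its right adjoint $\mathrm H(P_{A'},-):gr\text{-}(A',X',G')\to gr\text{-}(A,X,G)$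 is given by $\mathrm H(P_{A'},M')=\{f\in\mathrm{Hom}_{gr\text{-}(A',X',G')}(P,M'): f({}_xP)=0\text{ for almost all }x\in X\}$, with $(fa)(p)=f(ap)$ and $\mathrm H(P_{A'},M')_x=\{f: f({}_yP)=0\ \forall y\neq x\}$. Symmetrically, $\mathrm H({}_AP,P)=\{f\in\mathrm{Hom}_{(G,X,A)\text{-}gr}(P,P): f(P_{x'})=0\text{ for almost all }x'\in X'\}$. $\widehat A=A\otimes_kkX$ ($kX$ the free $k$-module on $X$) is the $X\times X$-graded $(A,A)$-bimodule with $b(a\otimes x)=ba\otimes x$, $(a\otimes x)b=ab\otimes xg$ for $b\in A_g$, and component of degree $(x,y)$ spanned by the $a\otimes y$ with $a\in A_g$, $yg^{-1}=x$. Likewise $\widehat{A'}=A'\otimes_kkX'$. *)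

(* Defs.v *)
From HB Require Import structures.
From mathcomp Require Import all_boot all_algebra.
From mathcomp Require Import boolp classical_sets functions cardinality.

Set Implicit Arguments.
Unset Strict Implicit.
Unset Printing Implicit Defensive.

Import GRing.Theory.

Local Open Scope classical_set_scope.
Local Open Scope ring_scope.


Record category := Category {
  obj :> Type;
  hom : obj -> obj -> Type;
  idm : forall a, hom a a;
  cmp : forall a b c, hom b c -> hom a b -> hom a c;
  cmp1m : forall a b (f : hom a b), cmp (idm b) f = f;
  cmpm1 : forall a b (f : hom a b), cmp f (idm a) = f;
  cmpA : forall a b c d (h : hom c d) (g : hom b c) (f : hom a b),
    cmp h (cmp g f) = cmp (cmp h g) f
}.
Arguments hom {_} _ _.
Arguments idm {_} _.
Arguments cmp {_ _ _ _} _ _.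

Record functor (C D : category) := Functor {
  fobj :> C -> D;
  fmap : forall a b : C, hom a b -> hom (fobj a) (fobj b);
  fmap_id : forall a : C, fmap (idm a) = idm (fobj a);
  fmap_cmp : forall (a b c : C) (g : hom b c) (f : hom a b),
    fmap (cmp g f) = cmp (fmap g) (fmap f)
}.
Arguments fmap {_ _} _ {_ _} _.

Definition idF (C : category) : functor C C :=
  @Functor C C id (fun _ _ f => f) (fun=> erefl) (fun _ _ _ _ _ => erefl).

Section CompF.
Variables (C D E : category) (G : functor D E) (F : functor C D).

Fact compF_id a : fmap G (fmap F (idm a)) = idm (G (F a)).
Proof. by rewrite !fmap_id. Qed.

Fact compF_cmp (a b c : C) (g : hom b c) (f : hom a b) :
  fmap G (fmap F (cmp g f)) = cmp (fmap G (fmap F g)) (fmap G (fmap F f)).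
Proof. by rewrite !fmap_cmp. Qed.

Definition compF : functor C E := Functor compF_id compF_cmp.
End CompF.

Definition naturally_isomorphic (C D : category) (F G : functor C D) : Prop :=
  exists (u : forall a : C, hom (F a) (G a)) (v : forall a : C, hom (G a) (F a)),
    [/\ forall (a b : C) (f : hom a b), cmp (u b) (fmap F f) = cmp (fmap G f) (u a),
        forall a, cmp (v a) (u a) = idm (F a)
      & forall a, cmp (u a) (v a) = idm (G a)].

Definition inverse_equivalences (C D : category)
    (F : functor C D) (H : functor D C) : Prop :=
  naturally_isomorphic (compF H F) (idF C) /\
  naturally_isomorphic (compF F H) (idF D).

Definition faithful (C D : category) (F : functor C D) : Prop :=
  forall (a b : C) (f g : hom a b), fmap F f = fmap F g -> f = g.

Definition generator (C : category) (p : C) : Prop :=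
  forall (a b : C) (f g : hom a b),
    (forall h : hom p a, cmp f h = cmp g h) -> f = g.

Section AddMorph.
Variables (U V : zmodType) (f : U -> V).
Hypothesis fD : {morph f : x y / x + y}.

Lemma am0 : f 0 = 0.
Proof. by apply: (addrI (f 0)); rewrite -fD !addr0. Qed.

Lemma amN x : f (- x) = - f x.
Proof. by apply: (addrI (f x)); rewrite -fD !subrr am0. Qed.

Lemma amB x y : f (x - y) = f x - f y.
Proof. by rewrite fD amN. Qed.

Lemma am_sum I (s : seq I) (P : pred I) (F : I -> U) :
  f (\sum_(i <- s | P i) F i) = \sum_(i <- s | P i) f (F i).
Proof. exact: (big_morph f fD am0). Qed.

End AddMorph.

Section DirectSum.
Variables (V : zmodType) (I : choiceType).
Implicit Types (D : I -> set V) (v : V).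

Definition sum_of D : set V :=
  [set v | exists (s : seq I) (f : I -> V),
    [/\ uniq s, forall i, D i (f i) & v = \sum_(i <- s) f i]].

Record direct_sum D : Prop := DirectSum {
  ds0 : forall i, D i 0;
  dsB : forall i u v, D i u -> D i v -> D i (u - v);
  ds_span : forall v, sum_of D v;
  ds_free : forall (s : seq I) (f : I -> V),
    uniq s -> (forall i, D i (f i)) -> \sum_(i <- s) f i = 0 ->
    forall i, i \in s -> f i = 0
}.

(* The component of index i of v; meaningful when [direct_sum D] holds. *)
Definition dscomp D (i : I) v : V :=
  xget 0 [set w | exists (s : seq I) (f : I -> V),
    [/\ uniq s, forall j, D j (f j), v = \sum_(j <- s) f j
      & w = if i \in s then f i else 0]].

Definition dssupp D v : seq I :=
  xget [::] [set s | [/\ uniq s, forall i, i \notin s -> dscomp D i v = 0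
                       & v = \sum_(i <- s) dscomp D i v]].

Definition dsext D (W : zmodType) (F : I -> V -> W) v : W :=
  \sum_(i <- dssupp D v) F i (dscomp D i v).

Section Closed.
Variable D : I -> set V.
Hypothesis D0 : forall i, D i 0.
Hypothesis DB : forall i u v, D i u -> D i v -> D i (u - v).

Lemma dN i u : D i u -> D i (- u).
Proof. by move=> Du; rewrite -[- u]add0r; apply: DB. Qed.

Lemma dD i u v : D i u -> D i v -> D i (u + v).
Proof. by move=> Du Dv; rewrite -[v]opprK; apply: DB => //; apply: dN. Qed.

Lemma sum_of0 : sum_of D 0.
Proof. by exists [::], (fun=> 0); split=> //; rewrite big_nil. Qed.

Lemma sum_of_in i u : D i u -> sum_of D u.
Proof.
move=> Du; exists [:: i], (fun j => if j == i then u else 0); split=> //.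
  by move=> j; case: eqP => // ->.
by rewrite big_seq1 eqxx.
Qed.

Lemma big_widen (s t : seq I) (f : I -> V) : uniq s -> uniq t -> {subset s <= t} ->
  \sum_(i <- s) f i = \sum_(i <- t) (if i \in s then f i else 0).
Proof.
move=> us ut st; rewrite -big_mkcond -big_filter; apply: perm_big.
apply: uniq_perm => //; first exact: filter_uniq.
move=> i; rewrite mem_filter; case: (boolP (i \in s)) => //= /st ->.
by [].
Qed.

Lemma sum_ofD u v : sum_of D u -> sum_of D v -> sum_of D (u + v).
Proof.
move=> [s [f [us Df ->]]] [t [g [ut Dg ->]]].
exists (undup (s ++ t)), (fun i => (if i \in s then f i else 0) + (if i \in t then g i else 0)).
split; first exact: undup_uniq.
  by move=> i; apply: dD; case: ifP.
rewrite big_split; congr (_ + _); apply: big_widen => //; rewrite ?undup_uniq //.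
  by move=> i si; rewrite mem_undup mem_cat si.
by move=> i si; rewrite mem_undup mem_cat si orbT.
Qed.

Lemma sum_ofN u : sum_of D u -> sum_of D (- u).
Proof.
move=> [s [f [us Df ->]]]; exists s, (fun i => - f i); split=> //.
  by move=> i; apply: dN.
by rewrite sumrN.
Qed.

Lemma sum_ofB u v : sum_of D u -> sum_of D v -> sum_of D (u - v).
Proof. by move=> Du Dv; apply: sum_ofD => //; apply: sum_ofN. Qed.

Lemma sum_of_sum J (s : seq J) (P : pred J) (F : J -> V) :
  (forall j, P j -> sum_of D (F j)) -> sum_of D (\sum_(j <- s | P j) F j).
Proof.
move=> h; elim/big_rec: _ => [|j x Pj IH]; first exact: sum_of0.
by apply: sum_ofD => //; apply: h.
Qed.

Lemma direct_sum_proj (W : zmodType) (vl : V -> W) (pr : I -> W -> W) :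
  (forall v, sum_of D v) ->
  injective vl -> {morph vl : x y / x + y} ->
  (forall i, {morph pr i : x y / x + y}) ->
  (forall i j v, D i v -> pr j (vl v) = if i == j then vl v else 0) ->
  direct_sum D.
Proof.
move=> sp inj vlD prD prE; split=> // s f us Df f0 i si.
apply: inj; rewrite (am0 vlD).
have /(congr1 (pr i)) := congr1 vl f0.
rewrite (am0 vlD) (am0 (prD i)) (am_sum vlD) (am_sum (prD i)) => <-.
rewrite (bigD1_seq i) //= (prE i i) // eqxx big1 ?addr0 // => j ji.
by rewrite (prE j i) // (negbTE ji).
Qed.

End Closed.

Section Theory.
Variable D : I -> set V.
Hypothesis dsD : direct_sum D.
Let D0 := ds0 dsD.
Let DB := dsB dsD.

Lemma ds_uniq (s t : seq I) (f g : I -> V) i : uniq s -> uniq t ->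
  (forall j, D j (f j)) -> (forall j, D j (g j)) ->
  \sum_(j <- s) f j = \sum_(j <- t) g j ->
  (if i \in s then f i else 0) = (if i \in t then g i else 0).
Proof.
move=> us ut Df Dg e.
pose u := undup (i :: s ++ t).
have uu : uniq u by exact: undup_uniq.
apply/eqP; rewrite -subr_eq0; apply/eqP.
pose h j := (if j \in s then f j else 0) - (if j \in t then g j else 0).
apply: (ds_free dsD (s := u) (f := h)) => //.
- by move=> j; apply: DB; case: ifP.
- rewrite /h sumrB -!big_widen ?e ?subrr //.
    by move=> j js; rewrite mem_undup inE mem_cat js !orbT.
  by move=> j js; rewrite mem_undup inE mem_cat js !orbT.
- by rewrite mem_undup inE eqxx.
Qed.

Lemma dscompE (s : seq I) (f : I -> V) i : uniq s -> (forall j, D j (f j)) ->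
  dscomp D i (\sum_(j <- s) f j) = if i \in s then f i else 0.
Proof.
move=> us Df; rewrite /dscomp; case: xgetP => [w _ [t [g [ut Dg e ->]]]|].
  by apply/esym/ds_uniq.
by move/(_ (if i \in s then f i else 0)); case; exists s, f.
Qed.

Lemma dscomp_in i v : D i (dscomp D i v).
Proof. by have [s [f [us Df ->]]] := ds_span dsD v; rewrite dscompE //; case: ifP. Qed.

Lemma dscomp_hom i j v : D i v -> dscomp D j v = if i == j then v else 0.
Proof.
move=> Dv; pose f k := if k == i then v else 0.
have Df k : D k (f k) by rewrite /f; case: eqP => // ->.
have -> : v = \sum_(k <- [:: i]) f k by rewrite big_seq1 /f eqxx.
rewrite dscompE // inE big_seq1 /f eqxx eq_sym.
by case: eqP => // ->.
Qed.

Lemma dscompD i : {morph dscomp D i : u v / u + v}.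
Proof.
move=> u v; have [s [f [us Df ->]]] := ds_span dsD u.
have [t [g [ut Dg ->]]] := ds_span dsD v; rewrite !dscompE //.
pose w := undup (i :: s ++ t).
have uw : uniq w by exact: undup_uniq.
rewrite (@big_widen s w) // ?(@big_widen t w) // -?big_split ?dscompE //=.
- by rewrite mem_undup inE eqxx.
- by move=> j; apply: dD => //; case: ifP.
- by move=> j js; rewrite mem_undup inE mem_cat js !orbT.
- by move=> j js; rewrite mem_undup inE mem_cat js !orbT.
Qed.

Lemma dssuppP v : [/\ uniq (dssupp D v),
  forall i, i \notin dssupp D v -> dscomp D i v = 0
  & v = \sum_(i <- dssupp D v) dscomp D i v].
Proof.
rewrite /dssupp; case: xgetP => [w _ //|]; have [s [f [us Df vE]]] := ds_span dsD v.
move/(_ s); case; split=> // [i si|].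
  by rewrite vE dscompE // (negbTE si).
rewrite {1}vE; apply: eq_big_seq => i si; by rewrite vE dscompE // si.
Qed.

Lemma dscomp_eq0 v : (forall i, dscomp D i v = 0) -> v = 0.
Proof. by move=> h; have [_ _ ->] := dssuppP v; rewrite big1. Qed.

Lemma ds_ind (P : V -> Prop) : P 0 -> (forall u v, P u -> P v -> P (u + v)) ->
  (forall i v, D i v -> P v) -> forall v, P v.
Proof.
move=> P0 PD Ph v; have [s [f [_ Df ->]]] := ds_span dsD v.
by elim/big_rec: _ => [//|i x _]; apply: PD; apply: Ph (Df i).
Qed.

Lemma ds_ext (W : zmodType) (f g : V -> W) :
  {morph f : x y / x + y} -> {morph g : x y / x + y} ->
  (forall i v, D i v -> f v = g v) -> f =1 g.
Proof.
move=> fD gD fg; apply: ds_ind => [|u v|//]; first by rewrite !am0.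
by rewrite fD gD => -> ->.
Qed.

Section Ext.
Variables (W : zmodType) (F : I -> V -> W).
Hypothesis FD : forall i, {morph F i : x y / x + y}.

Lemma dsextE (s : seq I) v : uniq s -> (forall i, i \notin s -> dscomp D i v = 0) ->
  dsext D F v = \sum_(i <- s) F i (dscomp D i v).
Proof.
move=> us s0; have [ut t0 _] := dssuppP v; rewrite /dsext.
have h (r : seq I) : uniq r -> (forall i, i \notin r -> dscomp D i v = 0) ->
  {subset r <= dssupp D v ++ s} ->
  \sum_(i <- r) F i (dscomp D i v) = \sum_(i <- undup (dssupp D v ++ s)) F i (dscomp D i v).
  move=> ur r0 sub.
  transitivity (\sum_(i <- undup (dssupp D v ++ s)) if i \in r then F i (dscomp D i v) else 0).
    rewrite -big_mkcond -big_filter; apply: perm_big; apply: uniq_perm => //.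
      by rewrite filter_uniq // undup_uniq.
    by move=> i; rewrite mem_filter mem_undup; case: (boolP (i \in r)) => //= /sub ->.
  apply: eq_bigr => i _; case: ifP => // /negbT/r0 ->; by rewrite am0.
rewrite (h (dssupp D v)) ?(h s) // => i si; by rewrite mem_cat si ?orbT.
Qed.

Lemma dsextD : {morph dsext D F : x y / x + y}.
Proof.
move=> u v; have [us su _] := dssuppP u; have [vs sv _] := dssuppP v.
pose w := undup (dssupp D u ++ dssupp D v).
rewrite !(@dsextE w) ?undup_uniq //.
- by rewrite -big_split; apply: eq_bigr => i _; rewrite dscompD FD.
- by move=> i; rewrite mem_undup mem_cat negb_or => /andP[_ /sv].
- by move=> i; rewrite mem_undup mem_cat negb_or => /andP[/su].
- move=> i; rewrite mem_undup mem_cat negb_or dscompD => /andP[/su -> /sv ->].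
  by rewrite addr0.
Qed.

Lemma dsext_hom i v : D i v -> dsext D F v = F i v.
Proof.
move=> Dv; rewrite (@dsextE [:: i]) //; last first.
  by move=> j; rewrite inE (dscomp_hom _ Dv) eq_sym => /negbTE ->.
by rewrite big_seq1 (dscomp_hom _ Dv) eqxx.
Qed.

End Ext.
End Theory.
End DirectSum.

Section Coarsen.
Variables (V : zmodType) (X Y : choiceType) (D : X * Y -> set V).
Hypothesis dsD : direct_sum D.

Lemma sum_of_fst x v :
  sum_of (fun y => D (x, y)) v <-> (forall z, z.1 != x -> dscomp D z v = 0).
Proof.
split=> [[s [f [us Df ->]]] z zx|h].
  rewrite (am_sum (dscompD dsD z)) big1 // => y _.
  rewrite (dscomp_hom dsD z (Df y)); case: eqP => // e.
  by rewrite -e eqxx in zx.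
have [us s0 ->] := dssuppP dsD v.
apply: sum_of_sum => [y|y|z _]; first exact: ds0.
  exact: dsB.
have [zx|/h ->] := eqVneq z.1 x; last by apply: sum_of0 => ?; apply: ds0.
apply: (@sum_of_in _ _ _ _ z.2) => [?|]; first exact: ds0.
by rewrite -zx -surjective_pairing; apply: dscomp_in.
Qed.

Lemma coarsen_fst : direct_sum (fun x => sum_of (fun y => D (x, y))).
Proof.
split=> [x|x u v|v|s f us Df f0 x xs].
- by apply: sum_of0 => y; apply: ds0.
- by apply: sum_ofB => y *; [apply: ds0|apply: dsB].
- have [_ _ ->] := dssuppP dsD v; apply: sum_of_sum => [x|x|z _].
  + by apply: sum_of0 => y; apply: ds0.
  + by apply: sum_ofB => y *; [apply: ds0|apply: dsB].
  apply: (@sum_of_in _ _ _ _ z.1) => [x|]; first by apply: sum_of0 => y; apply: ds0.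
  apply: (@sum_of_in _ _ _ _ z.2) => [x|]; first exact: ds0.
  by rewrite -surjective_pairing; apply: dscomp_in.
- apply: (dscomp_eq0 dsD) => z.
  have [zx|zx] := eqVneq z.1 x; last by have /sum_of_fst := Df x; apply.
  have := congr1 (dscomp D z) f0; rewrite (am_sum (dscompD dsD z)) (am0 (dscompD dsD z)).
  rewrite (bigD1_seq x) //= big1 ?addr0 // => y yx.
  by have /sum_of_fst := Df y; apply; rewrite zx eq_sym.
Qed.

End Coarsen.

Lemma direct_sum_swap (V : zmodType) (X Y : choiceType) (D : X * Y -> set V) :
  direct_sum D -> direct_sum (fun z : Y * X => D (z.2, z.1)).
Proof.
pose sw (A B : Type) (z : A * B) := (z.2, z.1).
have swK A B : cancel (@sw A B) (@sw B A) by case.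
move=> dsD; split=> [z|z u v|v|s f us Df f0 z zs].
- exact: ds0.
- exact: dsB.
- have [s [f [us Df ->]]] := ds_span dsD v.
  exists (map (@sw _ _) s), (f \o @sw _ _); split.
  + by rewrite map_inj_uniq //; apply: can_inj (swK _ _).
  + by move=> z; apply: Df.
  + by rewrite big_map; apply: eq_bigr => z _ /=; rewrite swK.
- have := @ds_free _ _ _ dsD (map (@sw _ _) s) (f \o @sw _ _) _ _ _ (sw _ _ z).
  rewrite /= swK; apply.
  + by rewrite map_inj_uniq //; apply: can_inj (swK _ _).
  + by case=> x y; apply: (Df (y, x)).
  + by rewrite big_map -[RHS]f0; apply: eq_bigr => i _ /=; rewrite swK.
  + by apply: map_f.
Qed.

(* For a right action ra on M and a left action la on N, the tensor product   *)
(* is the abelian group of formal sums of pairs (m, n), a formal sum being a  *)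
(* sequence, modulo the congruence generated by biadditivity and by           *)
(* (m a, n) = (m, a n).                                                       *)
Section Tensor.
Variables (S : Type) (M N : zmodType) (ra : M -> S -> M) (la : S -> N -> N).

Inductive tens_rel : seq (M * N) -> seq (M * N) -> Prop :=
| tens_refl s : tens_rel s s
| tens_sym s t : tens_rel s t -> tens_rel t s
| tens_trans s t u : tens_rel s t -> tens_rel t u -> tens_rel s u
| tens_cat s s' t t' :
    tens_rel s s' -> tens_rel t t' -> tens_rel (s ++ t) (s' ++ t')
| tens_comm s t : tens_rel (s ++ t) (t ++ s)
| tens_0l n : tens_rel [:: (0, n)] [::]
| tens_Dl m m' n : tens_rel [:: (m + m', n)] [:: (m, n); (m', n)]
| tens_Dr m n n' : tens_rel [:: (m, n + n')] [:: (m, n); (m, n')]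
| tens_bal m a n : tens_rel [:: (ra m a, n)] [:: (m, la a n)].

Definition tens_relb s t := `[< tens_rel s t >].

Fact tens_relb_refl : reflexive tens_relb.
Proof. by move=> s; apply/asboolP/tens_refl. Qed.
Fact tens_relb_sym : symmetric tens_relb.
Proof. by move=> s t; apply/asboolP/asboolP; apply: tens_sym. Qed.
Fact tens_relb_trans : transitive tens_relb.
Proof.
by move=> s t u /asboolP h /asboolP h'; apply/asboolP; apply: tens_trans h h'.
Qed.

Canonical tens_equiv :=
  EquivRel tens_relb tens_relb_refl tens_relb_sym tens_relb_trans.

Definition tens : Type := {eq_quot tens_equiv}%qT.
HB.instance Definition _ := Choice.on tens.

Definition tens_pi (s : seq (M * N)) : tens := (\pi_({eq_quot tens_equiv}) s)%qT.
Definition tens_repr (t : tens) : seq (M * N) := repr (t : {eq_quot tens_equiv}%qT).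

Lemma tens_reprK t : tens_pi (tens_repr t) = t.
Proof. exact: reprK. Qed.

Lemma tens_piP s t : tens_pi s = tens_pi t <-> tens_rel s t.
Proof.
split=> [/eqP|h]; first by rewrite eqmodE => /asboolP.
by apply/eqP; rewrite eqmodE; apply/asboolP.
Qed.

Definition tens_zero : tens := tens_pi [::].
Definition tens_add (t u : tens) : tens := tens_pi (tens_repr t ++ tens_repr u).
Definition tens_negs (s : seq (M * N)) := [seq (- p.1, p.2) | p <- s].
Definition tens_opp (t : tens) : tens := tens_pi (tens_negs (tens_repr t)).

Lemma tens_repr_pi s : tens_rel (tens_repr (tens_pi s)) s.
Proof. by apply/tens_piP; rewrite tens_reprK. Qed.

Lemma tens_add_pi s t : tens_add (tens_pi s) (tens_pi t) = tens_pi (s ++ t).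
Proof. by apply/tens_piP; apply: tens_cat; apply: tens_repr_pi. Qed.

Fact tens_addA : associative tens_add.
Proof.
move=> t u v; rewrite -(tens_reprK t) -(tens_reprK u) -(tens_reprK v).
by rewrite !tens_add_pi catA.
Qed.

Fact tens_addC : commutative tens_add.
Proof.
move=> t u; rewrite -(tens_reprK t) -(tens_reprK u) !tens_add_pi.
by apply/tens_piP/tens_comm.
Qed.

Fact tens_add0 : left_id tens_zero tens_add.
Proof. by move=> t; rewrite -(tens_reprK t) tens_add_pi. Qed.

Fact tens_addN : left_inverse tens_zero tens_opp tens_add.
Proof.
move=> t; rewrite -{2}(tens_reprK t) tens_add_pi; apply/tens_piP.
elim: (tens_repr t) => [|[m n] s IH] /=; first exact: tens_refl.
apply: (@tens_trans _ ([:: (- m, n)] ++ [:: (m, n)] ++ (tens_negs s ++ s))).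
  rewrite -cat1s -[(m, n) :: s]cat1s; apply: tens_cat; first exact: tens_refl.
  rewrite !catA; apply: tens_cat; last exact: tens_refl.
  exact: tens_comm.
rewrite catA -[X in tens_rel _ X]cat0s; apply: tens_cat => //.
apply: tens_trans (tens_0l n); apply: tens_sym.
by rewrite -(addNr m); apply: tens_Dl.
Qed.

HB.instance Definition _ :=
  GRing.isZmodule.Build tens tens_addA tens_addC tens_add0 tens_addN.

Definition tmk (m : M) (n : N) : tens := tens_pi [:: (m, n)].

Lemma tmkDl m m' n : tmk (m + m') n = tmk m n + tmk m' n.
Proof. by rewrite [RHS]tens_add_pi; apply/tens_piP/tens_Dl. Qed.

Lemma tmkDr m n n' : tmk m (n + n') = tmk m n + tmk m n'.
Proof. by rewrite [RHS]tens_add_pi; apply/tens_piP/tens_Dr. Qed.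

Lemma tmk_bal m a n : tmk (ra m a) n = tmk m (la a n).
Proof. exact/tens_piP/tens_bal. Qed.

Lemma tmk0l n : tmk 0 n = 0.
Proof. by apply: (@am0 _ _ (tmk^~ n)) => ??; apply: tmkDl. Qed.
Lemma tmk0r m : tmk m 0 = 0.
Proof. by apply: (@am0 _ _ (tmk m)) => ??; apply: tmkDr. Qed.
Lemma tmk_suml m I (s : seq I) (P : pred I) F :
  tmk (\sum_(i <- s | P i) F i) m = \sum_(i <- s | P i) tmk (F i) m.
Proof. by apply: (@am_sum _ _ (tmk^~ m)) => ??; apply: tmkDl. Qed.
Lemma tmk_sumr m I (s : seq I) (P : pred I) F :
  tmk m (\sum_(i <- s | P i) F i) = \sum_(i <- s | P i) tmk m (F i).
Proof. by apply: (@am_sum _ _ (tmk m)) => ??; apply: tmkDr. Qed.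

Lemma tens_piE s : tens_pi s = \sum_(p <- s) tmk p.1 p.2.
Proof.
elim: s => [|[m n] s IH]; first by rewrite big_nil.
by rewrite big_cons -IH [RHS]tens_add_pi.
Qed.

Lemma tens_ind (P : tens -> Prop) : P 0 -> (forall t u, P t -> P u -> P (t + u)) ->
  (forall m n, P (tmk m n)) -> forall t, P t.
Proof.
move=> P0 PD Pm t; rewrite -(tens_reprK t) tens_piE.
by elim/big_rec: _ => // p x _; apply: PD.
Qed.

Lemma tens_ext (W : zmodType) (f g : tens -> W) :
  {morph f : x y / x + y} -> {morph g : x y / x + y} ->
  (forall m n, f (tmk m n) = g (tmk m n)) -> f =1 g.
Proof.
move=> fD gD fg; apply: tens_ind => [|u v|//]; first by rewrite !am0.
by rewrite fD gD => -> ->.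
Qed.

(* The additive map sending m (x) n to b m n, when b is biadditive and        *)
(* balanced.                                                                  *)
Definition tlift (W : zmodType) (b : M -> N -> W) (t : tens) : W :=
  \sum_(p <- tens_repr t) b p.1 p.2.

Section Lift.
Variables (W : zmodType) (b : M -> N -> W).
Hypothesis bDl : forall n, {morph b^~ n : x y / x + y}.
Hypothesis bDr : forall m, {morph b m : x y / x + y}.
Hypothesis bb : forall m a n, b (ra m a) n = b m (la a n).

Lemma tens_rel_lift s t : tens_rel s t ->
  \sum_(p <- s) b p.1 p.2 = \sum_(p <- t) b p.1 p.2.
Proof.
elim=> {s t} //=.
- by move=> s t u _ -> _ ->.
- by move=> s s' t t' _ e _ e'; rewrite !big_cat /= e e'.
- by move=> s t; rewrite !big_cat /= addrC.
- by move=> n; rewrite big_seq1 big_nil /=; apply: am0 (bDl n).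
- by move=> m m' n; rewrite !big_cons !big_nil !addr0 /= bDl.
- by move=> m n n'; rewrite !big_cons !big_nil !addr0 /= bDr.
- by move=> m a n; rewrite !big_seq1 /= bb.
Qed.

Lemma tlift_pi s : tlift b (tens_pi s) = \sum_(p <- s) b p.1 p.2.
Proof. exact/tens_rel_lift/tens_repr_pi. Qed.

Lemma tlift_tmk m n : tlift b (tmk m n) = b m n.
Proof. by rewrite tlift_pi big_seq1. Qed.

Lemma tliftD : {morph tlift b : x y / x + y}.
Proof.
move=> t u; rewrite -(tens_reprK t) -(tens_reprK u) [tens_pi _ + _]tens_add_pi.
by rewrite !tlift_pi big_cat.
Qed.
End Lift.
End Tensor.

Section TensorMap.
Variables (S T : Type) (M N M' N' : zmodType).
Variables (ra : M -> S -> M) (la : S -> N -> N).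
Variables (ra' : M' -> T -> M') (la' : T -> N' -> N').
Variables (f : M -> M') (g : N -> N').

Definition tmap : tens ra la -> tens ra' la' := tlift (fun m n => tmk ra' la' (f m) (g n)).

Hypotheses (fD : {morph f : x y / x + y}) (gD : {morph g : x y / x + y}).
Hypothesis fgb : forall m a n,
  tmk ra' la' (f (ra m a)) (g n) = tmk ra' la' (f m) (g (la a n)).

Lemma tmap_tmk m n : tmap (tmk ra la m n) = tmk ra' la' (f m) (g n).
Proof.
by rewrite /tmap tlift_tmk // => [k x y|k x y]; rewrite ?fD ?gD ?tmkDl ?tmkDr.
Qed.

Lemma tmapD : {morph tmap : x y / x + y}.
Proof.
by apply: tliftD => // [k x y|k x y]; rewrite ?fD ?gD ?tmkDl ?tmkDr.
Qed.
End TensorMap.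

Inductive kspan (k : Type) (V : zmodType) (sc : k -> V -> V) (E : set V) : set V :=
| kspan0 : kspan sc E 0
| kspanD u v : kspan sc E u -> kspan sc E v -> kspan sc E (u + v)
| kspanZ c u : kspan sc E u -> kspan sc E (sc c u)
| kspan_in u : E u -> kspan sc E u.

Section KSpan.
Variables (k : pzRingType) (V : zmodType) (sc : k -> V -> V) (E : set V).
Hypothesis scD : forall c, {morph sc c : x y / x + y}.
Hypothesis scE : forall c u, E u -> E (sc c u).
Hypothesis scN : forall u, sc (-1) u = - u.

Lemma kspanN u : kspan sc E u -> kspan sc E (- u).
Proof. by move=> h; rewrite -scN; apply: kspanZ. Qed.

Lemma kspanB u v : kspan sc E u -> kspan sc E v -> kspan sc E (u - v).
Proof. by move=> h h'; apply: kspanD => //; apply: kspanN. Qed.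

(* Scaling can be dropped from inductions when E is stable under it.          *)
Lemma kspan_add_ind (P : V -> Prop) : P 0 ->
  (forall u v, kspan sc E u -> kspan sc E v -> P u -> P v -> P (u + v)) ->
  (forall u, E u -> P u) -> forall u, kspan sc E u -> P u.
Proof.
move=> P0 PD PE.
pose Q u := kspan sc E u /\ P u.
have Q0 : Q 0 by split=> //; apply: kspan0.
have QD u v : Q u -> Q v -> Q (u + v).
  by move=> [a b] [c d]; split; [apply: kspanD|apply: PD].
have QE u : E u -> Q u by move=> h; split; [apply: kspan_in|apply: PE].
pose L u := exists2 s : seq V, forall v, v \in s -> E v & u = \sum_(v <- s) v.
have LQ u : L u -> Q u.
  case=> s sE ->; elim: s sE => [|v s IH] sE; first by rewrite big_nil.
  rewrite big_cons; apply: QD; first by apply/QE/sE; rewrite inE eqxx.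
  by apply: IH => w ws; apply: sE; rewrite inE ws orbT.
move=> u ku; suff /LQ[] : L u by [].
elim: ku => {u} [|u v _ [s sE ->] _ [t tE ->]|c u _ [s sE ->]|u Eu].
- by exists [::] => //; rewrite big_nil.
- exists (s ++ t); last by rewrite big_cat.
  by move=> w; rewrite mem_cat => /orP[/sE|/tE].
- exists (map (sc c) s); last by rewrite big_map (am_sum (scD c)).
  by move=> w /mapP[x /sE xE ->]; apply: scE.
- by exists [:: u]; rewrite ?big_seq1 // => w; rewrite inE => /eqP ->.
Qed.
End KSpan.

(* G-graded k-algebra. The structure map is a field of the record because     *)
(* algType excludes the zero ring.                                            *)
Record grAlg (k : comPzRingType) (G : groupType) := GrAlg {
  ga_ring :> pzRingType;
  ga_alg : {rmorphism k -> ga_ring};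
  ga_algC : forall c a, ga_alg c * a = a * ga_alg c;
  ga_comp : G -> set ga_ring;
  ga_dsum : direct_sum ga_comp;
  ga_compZ : forall c g a, ga_comp g a -> ga_comp g (ga_alg c * a);
  ga_compM : forall g h a b,
    ga_comp g a -> ga_comp h b -> ga_comp (g * h)%g (a * b)
}.

Record gset (G : groupType) := GSet {
  gs_car :> choiceType;
  gs_act : gs_car -> G -> gs_car;
  gs_act1 : forall x, gs_act x 1%g = x;
  gs_actM : forall x g h, gs_act x (g * h)%g = gs_act (gs_act x g) h
}.

Lemma gs_actK G (X : gset G) g : cancel (@gs_act G X ^~ g) (@gs_act G X ^~ g^-1%g).
Proof. by move=> x; rewrite -gs_actM mulgV gs_act1. Qed.
Lemma gs_actVK G (X : gset G) g : cancel (@gs_act G X ^~ g^-1%g) (@gs_act G X ^~ g).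
Proof. by move=> x; rewrite -gs_actM mulVg gs_act1. Qed.

Section GrAlgTheory.
Variables (k : comPzRingType) (G : groupType) (A : grAlg k G).

Lemma ga_one : @ga_comp k G A 1%g 1.
Proof.
pose e := dscomp (@ga_comp k G A) 1%g 1.
have De : ga_comp 1%g e by apply: dscomp_in (ga_dsum A) _ _.
have he : (fun a : A => a * e) =1 id.
  apply: (ds_ext (ga_dsum A)) => [x y|//|h a ha]; first by rewrite mulrDl.
  suff E : dscomp (@ga_comp k G A) h (a * 1) = a * e.
    by rewrite -E mulr1 (dscomp_hom (ga_dsum A) h ha) eqxx.
  have [us s0 e1] := dssuppP (ga_dsum A) 1.
  rewrite {1}e1 mulr_sumr (am_sum (dscompD (ga_dsum A) h)).
  have gM g : dscomp (@ga_comp k G A) h (a * dscomp (@ga_comp k G A) g 1)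
              = if g == 1%g then a * e else 0.
    have D : ga_comp (h * g)%g (a * dscomp (@ga_comp k G A) g 1).
      by apply: ga_compM => //; apply: dscomp_in (ga_dsum A) _ _.
    rewrite (dscomp_hom (ga_dsum A) h D) -{2}[h]mulg1 (inj_eq (mulgI h)).
    by case: eqP => // ->.
  under eq_bigr do rewrite gM.
  have [h1|h1] := boolP (1%g \in dssupp (@ga_comp k G A) 1).
    by rewrite (bigD1_seq 1%g) //= eqxx big1 ?addr0 // => g /negbTE ->.
  rewrite /e (s0 _ h1) mulr0 big_seq big1 // => g gs.
  by case: eqP => // g1; rewrite g1 (negbTE h1) in gs.
by have := he 1; rewrite mul1r => <-.
Qed.

Lemma ga_one_alg c : @ga_comp k G A 1%g (ga_alg A c).
Proof. by rewrite -[ga_alg _ _]mulr1; apply/ga_compZ/ga_one. Qed.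

End GrAlgTheory.

(* Modules over R graded by X, where an element of R of degree i shifts the   *)
(* degree x to act x i. Right A-modules are modules over the converse ring    *)
(* A^c, the product m a being a *: m.                                         *)
Section GradedModules.
Variables (R : pzRingType) (I : Type) (Rh : I -> set R).
Variables (X : choiceType) (act : X -> I -> X).

Record grmod := GrMod {
  gm_car :> lmodType R;
  gm_comp : X -> set gm_car;
  gm_dsum : direct_sum gm_comp;
  gm_act : forall i x (r : R) (m : gm_car),
    Rh i r -> gm_comp x m -> gm_comp (act x i) (r *: m)
}.

Record grhom (M N : grmod) := GrHom {
  gh_fun :> M -> N;
  gh_lin : linear gh_fun;
  gh_comp : forall x m, gm_comp x m -> gm_comp x (gh_fun m)
}.

Lemma grhom_eq (M N : grmod) (f g : grhom M N) : gh_fun f =1 gh_fun g -> f = g.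
Proof.
case: f g => [f fl fc] [g gl gc] /= /funext e; case: _ / e in gl gc *.
by congr GrHom; apply: Prop_irrelevance.
Qed.

Lemma gh_D (M N : grmod) (f : grhom M N) : {morph gh_fun f : x y / x + y}.
Proof. by move=> x y; have := gh_lin f 1 x y; rewrite !scale1r. Qed.

Lemma gh_Z (M N : grmod) (f : grhom M N) a x : f (a *: x) = a *: f x.
Proof. by rewrite -[a *: x]addr0 gh_lin (am0 (gh_D f)) addr0. Qed.

Lemma linearP_of (M N : lmodType R) (f : M -> N) :
  {morph f : x y / x + y} -> (forall a x, f (a *: x) = a *: f x) -> linear f.
Proof. by move=> fD fZ a x y; rewrite fD fZ. Qed.

Definition grhom_id (M : grmod) : grhom M M :=
  @GrHom M M id (fun _ _ _ => erefl) (fun _ _ h => h).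

Definition grhom_cmp (M N Q : grmod) (g : grhom N Q) (f : grhom M N) : grhom M Q.
Proof.
exists (g \o f); first by move=> a x y /=; rewrite !gh_lin.
by move=> x m h /=; do 2!apply: gh_comp.
Defined.

Definition gr_cat : category.
Proof.
apply: (@Category grmod grhom grhom_id grhom_cmp) => *; exact: grhom_eq.
Defined.

End GradedModules.

Definition grR (k : comPzRingType) (G : groupType) (A : grAlg k G) (X : gset G) : Type :=
  grmod (R := A^c) (@ga_comp k G A) (@gs_act G X).

(* X is a left G-set through g.x = x g^-1.                                    *)
Definition grL (k : comPzRingType) (G : groupType) (A : grAlg k G) (X : gset G) : Type :=
  grmod (R := A) (@ga_comp k G A) (fun x g => @gs_act G X x g^-1%g).

Definition grR_cat k G (A : grAlg k G) (X : gset G) : category :=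
  gr_cat (R := A^c) (@ga_comp k G A) (@gs_act G X).

Definition grL_cat k G (A : grAlg k G) (X : gset G) : category :=
  gr_cat (R := A) (@ga_comp k G A) (fun x g => @gs_act G X x g^-1%g).

(* bm_k: as usual for bimodules over k-algebras, k acts in the same way on    *)
(* both sides.                                                                *)
Record grbimod (k : comPzRingType) (G G' : groupType)
    (A : grAlg k G) (A' : grAlg k G') (X : gset G) (X' : gset G') := GrBimod {
  bm_car :> lmodType A;
  bm_r : bm_car -> A' -> bm_car;
  bm_rDl : forall a', {morph bm_r^~ a' : p q / p + q};
  bm_rDr : forall p, {morph bm_r p : a' b' / a' + b'};
  bm_r1 : forall p, bm_r p 1 = p;
  bm_rM : forall p a' b', bm_r p (a' * b') = bm_r (bm_r p a') b';
  bm_lr : forall a p a', bm_r (a *: p) a' = a *: bm_r p a';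
  bm_k : forall c p, bm_r p (ga_alg A' c) = ga_alg A c *: p;
  bm_comp : X * X' -> set bm_car;
  bm_dsum : direct_sum bm_comp;
  bm_act : forall g x (a : A) g' x' (a' : A') p,
    ga_comp g a -> ga_comp g' a' -> bm_comp (x, x') p ->
    bm_comp (gs_act x g^-1%g, gs_act x' g') (bm_r (a *: p) a')
}.

Section BimodViews.
Variables (k : comPzRingType) (G G' : groupType).
Variables (A : grAlg k G) (A' : grAlg k G') (X : gset G) (X' : gset G').
Variable (P : grbimod A A' X X').

(* lpart x is _xP and rpart x' is P_x'.                                       *)
Definition lpart (x : X) : set P := sum_of (fun x' => @bm_comp _ _ _ _ _ _ _ P (x, x')).
Definition rpart (x' : X') : set P := sum_of (fun x => @bm_comp _ _ _ _ _ _ _ P (x, x')).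

Lemma lpart_dsum : direct_sum lpart.
Proof. exact: coarsen_fst (bm_dsum P). Qed.

Lemma rpart_dsum : direct_sum rpart.
Proof. exact: coarsen_fst (direct_sum_swap (bm_dsum P)). Qed.

Lemma bm_actl g x (a : A) x' (p : P) :
  ga_comp g a -> bm_comp (x, x') p -> bm_comp (gs_act x g^-1%g, x') (a *: p).
Proof.
move=> ag /(bm_act ag (ga_one A')); by rewrite gs_act1 bm_r1.
Qed.

Lemma bm_actr g' x (a : A') x' (p : P) :
  ga_comp g' a -> bm_comp (x, x') p -> bm_comp (x, gs_act x' g') (bm_r p a).
Proof.
move=> ag /(bm_act (ga_one A) ag).
by rewrite -[X in gs_act x X]mul1g mulgV gs_act1 scale1r.
Qed.

Lemma lpart_ind (Q : P -> Prop) x : Q 0 -> (forall p q, Q p -> Q q -> Q (p + q)) ->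
  (forall x' p, bm_comp (x, x') p -> Q p) -> forall p, lpart x p -> Q p.
Proof.
move=> Q0 QD Qh p [s [f [_ Df ->]]].
by elim/big_rec: _ => // i q _; apply: QD; apply: Qh (Df i).
Qed.

Lemma rpart_ind (Q : P -> Prop) x' : Q 0 -> (forall p q, Q p -> Q q -> Q (p + q)) ->
  (forall x p, bm_comp (x, x') p -> Q p) -> forall p, rpart x' p -> Q p.
Proof.
move=> Q0 QD Qh p [s [f [_ Df ->]]].
by elim/big_rec: _ => // i q _; apply: QD; apply: Qh (Df i).
Qed.

Lemma lpart_in x x' p : bm_comp (x, x') p -> lpart x p.
Proof.
move=> h; apply: (@sum_of_in _ _ (fun y => @bm_comp _ _ _ _ _ _ _ P (x, y)) _ x') => // y.
exact: ds0 (bm_dsum P) _.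
Qed.

Lemma rpart_in x x' p : bm_comp (x, x') p -> rpart x' p.
Proof.
move=> h; apply: (@sum_of_in _ _ (fun y => @bm_comp _ _ _ _ _ _ _ P (y, x')) _ x) => // y.
exact: ds0 (bm_dsum P) _.
Qed.

Lemma lpartD x p q : lpart x p -> lpart x q -> lpart x (p + q).
Proof. by apply: dD; [apply: ds0 lpart_dsum|apply: dsB lpart_dsum]. Qed.

Lemma rpartD x p q : rpart x p -> rpart x q -> rpart x (p + q).
Proof. by apply: dD; [apply: ds0 rpart_dsum|apply: dsB rpart_dsum]. Qed.

Lemma bm_r0l a' : @bm_r _ _ _ _ _ _ _ P 0 a' = 0.
Proof. exact: (am0 (@bm_rDl _ _ _ _ _ _ _ P a')). Qed.
Lemma bm_r0r (p : P) : bm_r p 0 = 0.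
Proof. exact: (am0 (@bm_rDr _ _ _ _ _ _ _ P p)). Qed.

Lemma lpart_l g x (a : A) p : ga_comp g a -> lpart x p ->
  lpart (gs_act x g^-1%g) (a *: p).
Proof.
move=> ag; move: p; apply: lpart_ind; first by rewrite scaler0; apply: ds0 lpart_dsum _.
  by move=> q r; rewrite scalerDr; apply: lpartD.
by move=> x' q /(bm_actl ag); apply: lpart_in.
Qed.

Lemma rpart_r g x' (a : A') p : ga_comp g a -> rpart x' p ->
  rpart (gs_act x' g) (bm_r p a).
Proof.
move=> ag; move: p; apply: rpart_ind; first by rewrite bm_r0l; apply: ds0 rpart_dsum _.
  by move=> q r; rewrite bm_rDl; apply: rpartD.
by move=> x q /(bm_actr ag); apply: rpart_in.
Qed.

Lemma lpart_r x (a : A') p : lpart x p -> lpart x (bm_r p a).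
Proof.
move=> xp; move: a; apply: (ds_ind (ga_dsum A')).
- by rewrite bm_r0r; apply: ds0 lpart_dsum _.
- by move=> a b; rewrite bm_rDr; apply: lpartD.
move=> g a ag; move: p xp; apply: lpart_ind.
- by rewrite bm_r0l; apply: ds0 lpart_dsum _.
- by move=> q r; rewrite bm_rDl; apply: lpartD.
by move=> x' q /(bm_actr ag); apply: lpart_in.
Qed.

Lemma rpart_l x' (a : A) p : rpart x' p -> rpart x' (a *: p).
Proof.
move=> xp; move: a; apply: (ds_ind (ga_dsum A)).
- by rewrite scale0r; apply: ds0 rpart_dsum _.
- by move=> a b; rewrite scalerDl; apply: rpartD.
move=> g a ag; move: p xp; apply: rpart_ind.
- by rewrite scaler0; apply: ds0 rpart_dsum _.
- by move=> q r; rewrite scalerDr; apply: rpartD.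
by move=> x q /(bm_actl ag); apply: rpart_in.
Qed.

Definition rmod_of : Type := P.
HB.instance Definition _ := GRing.Zmodule.on rmod_of.

Definition rmod_scale (a' : A'^c) (p : rmod_of) : rmod_of := bm_r (p : P) a'.
Fact rmod_scaleA a b v : rmod_scale a (rmod_scale b v) = rmod_scale (a * b) v.
Proof. by rewrite /rmod_scale -bm_rM. Qed.
Fact rmod_scale1 : left_id 1 rmod_scale.
Proof. by move=> v; apply: bm_r1. Qed.
Fact rmod_scaleDr : right_distributive rmod_scale +%R.
Proof. by move=> a u v; apply: bm_rDl. Qed.
Fact rmod_scaleDl v : {morph rmod_scale^~ v : a b / a + b}.
Proof. by move=> a b; apply: bm_rDr. Qed.
HB.instance Definition _ := GRing.Zmodule_isLmodule.Build A'^c rmod_of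
  rmod_scaleA rmod_scale1 rmod_scaleDr rmod_scaleDl.

Definition bmR : grR A' X' :=
  @GrMod A'^c _ _ _ _ rmod_of rpart rpart_dsum (fun g x a p => @rpart_r g x a p).
Definition bmL : grL A X :=
  @GrMod A _ _ _ _ P lpart lpart_dsum (fun g x a p => @lpart_l g x a p).

End BimodViews.

Record submod (R : pzRingType) (V : lmodType R) := Submod {
  sm_set : set V;
  sm_0 : sm_set 0;
  sm_D : forall u v, sm_set u -> sm_set v -> sm_set (u + v);
  sm_Z : forall a u, sm_set u -> sm_set (a *: u)
}.

Section SubmodType.
Variables (R : pzRingType) (V : lmodType R) (S : submod V).

Definition sm_type : Type := {v : V | v \in sm_set S}.
HB.instance Definition _ := Choice.on sm_type.

Definition sm_val (u : sm_type) : V := sval u.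
Definition sm_mk v (h : sm_set S v) : sm_type := exist _ v (mem_set h).

Lemma sm_valP u : sm_set S (sm_val u).
Proof. by apply: set_mem; apply: (svalP u). Qed.

Lemma sm_val_inj : injective sm_val.
Proof. by move=> u v /val_inj. Qed.

Fact sm_N v : sm_set S v -> sm_set S (- v).
Proof. by rewrite -scaleN1r; apply: sm_Z. Qed.

Definition sm_zero : sm_type := sm_mk (sm_0 S).
Definition sm_add (u v : sm_type) : sm_type := sm_mk (sm_D (sm_valP u) (sm_valP v)).
Definition sm_opp (u : sm_type) : sm_type := sm_mk (sm_N (sm_valP u)).
Definition sm_scale a (u : sm_type) : sm_type := sm_mk (sm_Z a (sm_valP u)).

Fact sm_addA : associative sm_add.
Proof. by move=> u v w; apply: sm_val_inj; apply: addrA. Qed.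
Fact sm_addC : commutative sm_add.
Proof. by move=> u v; apply: sm_val_inj; apply: addrC. Qed.
Fact sm_add0 : left_id sm_zero sm_add.
Proof. by move=> u; apply: sm_val_inj; apply: add0r. Qed.
Fact sm_addN : left_inverse sm_zero sm_opp sm_add.
Proof. by move=> u; apply: sm_val_inj; apply: addNr. Qed.

HB.instance Definition _ :=
  GRing.isZmodule.Build sm_type sm_addA sm_addC sm_add0 sm_addN.

Fact sm_scaleA a b v : sm_scale a (sm_scale b v) = sm_scale (a * b) v.
Proof. by apply: sm_val_inj; apply: scalerA. Qed.
Fact sm_scale1 : left_id 1 sm_scale.
Proof. by move=> v; apply: sm_val_inj; apply: scale1r. Qed.
Fact sm_scaleDr : right_distributive sm_scale +%R.
Proof. by move=> a u v; apply: sm_val_inj; apply: scalerDr. Qed.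
Fact sm_scaleDl v : {morph sm_scale^~ v : a b / a + b}.
Proof. by move=> a b; apply: sm_val_inj; apply: scalerDl. Qed.

HB.instance Definition _ := GRing.Zmodule_isLmodule.Build R sm_type
  sm_scaleA sm_scale1 sm_scaleDr sm_scaleDl.

Lemma sm_valD : {morph sm_val : x y / x + y}. Proof. by []. Qed.
Lemma sm_valZ a u : sm_val (a *: u) = a *: sm_val u. Proof. by []. Qed.

End SubmodType.

Definition finitely_generated (R : pzRingType) (V : lmodType R) : Prop :=
  exists (n : nat) (e : 'I_n -> V), forall v, exists c : 'I_n -> R,
    v = \sum_(i < n) c i *: e i.

Definition projective (R : pzRingType) (V : lmodType R) : Prop :=
  forall (M N : lmodType R) (g : {linear M -> N}) (f : {linear V -> N}),
    (forall y, exists x, g x = y) ->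
    exists h : {linear V -> M}, forall v, g (h v) = f v.

Definition fg_projective (R : pzRingType) (V : lmodType R) : Prop :=
  finitely_generated V /\ projective V.

Section Parts.
Variables (k : comPzRingType) (G G' : groupType).
Variables (A : grAlg k G) (A' : grAlg k G') (X : gset G) (X' : gset G').
Variable (P : grbimod A A' X X').

Definition lpart_sub (x : X) : submod (rmod_of P) :=
  @Submod A'^c (rmod_of P) (@lpart _ _ _ _ _ _ _ P x) (ds0 (lpart_dsum P) x)
    (@lpartD _ _ _ _ _ _ _ P x) (fun a p => @lpart_r _ _ _ _ _ _ _ P x a p).
Definition rpart_sub (x' : X') : submod (bm_car P) :=
  @Submod A (bm_car P) (@rpart _ _ _ _ _ _ _ P x') (ds0 (rpart_dsum P) x')
    (@rpartD _ _ _ _ _ _ _ P x') (fun a p => @rpart_l _ _ _ _ _ _ _ P x' a p).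
End Parts.

Definition rac (A : pzRingType) (M : lmodType A^c) (m : M) (a : A) : M :=
  (a : A^c) *: m.
Definition lac (A : pzRingType) (N : lmodType A) (a : A) (n : N) : N := a *: n.

Definition tensA (A : pzRingType) (M : lmodType A^c) (N : lmodType A) : zmodType :=
  tens (@rac A M) (@lac A N).

Notation tmkA m n := (tmk (@rac _ _) (@lac _ _) m n).

Section HatTensor.
Variables (k : comPzRingType) (G : groupType) (A : grAlg k G) (X : gset G).

Definition tscale (M : lmodType A^c) (N : lmodType A) (c : k) : tensA M N -> tensA M N :=
  tmap (@rac A M) (@lac A N) id (fun n => ga_alg A c *: n).

Definition hat (M : grR A X) (N : grL A X) : set (tensA M N) :=
  kspan (@tscale M N) [set t | exists (x : X) (m : M) (n : N),
    [/\ gm_comp x m, gm_comp x n & t = tmkA m n]].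
Arguments hat : clear implicits.

Section TScale.
Variables (M : lmodType A^c) (N : lmodType A).
Implicit Types c : k.

Fact tscale_bal c (m : M) (a : A) (n : N) :
  tmkA (rac m a) (ga_alg A c *: n) = tmkA m (ga_alg A c *: lac a n).
Proof. by rewrite tmk_bal /lac !scalerA ga_algC. Qed.

Lemma tscale_tmk c (m : M) (n : N) : tscale c (tmkA m n) = tmkA m (ga_alg A c *: n).
Proof. by apply: tmap_tmk => // [x y|??? ]; [rewrite scalerDr|apply: tscale_bal]. Qed.

Lemma tscaleD c : {morph @tscale M N c : x y / x + y}.
Proof. by apply: tmapD => // [x y|??? ]; [rewrite scalerDr|apply: tscale_bal]. Qed.

Lemma tscaleN1 (t : tensA M N) : tscale (-1) t = - t.
Proof.
move: t; apply: tens_ext => [|x y|m n]; first exact: tscaleD.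
  by rewrite opprD.
rewrite tscale_tmk rmorphN rmorph1 scaleN1r.
by apply: (@amN _ _ (tmk _ _ m)) => x y; apply: tmkDr.
Qed.
End TScale.

Variables (G' : groupType) (A' : grAlg k G') (X' : gset G').
Variable (P : grbimod A A' X X').

Section HatObj.
Variable (M : grR A X).

Definition tensP : Type := tensA M (bm_car P).
HB.instance Definition _ := GRing.Zmodule.on tensP.

Definition tensP_scale (a' : A'^c) : tensP -> tensP :=
  tmap (@rac A M) (@lac A (bm_car P)) id (fun p : P => bm_r p a').

Fact tensP_bal a' (m : M) (a : A) (p : P) :
  tmkA (rac m a) (bm_r p a') = tmkA m (bm_r (lac a p) a').
Proof. by rewrite tmk_bal /lac bm_lr. Qed.

Lemma tensP_scale_tmk a' (m : M) (p : P) : tensP_scale a' (tmkA m p) = tmkA m (bm_r p a').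
Proof. by apply: tmap_tmk => // [x y|??? ]; [rewrite bm_rDl|apply: tensP_bal]. Qed.

Lemma tensP_scaleDr a' : {morph tensP_scale a' : x y / x + y}.
Proof. by apply: tmapD => // [x y|??? ]; [rewrite bm_rDl|apply: tensP_bal]. Qed.

Fact tensP_scaleA a b v : tensP_scale a (tensP_scale b v) = tensP_scale (a * b) v.
Proof.
move: v; apply: tens_ext => [x y|x y|m p]; rewrite ?tensP_scaleDr //.
by rewrite !tensP_scale_tmk -bm_rM.
Qed.

Fact tensP_scale1 : left_id 1 tensP_scale.
Proof.
apply: tens_ext => [x y|x y|m p]; rewrite ?tensP_scaleDr //.
by rewrite tensP_scale_tmk bm_r1.
Qed.

Fact tensP_scaleDl v : {morph tensP_scale^~ v : a b / a + b}.
Proof.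
move=> a b; move: v; apply: tens_ext => [x y|x y|m p].
- by rewrite tensP_scaleDr.
- by rewrite !tensP_scaleDr addrACA.
- by rewrite !tensP_scale_tmk bm_rDr tmkDr.
Qed.

HB.instance Definition _ := GRing.Zmodule_isLmodule.Build A'^c tensP
  tensP_scaleA tensP_scale1 (fun a => tensP_scaleDr a) tensP_scaleDl.

Let E : set tensP := [set t | exists (x : X) (m : M) (p : P),
    [/\ gm_comp x m, lpart x p & t = tmkA m p]].

Fact hat_gen_Z c (t : tensP) : E t -> E (tscale c t).
Proof.
move=> [x [m [p [mx px ->]]]]; exists x, m, (ga_alg A c *: p); split=> //.
  have := lpart_l (ga_one_alg A c) px.
  by rewrite -[X in gs_act x X]mul1g mulgV gs_act1.
exact: tscale_tmk.
Qed.

Lemma hat_ind (Q : tensP -> Prop) : Q 0 ->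
  (forall u v, hat M (bmL P) u -> hat M (bmL P) v -> Q u -> Q v -> Q (u + v)) ->
  (forall x m p, gm_comp x m -> lpart x p -> Q (tmkA m p)) ->
  forall u, hat M (bmL P) u -> Q u.
Proof.
move=> Q0 QD QE; apply: (kspan_add_ind (k := k)) => //.
- exact: tscaleD.
- exact: hat_gen_Z.
- by move=> u [x [m [p [mx px ->]]]]; apply: QE mx px.
Qed.

Lemma hat_tmk x (m : M) (p : P) : gm_comp x m -> lpart x p -> hat M (bmL P) (tmkA m p).
Proof. by move=> mx px; apply: kspan_in; exists x, m, p. Qed.

Fact hat_Z (a' : A'^c) (u : tensP) : hat M (bmL P) u -> hat M (bmL P) (a' *: u).
Proof.
move: u; apply: hat_ind => [|u v _ _ hu hv|x m p mx px].
- by rewrite scaler0; apply: kspan0.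
- by rewrite scalerDr; apply: kspanD.
- rewrite [_ *: _]tensP_scale_tmk; apply: hat_tmk mx _; exact: lpart_r.
Qed.

Definition hatP_sub : submod tensP :=
  @Submod A'^c tensP (hat M (bmL P)) (kspan0 _ _) (@kspanD _ _ _ _) hat_Z.

(* (M (x)^_A P)_x' = M (x)^_A P_x', where P_x' is graded by the P_(x, x').    *)
Definition hatP_comp (x' : X') : set (sm_type hatP_sub) :=
  [set u : sm_type hatP_sub | kspan (@tscale M (bm_car P)) [set t | exists (x : X) (m : M) (p : P),
    [/\ gm_comp x m, bm_comp (x, x') p & t = tmkA m p]] (sm_val u)].

Lemma hatc_ind x' (Q : tensP -> Prop) : Q 0 ->
  (forall u v, Q u -> Q v -> Q (u + v)) ->
  (forall x m p, gm_comp x m -> bm_comp (x, x') p -> Q (tmkA m p)) ->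
  forall u, hatP_comp x' u -> Q (sm_val u).
Proof.
move=> Q0 QD QE u; rewrite /hatP_comp /=; move: (sm_val u); apply: (kspan_add_ind (k := k)) => //.
- exact: tscaleD.
- move=> c t [x [m [p [mx px ->]]]]; exists x, m, (ga_alg A c *: p); split=> //.
    have := bm_actl (ga_one_alg A c) px.
    by rewrite -[X in gs_act x X]mul1g mulgV gs_act1.
  exact: tscale_tmk.
- by move=> ????; apply: QD.
- by move=> t [x [m [p [mx px ->]]]]; apply: QE mx px.
Qed.

Fact hatP_comp0 x' : hatP_comp x' 0. Proof. exact: kspan0. Qed.
Fact hatP_compB x' u v : hatP_comp x' u -> hatP_comp x' v -> hatP_comp x' (u - v).
Proof. by move=> hu hv; apply: kspanB => //; apply: tscaleN1. Qed.

Let pr (x' : X') : tensP -> tensP :=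
  tmap (@rac A M) (@lac A (bm_car P)) id (dscomp (@rpart _ _ _ _ _ _ _ P) x').

Lemma rcomp_l x' (a : A) (p : P) :
  dscomp (@rpart _ _ _ _ _ _ _ P) x' (a *: p) = a *: dscomp (@rpart _ _ _ _ _ _ _ P) x' p.
Proof.
have dP := rpart_dsum P.
move: p; apply: (ds_ext dP) => [p q|p q|y p py].
- by rewrite scalerDr dscompD.
- by rewrite dscompD // scalerDr.
- rewrite (dscomp_hom dP _ (rpart_l a py)) (dscomp_hom dP _ py).
  by case: eqP; rewrite ?scaler0.
Qed.

Let prb x' (m : M) (a : A) (p : P) : tmkA (rac m a) (dscomp (@rpart _ _ _ _ _ _ _ P) x' p) =
  tmkA m (dscomp (@rpart _ _ _ _ _ _ _ P) x' (lac a p)).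
Proof. by rewrite tmk_bal /lac rcomp_l. Qed.

Fact hatP_dsum : direct_sum hatP_comp.
Proof.
have dP := rpart_dsum P.
have prD x' : {morph pr x' : x y / x + y}.
  exact: tmapD (fun _ _ => erefl) (dscompD dP x') (@prb x').
have prE x' m p : pr x' (tmkA m p) = tmkA m (dscomp (@rpart _ _ _ _ _ _ _ P) x' p).
  exact: tmap_tmk (fun _ _ => erefl) (dscompD dP x') (@prb x') m p.
apply: (direct_sum_proj hatP_comp0 hatP_compB (vl := @sm_val _ _ _) (pr := pr)) => //.
- move=> u; pose Q t := forall h : hat M (bmL P) t, sum_of hatP_comp (sm_mk (S := hatP_sub) h).
  have e : sm_mk (S := hatP_sub) (sm_valP u) = u by apply: sm_val_inj.
  suff QA : Q (sm_val u) by rewrite -e; apply: QA.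
  apply: hat_ind (sm_valP u) => [h|t v ht hv Qt Qv h|x m p mx px h].
  + have -> : sm_mk (S := hatP_sub) h = 0 by apply: sm_val_inj.
    exact: sum_of0 hatP_comp0.
  + have -> : sm_mk (S := hatP_sub) h
       = sm_mk (S := hatP_sub) ht + sm_mk (S := hatP_sub) hv by apply: sm_val_inj.
    exact: (sum_ofD hatP_comp0 hatP_compB).
  + have [s [f [us Df pE]]] := px.
    have hf i : hat M (bmL P) (tmkA m (f i)) by apply: hat_tmk mx (lpart_in (Df i)).
    have -> : sm_mk (S := hatP_sub) h = \sum_(i <- s) sm_mk (S := hatP_sub) (hf i).
      apply: sm_val_inj; rewrite (am_sum (@sm_valD _ _ _)) /= pE.
      exact: tmk_sumr.
    apply: (sum_of_sum hatP_comp0 hatP_compB) => i _; apply: (sum_of_in hatP_comp0 (i := i)).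
    by apply: kspan_in; exists x, m, (f i).
- exact: sm_val_inj.
- move=> x' y' u hu; move: u hu.
  apply: (hatc_ind (Q := fun t => pr y' t = if x' == y' then t else 0)).
  + by rewrite (am0 (prD y')); case: ifP.
  + by move=> u v hu hv; rewrite prD hu hv; case: ifP => //; rewrite addr0.
  + move=> x m p mx px; rewrite prE (dscomp_hom dP _ (rpart_in px)).
    by case: eqP => // _; apply: tmk0r.
Qed.

Fact hatP_act g (x' : X') (a' : A'^c) (u : sm_type hatP_sub) :
  @ga_comp k G' A' g a' -> hatP_comp x' u -> hatP_comp (gs_act x' g) (a' *: u).
Proof.
move=> ag; move: u.
apply: (hatc_ind (Q := fun t => kspan _ _ (a' *: t))) => [|t v ht hv|x m p mx px].
- by rewrite scaler0; apply: kspan0.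
- by rewrite scalerDr; apply: kspanD.
- rewrite [_ *: _]tensP_scale_tmk; apply: kspan_in; exists x, m, (bm_r p a').
  by split=> //; apply: bm_actr.
Qed.

Definition hatP : grR A' X' := GrMod hatP_dsum hatP_act.

End HatObj.

Section HatMor.
Variables (M N : grR A X) (f : grhom M N).

Definition hatP_fun0 : tensP M -> tensP N :=
  tmap (@rac A N) (@lac A (bm_car P)) f id.

Fact hatP_fun_bal (m : M) (a : A) (p : P) :
  tmkA (f (rac m a)) p = tmkA (f m) (lac a p).
Proof. by rewrite /rac gh_Z -[_ *: _]/(rac (f m) a) tmk_bal. Qed.

Lemma hatP_fun0_tmk (m : M) (p : P) : hatP_fun0 (tmkA m p) = tmkA (f m) p.
Proof. by apply: tmap_tmk => //; [apply: gh_D|apply: hatP_fun_bal]. Qed.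

Lemma hatP_fun0D : {morph hatP_fun0 : x y / x + y}.
Proof. by apply: tmapD => //; [apply: gh_D|apply: hatP_fun_bal]. Qed.

Fact hatP_fun_in u : hat M (bmL P) u -> hat N (bmL P) (hatP_fun0 u).
Proof.
move: u; apply: hat_ind => [|u v _ _ hu hv|x m p mx px].
- by rewrite (am0 hatP_fun0D); apply: kspan0.
- by rewrite hatP_fun0D; apply: kspanD.
- by rewrite hatP_fun0_tmk; apply: hat_tmk px; apply: gh_comp.
Qed.

Definition hatP_fun (u : hatP M) : hatP N :=
  sm_mk (S := hatP_sub N) (hatP_fun_in (sm_valP u)).

Fact hatP_fun_lin : linear hatP_fun.
Proof.
apply: linearP_of => [u v|a u]; apply: sm_val_inj; first exact: hatP_fun0D.
rewrite [LHS]/= [RHS]/=; move: (sm_val u).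
apply: tens_ext => [x y|x y|m p].
- by rewrite [_ *: _]tensP_scaleDr hatP_fun0D.
- by rewrite hatP_fun0D; apply: tensP_scaleDr.
- by rewrite hatP_fun0_tmk [_ *: _]tensP_scale_tmk [RHS]tensP_scale_tmk hatP_fun0_tmk.
Qed.

Fact hatP_fun_comp x' (u : hatP M) : gm_comp x' u -> gm_comp x' (hatP_fun u).
Proof.
move: u; apply: (hatc_ind (Q := fun t => kspan _ _ (hatP_fun0 t))) => [|t v ht hv|x m p mx px].
- by rewrite (am0 hatP_fun0D); apply: kspan0.
- by rewrite hatP_fun0D; apply: kspanD.
- rewrite hatP_fun0_tmk; apply: kspan_in; exists x, (f m), p; split=> //.
  exact: gh_comp.
Qed.

Definition hatP_hom : grhom (hatP M) (hatP N) := GrHom hatP_fun_lin hatP_fun_comp.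
End HatMor.

Fact hatP_hom_id (M : grR A X) : hatP_hom (grhom_id M) = grhom_id (hatP M).
Proof.
apply: grhom_eq => u; apply: sm_val_inj => /=; move: (sm_val u).
apply: tens_ext => [x y|//|m p]; first by rewrite hatP_fun0D.
exact: (hatP_fun0_tmk (grhom_id M)).
Qed.

Fact hatP_hom_cmp (M N Q : grR A X) (g : grhom N Q) (f : grhom M N) :
  hatP_hom (grhom_cmp g f) = grhom_cmp (hatP_hom g) (hatP_hom f).
Proof.
apply: grhom_eq => u; apply: sm_val_inj => /=; move: (sm_val u).
apply: tens_ext => [x y|x y|m p]; rewrite ?hatP_fun0D //.
by rewrite !hatP_fun0_tmk.
Qed.

Definition tensor_functor : functor (grR_cat A X) (grR_cat A' X') :=
  @Functor (grR_cat A X) (grR_cat A' X') hatP hatP_hom hatP_hom_id hatP_hom_cmp.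

End HatTensor.
Arguments hat {k G A X} M N _.

Section HatHom.
Variables (R : pzRingType) (I : Type) (Rh : I -> set R).
Variables (X : choiceType) (act : X -> I -> X).
Variables (P M : grmod Rh act) (Y : choiceType) (D : Y -> set P).

Record hatHom := HatHom {
  hh :> grhom P M;
  hh_fin : finite_set [set y | ~ forall p, D y p -> hh p = 0]
}.

Lemma hh_eq (f g : hatHom) : (forall p, f p = g p) -> f = g.
Proof.
case: f g => [f ff] [g gf] /= /grhom_eq e; case: _ / e in gf *.
by congr HatHom; apply: Prop_irrelevance.
Qed.

HB.instance Definition _ := gen_eqMixin hatHom.
HB.instance Definition _ := gen_choiceMixin hatHom.

Definition grhom_zero : grhom P M.
Proof.
exists (fun=> 0); first by move=> a x y; rewrite scaler0 addr0.
by move=> x m _; apply: ds0 (gm_dsum M) _.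
Defined.

Definition grhom_opp (f : grhom P M) : grhom P M.
Proof.
exists (fun p => - f p); first by move=> a x y; rewrite gh_lin opprD scalerN.
move=> x m xm; apply: dN; [exact: ds0 (gm_dsum M)|exact: dsB (gm_dsum M)|exact: gh_comp].
Defined.

Definition grhom_add (f g : grhom P M) : grhom P M.
Proof.
exists (fun p => f p + g p).
  by move=> a x y; rewrite !gh_lin scalerDr addrACA.
move=> x m xm; apply: dD; [exact: ds0 (gm_dsum M)|exact: dsB (gm_dsum M)|exact: gh_comp..].
Defined.

Definition hh_zero : hatHom.
Proof.
exists grhom_zero; rewrite (_ : [set _ | _] = set0) //.
by apply/seteqP; split=> // y /=; apply.
Defined.

Definition hh_opp (f : hatHom) : hatHom.
Proof.
exists (grhom_opp f); apply: sub_finite_set (hh_fin f) => y /= h h'; apply: h => p yp.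
by rewrite h' ?oppr0.
Defined.

Definition hh_add (f g : hatHom) : hatHom.
Proof.
exists (grhom_add f g).
apply: (sub_finite_set _ (B := [set y | ~ forall p, D y p -> f p = 0] `|`
                              [set y | ~ forall p, D y p -> g p = 0])); last first.
  by rewrite finite_setU; split; apply: hh_fin.
move=> y /= h; apply: contrapT => /not_orP[/contrapT hf /contrapT hg].
by apply: h => p yp; rewrite hf // hg // addr0.
Defined.

Fact hh_addA : associative hh_add.
Proof. by move=> f g h; apply: hh_eq => p; apply: addrA. Qed.
Fact hh_addC : commutative hh_add.
Proof. by move=> f g; apply: hh_eq => p; apply: addrC. Qed.
Fact hh_add0 : left_id hh_zero hh_add.
Proof. by move=> f; apply: hh_eq => p; apply: add0r. Qed.
Fact hh_addN : left_inverse hh_zero hh_opp hh_add.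
Proof. by move=> f; apply: hh_eq => p; apply: addNr. Qed.

HB.instance Definition _ := GRing.isZmodule.Build hatHom hh_addA hh_addC hh_add0 hh_addN.

Lemma hh_addE (f g : hatHom) p : (f + g) p = f p + g p. Proof. by []. Qed.
Lemma hh_zeroE p : (0 : hatHom) p = 0. Proof. by []. Qed.
Lemma hh_oppE (f : hatHom) p : (- f) p = - f p. Proof. by []. Qed.
Lemma hh_sumE J (s : seq J) (Q : pred J) (F : J -> hatHom) p :
  (\sum_(j <- s | Q j) F j) p = \sum_(j <- s | Q j) F j p.
Proof. exact: (@am_sum _ _ (fun f : hatHom => f p)). Qed.

End HatHom.

Section HFunctor.
Variables (k : comPzRingType) (G G' : groupType).
Variables (A : grAlg k G) (A' : grAlg k G') (X : gset G) (X' : gset G').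
Variable (P : grbimod A A' X X').

Lemma lcomp_r x (a : A') (p : P) :
  dscomp (@lpart _ _ _ _ _ _ _ P) x (bm_r p a) = bm_r (dscomp (@lpart _ _ _ _ _ _ _ P) x p) a.
Proof.
have dP := lpart_dsum P.
move: p; apply: (ds_ext dP) => [p q|p q|y p py].
- by rewrite bm_rDl dscompD.
- by rewrite dscompD // bm_rDl.
- rewrite (dscomp_hom dP _ (lpart_r a py)) (dscomp_hom dP _ py).
  by case: eqP; rewrite ?bm_r0l.
Qed.

Lemma lcomp_rpart x x' (p : P) : rpart x' p -> rpart x' (dscomp (@lpart _ _ _ _ _ _ _ P) x p).
Proof.
have dP := lpart_dsum P; move: p; apply: rpart_ind.
- by rewrite (am0 (dscompD dP x)); apply: ds0 (rpart_dsum P) _.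
- by move=> p q hp hq; rewrite dscompD //; apply: rpartD.
- move=> y p yp; rewrite (dscomp_hom dP _ (lpart_in yp)); case: ifP => _.
    exact: rpart_in yp.
  exact: ds0 (rpart_dsum P) _.
Qed.

Lemma rcomp_lpart x' x (p : P) : lpart x p -> lpart x (dscomp (@rpart _ _ _ _ _ _ _ P) x' p).
Proof.
have dP := rpart_dsum P; move: p; apply: lpart_ind.
- by rewrite (am0 (dscompD dP x')); apply: ds0 (lpart_dsum P) _.
- by move=> p q hp hq; rewrite dscompD //; apply: lpartD.
- move=> y p yp; rewrite (dscomp_hom dP _ (rpart_in yp)); case: ifP => _.
    exact: lpart_in yp.
  exact: ds0 (lpart_dsum P) _.
Qed.

Section HObj.
Variable M' : grR A' X'.

Definition Hom_hat : Type := @hatHom _ _ _ _ _ (bmR P) M' X (@lpart _ _ _ _ _ _ _ P).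
HB.instance Definition _ := GRing.Zmodule.on Hom_hat.

Lemma hhD (f : Hom_hat) : {morph (f : P -> M') : p q / p + q}.
Proof. exact: (gh_D (hh f)). Qed.

Definition H_scale_gr (a : A) (f : Hom_hat) : grhom (bmR P) M'.
Proof.
exists (fun p : P => f (a *: p)).
  move=> a' p q; rewrite -gh_lin /=; congr (gh_fun (hh f) _).
  by rewrite scalerDr; congr (_ + _); rewrite [LHS]/= /GRing.scale /= /rmod_scale bm_lr.
by move=> x' p px; apply: gh_comp; apply: (rpart_l a px).
Defined.

Fact H_scale_fin a (f : Hom_hat) :
  finite_set [set x | ~ forall p, @lpart _ _ _ _ _ _ _ P x p -> H_scale_gr a f p = 0].
Proof.
have [ua sa aE] := dssuppP (ga_dsum A) a.
set s := dssupp _ a in ua sa aE.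
pose F := [set x | ~ forall p, @lpart _ _ _ _ _ _ _ P x p -> f p = 0].
apply: (sub_finite_set (B := \bigcup_(g in [set` s]) ((fun y => gs_act y g) @` F))).
  move=> x /= h; apply: contrapT => h'; apply: h => p xp.
  rewrite aE scaler_suml (am_sum (hhD f)) big_seq big1 // => g gs.
  apply: contrapT => fp; apply: h'; exists g => //.
  exists (gs_act x g^-1%g); last by rewrite gs_actVK.
  move=> h; apply: fp; apply: h; apply: lpart_l xp.
  exact: dscomp_in (ga_dsum A) _ _.
apply: bigcup_finite; first exact: finite_seq.
by move=> g _; apply: finite_image; exact: (hh_fin f).
Qed.

Definition H_scale (a : A^c) (f : Hom_hat) : Hom_hat :=
  @HatHom _ _ _ _ _ (bmR P) M' X (@lpart _ _ _ _ _ _ _ P)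
    (H_scale_gr a f) (H_scale_fin a f).

Fact H_scaleA a b f : H_scale a (H_scale b f) = H_scale (a * b) f.
Proof. by apply: hh_eq => p /=; rewrite scalerA. Qed.
Fact H_scale1 : left_id 1 H_scale.
Proof. by move=> f; apply: hh_eq => p /=; rewrite scale1r. Qed.
Fact H_scaleDr : right_distributive H_scale +%R.
Proof. by move=> a f g; apply: hh_eq => p. Qed.
Fact H_scaleDl f : {morph H_scale^~ f : a b / a + b}.
Proof. by move=> a b; apply: hh_eq => p /=; rewrite scalerDl hhD. Qed.

HB.instance Definition _ := GRing.Zmodule_isLmodule.Build A^c Hom_hat
  H_scaleA H_scale1 H_scaleDr H_scaleDl.

Definition H_comp (x : X) : set Hom_hat :=
  [set f : Hom_hat | forall y, y != x -> forall p, @lpart _ _ _ _ _ _ _ P y p -> f p = 0].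

Fact H_comp0 x : H_comp x 0. Proof. by []. Qed.
Fact H_compB x f g : H_comp x f -> H_comp x g -> H_comp x (f - g).
Proof. by move=> hf hg y yx p yp; rewrite hh_addE hh_oppE (hf y) // (hg y) // subr0. Qed.

Definition H_proj_gr (x : X) (f : Hom_hat) : grhom (bmR P) M'.
Proof.
exists (fun p : P => f (dscomp (@lpart _ _ _ _ _ _ _ P) x p)).
  move=> a' p q; rewrite -gh_lin /=; congr (gh_fun (hh f) _).
  by rewrite (dscompD (lpart_dsum P)); congr (_ + _); apply: lcomp_r.
by move=> x' p px; apply: gh_comp; apply: (lcomp_rpart x px).
Defined.

Fact H_proj_fin x f :
  finite_set [set y | ~ forall p, @lpart _ _ _ _ _ _ _ P y p -> H_proj_gr x f p = 0].
Proof.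
apply: (sub_finite_set (B := [set x])); last exact: finite_set1.
move=> y /= h; apply: contrapT => yx; apply: h => p yp.
rewrite (dscomp_hom (lpart_dsum P) x yp); case: eqP => // _; exact: am0 (hhD f).
Qed.

Definition H_proj x f : Hom_hat :=
  @HatHom _ _ _ _ _ (bmR P) M' X (@lpart _ _ _ _ _ _ _ P)
    (H_proj_gr x f) (H_proj_fin x f).

Fact H_dsum : direct_sum H_comp.
Proof.
have dP := lpart_dsum P.
apply: (direct_sum_proj H_comp0 H_compB (vl := id) (pr := H_proj)) => // [f|x f g|x y f fx].
- have /finite_seqP[s sE] := hh_fin f.
  have -> : f = \sum_(x <- undup s) H_proj x f.
    apply: hh_eq => p; rewrite hh_sumE /=.
    have [up sp pE] := dssuppP dP p.
    rewrite {1}pE (am_sum (hhD f)).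
    pose t := undup (s ++ dssupp (@lpart _ _ _ _ _ _ _ P) p).
    have h (r : seq X) : uniq r -> {subset r <= t} ->
      (forall x, x \notin r -> f (dscomp (@lpart _ _ _ _ _ _ _ P) x p) = 0) ->
      \sum_(x <- r) f (dscomp (@lpart _ _ _ _ _ _ _ P) x p) =
      \sum_(x <- t) f (dscomp (@lpart _ _ _ _ _ _ _ P) x p).
      move=> ur rt r0.
      rewrite (big_widen (fun x => f (dscomp (@lpart _ _ _ _ _ _ _ P) x p)) ur (undup_uniq _) rt).
      by apply: eq_bigr => x _; case: ifP => // /negbT/r0 ->.
    rewrite h //; first rewrite [RHS]h //.
    + exact: undup_uniq.
    + by move=> x; rewrite !mem_undup mem_cat => ->.
    + move=> x; rewrite mem_undup => xs; apply: contrapT => fx.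
      have : [set` s] x; last by rewrite /= (negbTE xs).
      by rewrite -sE /= => h'; apply: fx; apply: h'; apply: dscomp_in dP _ _.
    + by move=> x; rewrite !mem_undup mem_cat => ->; rewrite orbT.
    + by move=> x /sp ->; apply: am0 (hhD f).
  apply: (sum_of_sum H_comp0 H_compB) => x _; apply: (sum_of_in H_comp0 (i := x)).
  move=> y yx p yp /=; rewrite (dscomp_hom dP x yp) (negbTE yx); exact: am0 (hhD f).
- by apply: hh_eq => p.
- apply: hh_eq => p /=.
  have [_ _ pE] := dssuppP dP p.
  have cE y' : f (dscomp (@lpart _ _ _ _ _ _ _ P) y' p) =
     if x == y' then f p else 0.
    have fy z : z != x -> f (dscomp (@lpart _ _ _ _ _ _ _ P) z p) = 0.
      by move=> zx; apply: (fx z zx); apply: dscomp_in dP _ _.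
    have [<-|xy] := eqVneq x y'; last by apply: fy; rewrite eq_sym.
    rewrite {2}pE (am_sum (hhD f)).
    have [up sp _] := dssuppP dP p.
    have [xs|xs] := boolP (x \in dssupp (@lpart _ _ _ _ _ _ _ P) p).
      by rewrite (bigD1_seq x) //= big1 ?addr0.
    rewrite (sp _ xs) (am0 (hhD f)) big_seq big1 // => z zs; apply: fy.
    by apply: contraNneq xs => <-.
  by rewrite cE; case: ifP.
Qed.

Fact H_act g x (a : A^c) (f : Hom_hat) :
  @ga_comp k G A g a -> H_comp x f -> H_comp (gs_act x g) (a *: f).
Proof.
move=> ag fx y yx p yp; apply: (fx (gs_act y g^-1%g)); last exact: lpart_l yp.
by apply: contraNneq yx => <-; rewrite gs_actVK.
Qed.

Definition H_obj : grR A X := GrMod H_dsum H_act.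

End HObj.

Section HMor.
Variables (M N : grR A' X') (u : grhom M N).

Fact H_fun_fin (f : Hom_hat M) : finite_set
  [set x | ~ forall p, @lpart _ _ _ _ _ _ _ P x p -> grhom_cmp u f p = 0].
Proof.
apply: sub_finite_set (hh_fin f) => x /= h h'; apply: h => p xp.
by rewrite h' // (am0 (gh_D u)).
Qed.

Definition H_fun (f : H_obj M) : H_obj N :=
  @HatHom _ _ _ _ _ (bmR P) N X (@lpart _ _ _ _ _ _ _ P)
    (grhom_cmp u (hh f)) (H_fun_fin f).

Fact H_fun_lin : linear H_fun.
Proof. by move=> a f g; apply: hh_eq => p /=; rewrite gh_D. Qed.

Fact H_fun_comp x (f : H_obj M) : gm_comp x f -> gm_comp x (H_fun f).
Proof. by move=> fx y yx p yp /=; rewrite (fx y yx p yp) (am0 (gh_D u)). Qed.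

Definition H_hom : grhom (H_obj M) (H_obj N) := GrHom H_fun_lin H_fun_comp.
End HMor.

Fact H_hom_id M : H_hom (grhom_id M) = grhom_id (H_obj M).
Proof. by apply: grhom_eq => f; apply: hh_eq. Qed.

Fact H_hom_cmp (M N Q : grR A' X') (g : grhom N Q) (f : grhom M N) :
  H_hom (grhom_cmp g f) = grhom_cmp (H_hom g) (H_hom f).
Proof. by apply: grhom_eq => h; apply: hh_eq. Qed.

Definition H_functor : functor (grR_cat A' X') (grR_cat A X) :=
  @Functor (grR_cat A' X') (grR_cat A X) H_obj H_hom H_hom_id H_hom_cmp.

Section Eval.
Variable M' : grR A' X'.

Definition ev0 : tensP P (H_obj M') -> M' := tlift (fun (f : Hom_hat M') (p : P) => f p).

Fact ev0D : {morph ev0 : x y / x + y}.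
Proof. by apply: tliftD => // f p q; apply: hhD. Qed.

Fact ev0_tmk (f : H_obj M') (p : P) : ev0 (tmkA f p) = hh f p.
Proof. by apply: (@tlift_tmk A (H_obj M') P) => // g q r; apply: hhD. Qed.

Definition evf (u : hatP P (H_obj M')) : M' := ev0 (sm_val u).

Fact evf_lin : linear evf.
Proof.
apply: linearP_of => [u v|a u]; first exact: ev0D.
rewrite /evf sm_valZ; move: (sm_val u); apply: tens_ext => [x y|x y|f p].
- by rewrite [_ *: _]tensP_scaleDr ev0D.
- by rewrite ev0D scalerDr.
- have -> : (a *: (tmkA f p : tensP P (H_obj M'))) = tmkA f (bm_r p a).
    exact: tensP_scale_tmk.
  rewrite !ev0_tmk.
  exact: (gh_Z (f : Hom_hat M') (a : A'^c) (p : bmR P)).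
Qed.

Fact evf_comp x' (u : hatP P (H_obj M')) : gm_comp x' u -> gm_comp x' (evf u).
Proof.
move: u; apply: (hatc_ind (Q := fun t => gm_comp x' (ev0 t))) => [|u v|x f p fx px].
- by rewrite (am0 ev0D); apply: ds0 (gm_dsum M') _.
- rewrite ev0D; apply: dD; [exact: ds0 (gm_dsum M')|exact: dsB (gm_dsum M')].
- by rewrite ev0_tmk; apply: gh_comp; apply: rpart_in px.
Qed.

Definition ev : grhom (hatP P (H_obj M')) M' := GrHom evf_lin evf_comp.
End Eval.

End HFunctor.

Section FreeModule.
Variables (k : comPzRingType) (X : choiceType).

Fact free_fin0 : finite_set [set x : X | (0 : X -> k^o) x != 0].
Proof.
rewrite (_ : [set _ | _] = set0) //.
by apply/seteqP; split=> // x /=; rewrite eqxx.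
Qed.

Fact free_finD (u v : X -> k^o) : finite_set [set x | u x != 0] ->
  finite_set [set x | v x != 0] -> finite_set [set x | (u + v) x != 0].
Proof.
move=> fu fv; apply: (sub_finite_set _ (B := [set x | u x != 0] `|` [set x | v x != 0])).
  move=> x /= uv; apply: contrapT => /not_orP[/negP/negPn/eqP u0 /negP/negPn/eqP v0].
  by move: uv; rewrite /GRing.add /= u0 v0 addr0 eqxx.
by rewrite finite_setU.
Qed.

Fact free_finZ (a : k) (u : X -> k^o) :
  finite_set [set x | u x != 0] -> finite_set [set x | (a *: u) x != 0].
Proof.
apply: sub_finite_set => x /=; apply: contra => /eqP u0.
by rewrite /GRing.scale /= u0 scaler0.
Qed.

Definition free_sub : submod (X -> k^o) :=
  @Submod k (X -> k^o) [set u | finite_set [set x | u x != 0]]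
    free_fin0 free_finD free_finZ.
Definition kfree : lmodType k := sm_type free_sub.

Definition coef (v : kfree) (x : X) : k := sm_val v x.

Lemma coefD x : {morph coef^~ x : u v / u + v}. Proof. by []. Qed.
Lemma coefZ c v x : coef (c *: v) x = c * coef v x. Proof. by []. Qed.
Lemma coef_inj u v : coef u =1 coef v -> u = v.
Proof. by move=> e; apply: sm_val_inj; apply/funext. Qed.

Fact kbase_fin (x : X) : sm_set free_sub (fun y => if y == x then 1 else 0).
Proof.
apply: (sub_finite_set (B := [set x])); last exact: finite_set1.
by move=> y /=; have [->|yx] := eqVneq y x => //; rewrite eqxx.
Qed.

Definition kbase (x : X) : kfree := sm_mk (kbase_fin x).

Lemma coef_base x y : coef (kbase x) y = if y == x then 1 else 0.
Proof. by []. Qed.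

Lemma kfree_ind (Q : kfree -> Prop) : Q 0 -> (forall u v, Q u -> Q v -> Q (u + v)) ->
  (forall c x, Q (c *: kbase x)) -> forall v, Q v.
Proof.
move=> Q0 QD Qb v; have /finite_seqP[s sE] : finite_set [set x | coef v x != 0] := sm_valP v.
have -> : v = \sum_(x <- undup s) coef v x *: kbase x.
  apply: coef_inj => y; rewrite (am_sum (coefD y)).
  under eq_bigr do rewrite coefZ coef_base.
  have [ys|ys] := boolP (y \in undup s).
    rewrite (bigD1_seq y) ?undup_uniq //= eqxx mulr1 big1 ?addr0 // => x.
    by rewrite eq_sym => /negbTE ->; rewrite mulr0.
  rewrite big_seq big1 => [|x xs].
    apply/eqP/negPn/negP => vy; have : [set` s] y by rewrite -sE.
    by rewrite /= -mem_undup (negbTE ys).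
  by case: eqP => [e|]; rewrite ?mulr0 //; rewrite e xs in ys.
by elim/big_rec: _ => // x u _; apply: QD; apply: Qb.
Qed.

Lemma kfree_ext (W : zmodType) (f g : kfree -> W) :
  {morph f : x y / x + y} -> {morph g : x y / x + y} ->
  (forall c x, f (c *: kbase x) = g (c *: kbase x)) -> f =1 g.
Proof.
move=> fD gD fg; apply: kfree_ind => [|u v|//]; first by rewrite !am0.
by rewrite fD gD => -> ->.
Qed.

End FreeModule.

Section KShift.
Variables (k : comPzRingType) (G : groupType) (X : gset G).

Fact kshift_fin g (v : kfree k X) :
  sm_set (free_sub k X) (fun x => coef v (gs_act x g^-1%g)).
Proof.
apply: (sub_finite_set (B := (fun x => gs_act x g) @` [set x | coef v x != 0])).
  by move=> x /= h; exists (gs_act x g^-1%g) => //; rewrite gs_actVK.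
by apply: finite_image; apply: (sm_valP v).
Qed.

Definition kshift g (v : kfree k X) : kfree k X := sm_mk (kshift_fin g v).

Lemma kshiftD g : {morph kshift g : u v / u + v}.
Proof. by move=> u v; apply: coef_inj. Qed.
Lemma kshiftZ g c v : kshift g (c *: v) = c *: kshift g v.
Proof. by apply: coef_inj. Qed.
Lemma kshift1 v : kshift 1%g v = v.
Proof.
by apply: coef_inj => x; rewrite /coef /= -[X in gs_act x X]mul1g mulgV gs_act1.
Qed.
Lemma kshiftM g h v : kshift (g * h)%g v = kshift h (kshift g v).
Proof. by apply: coef_inj => x; rewrite /coef /= invgM gs_actM. Qed.
Lemma kshift_base g x : kshift g (kbase k x) = kbase k (gs_act x g).
Proof.
apply: coef_inj => y; rewrite /coef /=.
by rewrite -(inj_eq (can_inj (gs_actK g)) _ x) gs_actVK.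
Qed.
End KShift.

Section Ahat.
Variables (k : comPzRingType) (G : groupType) (A : grAlg k G) (X : gset G).

Definition kra (a : A) (c : k) : A := a * ga_alg A c.
Definition kla (c : k) (v : kfree k X) : kfree k X := c *: v.

Definition Ahat_type : Type := tens kra kla.
HB.instance Definition _ := GRing.Zmodule.on Ahat_type.

Local Notation "a ** v" := (tmk kra kla a v : Ahat_type) (at level 40).

Definition Ahat_scale (b : A) : Ahat_type -> Ahat_type :=
  tmap kra kla (fun a => b * a) id.

Fact Ahat_scale_bal b a c v : (b * kra a c) ** v = (b * a) ** kla c v.
Proof. by rewrite -tmk_bal /kra mulrA. Qed.
Lemma Ahat_scale_tmk b a v : Ahat_scale b (a ** v) = (b * a) ** v.
Proof. exact: tmap_tmk (mulrDr b) (fun _ _ => erefl) (Ahat_scale_bal b) a v. Qed.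
Fact Ahat_scaleDr : right_distributive Ahat_scale +%R.
Proof. by move=> b; apply: tmapD (mulrDr b) (fun _ _ => erefl) (Ahat_scale_bal b). Qed.
Fact Ahat_scaleA a b t : Ahat_scale a (Ahat_scale b t) = Ahat_scale (a * b) t.
Proof.
move: t; apply: tens_ext => [x y|x y|c v]; rewrite ?Ahat_scaleDr //.
by rewrite !Ahat_scale_tmk mulrA.
Qed.
Fact Ahat_scale1 : left_id 1 Ahat_scale.
Proof.
apply: tens_ext => [x y|x y|c v]; rewrite ?Ahat_scaleDr //.
by rewrite !Ahat_scale_tmk mul1r.
Qed.
Fact Ahat_scaleDl t : {morph Ahat_scale^~ t : a b / a + b}.
Proof.
move=> a b; move: t; apply: tens_ext => [x y|x y|c v]; rewrite ?Ahat_scaleDr //.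
  by rewrite addrACA.
by rewrite !Ahat_scale_tmk mulrDl tmkDl.
Qed.
HB.instance Definition _ := GRing.Zmodule_isLmodule.Build A Ahat_type
  Ahat_scaleA Ahat_scale1 Ahat_scaleDr Ahat_scaleDl.

Definition Ahat_rh (t : Ahat_type) (g : G) (b : A) : Ahat_type :=
  tmap kra kla (fun a => a * b) (@kshift k G X g) t.

(* (a (x) v) b = a b (x) v g for b of degree g, extended additively in b.     *)
Definition Ahat_r (t : Ahat_type) (b : A) : Ahat_type :=
  dsext (@ga_comp k G A) (Ahat_rh t) b.

Section AhatR.
Implicit Types (a b : A) (t : Ahat_type).

Fact Ahat_rh_bal g b a c v :
  (kra a c * b) ** kshift g v = (a * b) ** kshift g (kla c v).
Proof. by rewrite /kla kshiftZ -/(kla _ _) -tmk_bal /kra -!mulrA ga_algC. Qed.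
Lemma Ahat_rh_tmk g b a v : Ahat_rh (a ** v) g b = (a * b) ** kshift g v.
Proof.
exact: tmap_tmk (fun x y => mulrDl x y b) (@kshiftD k G X g) (Ahat_rh_bal g b) a v.
Qed.
Lemma Ahat_rhDl g b : {morph (fun t => Ahat_rh t g b) : t u / t + u}.
Proof.
exact: tmapD (fun x y => mulrDl x y b) (@kshiftD k G X g) (Ahat_rh_bal g b).
Qed.
Lemma Ahat_rhDr t g : {morph Ahat_rh t g : a b / a + b}.
Proof.
move=> a b; move: t; apply: tens_ext => [x y|x y|c v]; rewrite ?Ahat_rhDl //.
  by rewrite addrACA.
by rewrite !Ahat_rh_tmk mulrDr tmkDl.
Qed.

Lemma Ahat_r_hom t g b : ga_comp g b -> Ahat_r t b = Ahat_rh t g b.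
Proof. by move=> gb; apply: (dsext_hom (ga_dsum A) _ gb) => h; apply: Ahat_rhDr. Qed.

Lemma Ahat_r_tmk g b a x : ga_comp g b ->
  Ahat_r (a ** kbase k x) b = (a * b) ** kbase k (gs_act x g).
Proof. by move=> gb; rewrite (Ahat_r_hom _ gb) Ahat_rh_tmk kshift_base. Qed.

Fact Ahat_rDl b : {morph Ahat_r^~ b : t u / t + u}.
Proof. by move=> t u; rewrite /Ahat_r /dsext -big_split; apply: eq_bigr => g _; apply: Ahat_rhDl. Qed.
Fact Ahat_rDr t : {morph Ahat_r t : a b / a + b}.
Proof. by apply: (dsextD (ga_dsum A)) => g; apply: Ahat_rhDr. Qed.
Fact Ahat_r1 t : Ahat_r t 1 = t.
Proof.
rewrite (Ahat_r_hom _ (ga_one A)); move: t; apply: tens_ext => [x y|//|c v].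
  exact: Ahat_rhDl.
by rewrite Ahat_rh_tmk mulr1 kshift1.
Qed.
Fact Ahat_rM t a b : Ahat_r t (a * b) = Ahat_r (Ahat_r t a) b.
Proof.
move: a; apply: (ds_ext (ga_dsum A)) => [a c|a c|g a ga].
- by rewrite mulrDl Ahat_rDr.
- by rewrite Ahat_rDr Ahat_rDl.
move: b; apply: (ds_ext (ga_dsum A)) => [b c|b c|h b hb].
- by rewrite mulrDr Ahat_rDr.
- by rewrite Ahat_rDr.
rewrite (Ahat_r_hom _ (ga_compM ga hb)) (Ahat_r_hom _ ga) (Ahat_r_hom _ hb).
move: t; apply: tens_ext => [x y|x y|c v]; rewrite ?Ahat_rhDl //.
by rewrite !Ahat_rh_tmk mulrA kshiftM.
Qed.
Fact Ahat_lr a t b : Ahat_r (a *: t) b = a *: Ahat_r t b.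
Proof.
move: b; apply: (ds_ext (ga_dsum A)) => [b c|b c|h b hb].
- by rewrite Ahat_rDr.
- by rewrite Ahat_rDr scalerDr.
rewrite !(Ahat_r_hom _ hb).
move: t; apply: tens_ext => [x y|x y|c v].
- by rewrite scalerDr Ahat_rhDl.
- by rewrite Ahat_rhDl scalerDr.
- rewrite [_ *: _]Ahat_scale_tmk !Ahat_rh_tmk [RHS]Ahat_scale_tmk.
  by rewrite mulrA.
Qed.
Fact Ahat_k c t : Ahat_r t (ga_alg A c) = ga_alg A c *: t.
Proof.
rewrite (Ahat_r_hom _ (ga_one_alg A c)); move: t; apply: tens_ext => [x y|x y|a v].
- exact: Ahat_rhDl.
- exact: scalerDr.
- by rewrite Ahat_rh_tmk kshift1 [RHS]Ahat_scale_tmk ga_algC.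
Qed.

Definition Ahat_comp (z : X * X) : set Ahat_type :=
  kspan (fun c (t : Ahat_type) => ga_alg A c *: t)
    [set t | exists (g : G) (a : A),
      [/\ ga_comp g a, gs_act z.2 g^-1%g = z.1 & t = a ** kbase k z.2]].

Lemma Ahat_comp_ind z (Q : Ahat_type -> Prop) : Q 0 ->
  (forall t u, Q t -> Q u -> Q (t + u)) ->
  (forall g a, ga_comp g a -> gs_act z.2 g^-1%g = z.1 -> Q (a ** kbase k z.2)) ->
  forall t, Ahat_comp z t -> Q t.
Proof.
move=> Q0 QD Qg; apply: (kspan_add_ind (k := k)) => //.
- by move=> c x y; apply: scalerDr.
- move=> c t [g [a [ga e ->]]]; exists g, (ga_alg A c * a); split=> //.
    exact: ga_compZ.
  exact: Ahat_scale_tmk.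
- by move=> t u _ _; apply: QD.
- by move=> t [g [a [ga e ->]]]; apply: Qg ga e.
Qed.

Lemma Ahat_comp_tmk g a x : ga_comp g a ->
  Ahat_comp (gs_act x g^-1%g, x) (a ** kbase k x).
Proof. by move=> ga; apply: kspan_in; exists g, a. Qed.

Fact Ahat_comp0 z : Ahat_comp z 0. Proof. exact: kspan0. Qed.
Fact Ahat_compB z t u : Ahat_comp z t -> Ahat_comp z u -> Ahat_comp z (t - u).
Proof.
move=> ht hu; apply: kspanB => // v.
by rewrite rmorphN rmorph1 scaleN1r.
Qed.

Fact Ahat_dsum : direct_sum Ahat_comp.
Proof.
pose F (z : X * X) (g : G) (a : A) := if gs_act z.2 g^-1%g == z.1 then a else 0.
have FD z g : {morph F z g : a b / a + b}.
  by move=> a b; rewrite /F; case: ifP => // _; rewrite addr0.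
pose q z (a : A) : A := dsext (@ga_comp k G A) (F z) a.
have qD z : {morph q z : a b / a + b} by apply: (dsextD (ga_dsum A)).
have qh z g a : ga_comp g a -> q z a = F z g a by apply: (dsext_hom (ga_dsum A)).
have qZ z c a : q z (kra a c) = kra (q z a) c.
  move: a; apply: (ds_ext (ga_dsum A)) => [a b|a b|g a ga].
  - by rewrite /kra mulrDl qD.
  - by rewrite qD /kra mulrDl.
  - have gc : ga_comp g (kra a c) by rewrite /kra -ga_algC; apply: ga_compZ.
    by rewrite (qh _ _ _ gc) (qh _ _ _ ga) /F /kra; case: ifP => // _; rewrite mul0r.
pose b z (a : A) (v : kfree k X) : Ahat_type := kra (q z a) (coef v z.2) ** kbase k z.2.
have bDl z v : {morph (b z)^~ v : x y / x + y}.
  by move=> x y; rewrite /b qD /kra mulrDl tmkDl.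
have bDr z a : {morph b z a : x y / x + y}.
  by move=> x y; rewrite /b coefD /kra rmorphD mulrDr tmkDl.
have bb z a c v : b z (kra a c) v = b z a (kla c v).
  by rewrite /b qZ /kla coefZ /kra rmorphM mulrA.
pose pr z : Ahat_type -> Ahat_type := tlift (b z).
have prD z : {morph pr z : x y / x + y} by apply: tliftD.
have prE z a v : pr z (a ** v) = b z a v by apply: tlift_tmk.
apply: (direct_sum_proj Ahat_comp0 Ahat_compB (vl := id) (pr := pr)) => //.
- apply: tens_ind => [|t u|a v]; [exact: sum_of0 Ahat_comp0|exact: (sum_ofD Ahat_comp0 Ahat_compB)|].
  move: v; apply: kfree_ind => [|u v hu hv|c x].
  + by rewrite tmk0r; apply: sum_of0 Ahat_comp0.
  + by rewrite tmkDr; apply: (sum_ofD Ahat_comp0 Ahat_compB).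
  rewrite -[c *: _]/(kla c _) -tmk_bal; move: (kra a c) => {c} {}a.
  move: a; apply: (ds_ind (ga_dsum A)) => [|a c ha hc|g a ga].
  + by rewrite tmk0l; apply: sum_of0 Ahat_comp0.
  + by rewrite tmkDl; apply: (sum_ofD Ahat_comp0 Ahat_compB).
  + by apply: (sum_of_in Ahat_comp0); apply: Ahat_comp_tmk ga.
- move=> z z' t; move: t; apply: Ahat_comp_ind.
  + by rewrite (am0 (prD z')); case: ifP.
  + by move=> u v hu hv; rewrite prD hu hv; case: ifP => //; rewrite addr0.
  + move=> g a ga e; rewrite prE /b (qh _ _ _ ga) /F coef_base.
    case: z z' e => x y [x' y'] /= e; rewrite xpair_eqE.
    have [->|yy] := eqVneq y' y.
      rewrite e andbT; case: eqP => _; rewrite /kra ?mul0r ?tmk0l //.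
      by rewrite rmorph1 mulr1.
    by rewrite andbF /kra rmorph0 mulr0 tmk0l.
Qed.

Fact Ahat_act g x a h y b t : ga_comp g a -> ga_comp h b -> Ahat_comp (x, y) t ->
  Ahat_comp (gs_act x g^-1%g, gs_act y h) (Ahat_r (a *: t) b).
Proof.
move=> ga hb; move: t; apply: Ahat_comp_ind => [|t u ht hu|i c ic /= e].
- by rewrite scaler0 (am0 (Ahat_rDl b)); apply: kspan0.
- by rewrite scalerDr Ahat_rDl; apply: kspanD.
- rewrite [_ *: _]Ahat_scale_tmk (Ahat_r_tmk _ _ hb) -e.
  apply: kspan_in; exists (g * i * h)%g, (a * c * b); split=> //=.
    by apply: ga_compM => //; apply: ga_compM.
  by rewrite !invgM -!gs_actM !mulgA mulgV mul1g.
Qed.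
End AhatR.

Definition Ahat : grbimod A A X X :=
  @GrBimod k G G A A X X Ahat_type Ahat_r Ahat_rDl Ahat_rDr Ahat_r1 Ahat_rM
    Ahat_lr Ahat_k Ahat_comp Ahat_dsum Ahat_act.

Definition Ahat_mk (a : A) (x : X) : Ahat := a ** kbase k x.

End Ahat.

Section Psi.
Variables (k : comPzRingType) (G G' : groupType).
Variables (A : grAlg k G) (A' : grAlg k G') (X : gset G) (X' : gset G').
Variable (P : grbimod A A' X X').

Local Notation lp := (@lpart _ _ _ _ _ _ _ P).
Local Notation rp := (@rpart _ _ _ _ _ _ _ P).

Definition HR : grR A X := H_obj P (bmR P).

(* For maps of left A-modules, the finiteness condition is on the P_x'.       *)
Definition HL : zmodType := @hatHom _ _ _ _ _ (bmL P) (bmL P) X' rp.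

Definition psi_fun (a : A) (v : kfree k X) (p : P) : P :=
  dsext lp (fun x q => (a * ga_alg A (coef v x)) *: q) p.

Lemma psi_funD a v : {morph psi_fun a v : p q / p + q}.
Proof. by apply: (dsextD (lpart_dsum P)) => x p q; rewrite scalerDr. Qed.

Lemma psi_fun_hom a v x p : lp x p -> psi_fun a v p = (a * ga_alg A (coef v x)) *: p.
Proof.
by move=> xp; apply: (dsext_hom (lpart_dsum P) _ xp) => y q r; rewrite scalerDr.
Qed.

Fact psi_fun_r a v a' p : psi_fun a v (bm_r p a') = bm_r (psi_fun a v p) a'.
Proof.
move: p; apply: (ds_ext (lpart_dsum P)) => [p q|p q|x p xp].
- by rewrite bm_rDl psi_funD.
- by rewrite psi_funD bm_rDl.
- by rewrite (psi_fun_hom _ _ (lpart_r a' xp)) (psi_fun_hom _ _ xp) bm_lr.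
Qed.

Definition psi_gr (a : A) (v : kfree k X) : grhom (bmR P) (bmR P).
Proof.
exists (psi_fun a v : rmod_of P -> rmod_of P).
- by apply: linearP_of => [|a' p]; [exact: psi_funD|exact: psi_fun_r].
- move=> x' p x'p; rewrite /= /psi_fun /dsext.
  elim/big_rec: _ => [|x q _]; first exact: ds0 (rpart_dsum P) _.
  apply: rpartD; apply: rpart_l; exact: lcomp_rpart x'p.
Defined.

Fact psi_fin a v : finite_set [set x | ~ forall p, lp x p -> psi_gr a v p = 0].
Proof.
apply: sub_finite_set (sm_valP v) => x /= h; apply/negP => /eqP v0.
by apply: h => p xp; rewrite /= (psi_fun_hom _ _ xp) /coef v0 rmorph0 mulr0 scale0r.
Qed.

Definition psi_av (a : A) (v : kfree k X) : HR :=
  @HatHom _ _ _ _ _ (bmR P) (bmR P) X lp (psi_gr a v) (psi_fin a v).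

(* psi and psi' are the additive maps given by psiE and psi'E below. With the *)
(* bimodule structure put on Ahat, psi is a map of bigraded bimodules, and    *)
(* psi' is one up to the additive automorphism of Ahat A' X' sending          *)
(* a (x) x to a (x) x g for a of degree g.                                    *)
Definition psi : Ahat A X -> HR := tlift psi_av.

Fact psi_avDl v : {morph psi_av^~ v : a b / a + b}.
Proof.
move=> a b; apply: hh_eq; apply: (ds_ext (lpart_dsum P)) => [||x p xp].
- exact: psi_funD.
- exact: hhD.
- by rewrite hh_addE /= !(psi_fun_hom _ _ xp) mulrDl scalerDl.
Qed.

Fact psi_avDr a : {morph psi_av a : u v / u + v}.
Proof.
move=> u v; apply: hh_eq; apply: (ds_ext (lpart_dsum P)) => [||x p xp].
- exact: psi_funD.
- exact: hhD.
- by rewrite hh_addE /= !(psi_fun_hom _ _ xp) coefD rmorphD mulrDr scalerDl.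
Qed.

Fact psi_av_bal a c v : psi_av (kra a c) v = psi_av a (kla c v).
Proof.
apply: hh_eq; apply: (ds_ext (lpart_dsum P)) => [||x p xp].
- exact: psi_funD.
- exact: psi_funD.
- by rewrite /= !(psi_fun_hom _ _ xp) /kra /kla coefZ rmorphM mulrA.
Qed.

Lemma psiD : {morph psi : t u / t + u}.
Proof. by apply: tliftD; [apply: psi_avDl|apply: psi_avDr|apply: psi_av_bal]. Qed.

Lemma psiE a x p : hh (psi (Ahat_mk a x)) p = a *: dscomp lp x p :> P.
Proof.
have -> : psi (Ahat_mk a x) = psi_av a (kbase k x).
  by apply: tlift_tmk; [apply: psi_avDl|apply: psi_avDr|apply: psi_av_bal].
move: p; apply: (ds_ext (lpart_dsum P)) => [|p q|y p yp].
- exact: psi_funD.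
- by rewrite (dscompD (lpart_dsum P)) scalerDr.
- rewrite /= (psi_fun_hom _ _ yp) (dscomp_hom (lpart_dsum P) _ yp) coef_base.
  by case: eqP => _; rewrite ?rmorph1 ?rmorph0 ?mulr1 ?mulr0 ?scale0r ?scaler0.
Qed.

Definition psi'_fun (a : A') (v : kfree k X') (p : P) : P :=
  dsext rp (fun x q => bm_r q (a * ga_alg A' (coef v x))) p.

Lemma psi'_funD a v : {morph psi'_fun a v : p q / p + q}.
Proof. by apply: (dsextD (rpart_dsum P)) => x p q; rewrite bm_rDl. Qed.

Lemma psi'_fun_hom a v x p : rp x p -> psi'_fun a v p = bm_r p (a * ga_alg A' (coef v x)).
Proof.
by move=> xp; apply: (dsext_hom (rpart_dsum P) _ xp) => y q r; rewrite bm_rDl.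
Qed.

Definition psi'_gr (a : A') (v : kfree k X') : grhom (bmL P) (bmL P).
Proof.
exists (psi'_fun a v).
- apply: linearP_of => [|b p]; first exact: psi'_funD.
  move: p; apply: (ds_ext (rpart_dsum P)) => [p q|p q|x p xp].
  + by rewrite scalerDr psi'_funD.
  + by rewrite psi'_funD scalerDr.
  + by rewrite (psi'_fun_hom _ _ (rpart_l b xp)) (psi'_fun_hom _ _ xp) bm_lr.
- move=> x p xp; rewrite /= /psi'_fun /dsext.
  elim/big_rec: _ => [|x' q _]; first exact: ds0 (lpart_dsum P) _.
  apply: lpartD; apply: lpart_r; exact: rcomp_lpart xp.
Defined.

Fact psi'_fin a v : finite_set [set x | ~ forall p, rp x p -> psi'_gr a v p = 0].
Proof.
apply: sub_finite_set (sm_valP v) => x /= h; apply/negP => /eqP v0.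
by apply: h => p xp; rewrite /= (psi'_fun_hom _ _ xp) /coef v0 rmorph0 mulr0 bm_r0r.
Qed.

Definition psi'_av (a : A') (v : kfree k X') : HL :=
  @HatHom _ _ _ _ _ (bmL P) (bmL P) X' rp (psi'_gr a v) (psi'_fin a v).

Definition psi' : Ahat A' X' -> HL := tlift psi'_av.

Fact psi'_avDl v : {morph psi'_av^~ v : a b / a + b}.
Proof.
move=> a b; apply: hh_eq; apply: (ds_ext (rpart_dsum P)) => [||x p xp].
- exact: psi'_funD.
- by apply: (gh_D (hh (psi'_av a v + psi'_av b v))).
- by rewrite hh_addE /= !(psi'_fun_hom _ _ xp) mulrDl bm_rDr.
Qed.

Fact psi'_avDr a : {morph psi'_av a : u v / u + v}.
Proof.
move=> u v; apply: hh_eq; apply: (ds_ext (rpart_dsum P)) => [||x p xp].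
- exact: psi'_funD.
- by apply: (gh_D (hh (psi'_av a u + psi'_av a v))).
- by rewrite hh_addE /= !(psi'_fun_hom _ _ xp) coefD rmorphD mulrDr bm_rDr.
Qed.

Fact psi'_av_bal a c v : psi'_av (kra a c) v = psi'_av a (kla c v).
Proof.
apply: hh_eq; apply: (ds_ext (rpart_dsum P)) => [||x p xp].
- exact: psi'_funD.
- exact: psi'_funD.
- by rewrite /= !(psi'_fun_hom _ _ xp) /kra /kla coefZ rmorphM mulrA.
Qed.

Lemma psi'D : {morph psi' : t u / t + u}.
Proof. by apply: tliftD; [apply: psi'_avDl|apply: psi'_avDr|apply: psi'_av_bal]. Qed.

Lemma psi'E a x p : hh (psi' (Ahat_mk a x)) p = bm_r (dscomp rp x p) a :> P.
Proof.
have -> : psi' (Ahat_mk a x) = psi'_av a (kbase k x).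
  by apply: tlift_tmk; [apply: psi'_avDl|apply: psi'_avDr|apply: psi'_av_bal].
move: p; apply: (ds_ext (rpart_dsum P)) => [|p q|y p yp].
- exact: psi'_funD.
- by rewrite (dscompD (rpart_dsum P)) bm_rDl.
- rewrite /= (psi'_fun_hom _ _ yp) (dscomp_hom (rpart_dsum P) _ yp) coef_base.
  by case: eqP => _; rewrite ?rmorph1 ?rmorph0 ?mulr1 ?mulr0 ?bm_r0r ?bm_r0l.
Qed.

End Psi.

(* Main.v *)
(* Morita theory for gr-(A,X,G). By the usual componentwise argument psi is      *)
(* bijective iff every x satisfies: A acts faithfully on _xP, and each graded    *)
(* endomorphism of P_A' acts on _xP as an element of A; likewise for psi'.       *)
(* (1) => (2): an equivalence F = - (x)^ P is full and faithful, which on        *)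
(* F(Ah) = P gives both properties of psi, and every object of gr-(A',X',G')     *)
(* is a sum of images of P. Expanding 1 (x) x' = sum_i f_i(p_i) accordingly      *)
(* gives a dual basis of P_x' and the properties of psi'. The graded maps        *)
(* P -> P factoring through copies of A'^ form a submodule of H(P, P) whose      *)
(* quotient is killed by F, so it contains the projection onto _xP; this is a    *)
(* dual basis of _xP. (2) => (2, resp.): multiplying a dual basis by elements of *)
(* P and using fullness writes 1 as a sum of values of functionals on P.         *)
(* (2, resp.) => (3): generation gives the expansion of 1 (x) x', which          *)
(* together with the fullness of psi inverts evaluation; generation on the left  *)
(* side recovers m from the elements m (x) p. (3) => (1): with dual bases the    *)
(* evaluation at every M' is bijective because it is so at A'^; the unit is then *)
(* inverted by F, hence injective and with zero cokernel, as F is faithful.      *)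

From HB Require Import structures.
From mathcomp Require Import all_boot all_algebra.
From mathcomp Require Import boolp classical_sets functions cardinality.
Require Import Defs.

Set Implicit Arguments.
Unset Strict Implicit.
Unset Printing Implicit Defensive.

Import GRing.Theory.

Local Open Scope classical_set_scope.
Local Open Scope ring_scope.

(** This is Morita theory with A^ and A'^ in place of the base rings. Write F for - (x)^ P. Since
    F(A^) is P ([theta]), full faithfulness of F, read on A^, says that A acts faithfully on each
    _xP ([lfaithful]) and realises there every graded endomorphism of P ([lfull]); together these
    amount to bijectivity of [psi] ([psi_bijP]).

    Once P generates, 1 (x) x' = sum f_i(p_i) with graded maps f_i : P -> A'^. Composing f_i with
    [lam q] : A'^ -> P, which sends 1 (x) x' to q for q in P_x', gives an endomorphism of P, hence
    under [lfull] an element c_i(q) of A, and q = sum c_i(q) p_i ([rpart_expansion]). This yields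
    dual bases of the P_x', the properties of [psi'] and an inverse of evaluation ([ev_inv]). Dual
    bases of the _xP come from faithfulness of F, applied to a quotient of H(P, P) ([factor_all]).

    In the other direction, dual bases together with [lfull] or [rfull] write 1 as a sum of values
    of functionals on P, so P generates on both sides ([lpart_generator], [rpart_generator]). A dual
    basis of _xP also factors the maps in H(P, M)_x through sums of copies of A'^, so evaluation is
    bijective everywhere once it is so at A'^ ([ev_bij_of_Ahat]). A triangle identity and
    faithfulness then make the unit bijective ([eta_bij]). *)

(** * Dual bases of finitely generated projective modules *)

Definition has_dual_basis (R : pzRingType) (V : lmodType R) : Prop :=
  exists (n : nat) (e : 'I_n -> V) (c : 'I_n -> V -> R),
    [/\ forall i, {morph c i : u v / u + v},
        forall i a v, c i (a *: v) = a * c i v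
      & forall v, v = \sum_i c i v *: e i].

Lemma dual_basis_fg_projective (R : pzRingType) (V : lmodType R) :
  has_dual_basis V -> fg_projective V.
Proof.
move=> [n [e [c [cD cZ ce]]]]; split.
  by exists n, e => v; exists (c^~ v).
move=> M N g f gs.
have /choice[y gy] : forall i, exists x, g x = f (e i) by move=> i; apply: gs.
pose h v := \sum_i c i v *: y i.
have h_lin : linear h.
  move=> a u v; rewrite /h scaler_sumr -big_split; apply: eq_bigr => i _.
  by rewrite cD cZ scalerDl scalerA.
pose hL : {linear V -> M} := HB.pack h (GRing.isLinear.Build _ _ _ _ h h_lin).
exists hL => v; rewrite /= /h linear_sum [in RHS](ce v) linear_sum.
by apply: eq_bigr => i _; rewrite !linearZ gy.
Qed.

(** Projectivity lifts the identity of V along the surjection R^n -> V given by the generators; the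
    coordinates of the lift are the functionals sought. *)
Lemma fg_projective_dual_basis (R : pzRingType) (V : lmodType R) :
  fg_projective V -> has_dual_basis V.
Proof.
move=> [[n [e he]] pV].
pose g (u : 'rV[R]_n) := \sum_i u ord0 i *: e i.
have g_lin : linear g.
  move=> a u v; rewrite /g scaler_sumr -big_split; apply: eq_bigr => i _.
  by rewrite !mxE scalerDl scalerA.
pose gL : {linear 'rV[R]_n -> V} := HB.pack g (GRing.isLinear.Build _ _ _ _ g g_lin).
have [|h hg] := pV _ _ gL idfun.
  by move=> v; have [c ->] := he v; exists (\row_i c i); apply: eq_bigr => i _; rewrite mxE.
exists n, e, (fun i v => h v ord0 i); split=> [i u v|i a v|v].
- by rewrite linearD mxE.
- by rewrite linearZ mxE.
- exact/esym/hg.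
Qed.

(** * Quotients of graded modules *)

Section Quotient.
Variables (R : pzRingType) (V : lmodType R) (S : submod V).

Let S0 := sm_0 S.
Let SD := @sm_D _ _ S.
Let SN := @sm_N _ _ S.

Definition quot_rel u v := `[< sm_set S (u - v) >].

Fact quot_rel_refl : reflexive quot_rel.
Proof. by move=> u; apply/asboolP; rewrite subrr. Qed.
Fact quot_rel_sym : symmetric quot_rel.
Proof. by move=> u v; apply/asboolP/asboolP => /SN; rewrite opprB. Qed.
Fact quot_rel_trans : transitive quot_rel.
Proof.
move=> v u w /asboolP h /asboolP h'; apply/asboolP.
by rewrite -(subrK v u) -addrA; apply: SD.
Qed.

Canonical quot_equiv := EquivRel quot_rel quot_rel_refl quot_rel_sym quot_rel_trans.

Definition quot : Type := {eq_quot quot_equiv}%qT.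
HB.instance Definition _ := Choice.on quot.

Definition quot_pi (v : V) : quot := (\pi_({eq_quot quot_equiv}) v)%qT.
Definition quot_repr (q : quot) : V := repr (q : {eq_quot quot_equiv}%qT).

Lemma quot_reprK q : quot_pi (quot_repr q) = q.
Proof. exact: reprK. Qed.

Lemma quot_piP u v : quot_pi u = quot_pi v <-> sm_set S (u - v).
Proof.
split=> [/eqP|h]; first by rewrite eqmodE => /asboolP.
by apply/eqP; rewrite eqmodE; apply/asboolP.
Qed.

Lemma quot_repr_pi v : sm_set S (quot_repr (quot_pi v) - v).
Proof. by apply/quot_piP; rewrite quot_reprK. Qed.

Definition quot_add q r := quot_pi (quot_repr q + quot_repr r).
Definition quot_opp q := quot_pi (- quot_repr q).
Definition quot_scale a q := quot_pi (a *: quot_repr q).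

Lemma quot_add_pi u v : quot_add (quot_pi u) (quot_pi v) = quot_pi (u + v).
Proof.
by apply/quot_piP; rewrite opprD addrACA; apply: SD; apply: quot_repr_pi.
Qed.
Lemma quot_opp_pi u : quot_opp (quot_pi u) = quot_pi (- u).
Proof. by apply/quot_piP; rewrite -opprD; apply/SN/quot_repr_pi. Qed.
Lemma quot_scale_pi a u : quot_scale a (quot_pi u) = quot_pi (a *: u).
Proof. by apply/quot_piP; rewrite -scalerBr; apply/sm_Z/quot_repr_pi. Qed.

Lemma quot_ind (P : quot -> Prop) : (forall v, P (quot_pi v)) -> forall q, P q.
Proof. by move=> h q; rewrite -(quot_reprK q). Qed.

Fact quot_addA : associative quot_add.
Proof.
by elim/quot_ind => u; elim/quot_ind => v; elim/quot_ind => w; rewrite !quot_add_pi addrA.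
Qed.
Fact quot_addC : commutative quot_add.
Proof. by elim/quot_ind => u; elim/quot_ind => v; rewrite !quot_add_pi addrC. Qed.
Fact quot_add0 : left_id (quot_pi 0) quot_add.
Proof. by elim/quot_ind => u; rewrite quot_add_pi add0r. Qed.
Fact quot_addN : left_inverse (quot_pi 0) quot_opp quot_add.
Proof. by elim/quot_ind => u; rewrite quot_opp_pi quot_add_pi addNr. Qed.

HB.instance Definition _ :=
  GRing.isZmodule.Build quot quot_addA quot_addC quot_add0 quot_addN.

Fact quot_scaleA a b q : quot_scale a (quot_scale b q) = quot_scale (a * b) q.
Proof. by elim/quot_ind: q => u; rewrite !quot_scale_pi scalerA. Qed.
Fact quot_scale1 : left_id 1 quot_scale.
Proof. by elim/quot_ind => u; rewrite quot_scale_pi scale1r. Qed.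
Fact quot_scaleDr : right_distributive quot_scale +%R.
Proof.
move=> a; elim/quot_ind => u; elim/quot_ind => v.
by rewrite [_ + _]quot_add_pi !quot_scale_pi [RHS]quot_add_pi scalerDr.
Qed.
Fact quot_scaleDl q : {morph quot_scale^~ q : a b / a + b}.
Proof.
by move=> a b; elim/quot_ind: q => u; rewrite !quot_scale_pi [RHS]quot_add_pi scalerDl.
Qed.
HB.instance Definition _ := GRing.Zmodule_isLmodule.Build R quot
  quot_scaleA quot_scale1 quot_scaleDr quot_scaleDl.

Lemma quot_piD : {morph quot_pi : u v / u + v}.
Proof. by move=> u v; rewrite [RHS]quot_add_pi. Qed.
Lemma quot_piZ a u : quot_pi (a *: u) = a *: quot_pi u.
Proof. by rewrite [RHS]quot_scale_pi. Qed.
Lemma quot_pi0P u : quot_pi u = 0 <-> sm_set S u.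
Proof. by rewrite -[0]/(quot_pi 0) quot_piP subr0. Qed.

End Quotient.

Section GradedQuotient.
Variables (R : pzRingType) (I : Type) (Rh : I -> set R).
Variables (X : choiceType) (act : X -> I -> X).
Variables (M : grmod Rh act) (S : submod M).
Hypothesis S_homog : forall x m, sm_set S m -> sm_set S (dscomp (@gm_comp _ _ _ _ _ M) x m).

Let dM := gm_dsum M.

Definition grquot_comp (x : X) : set (quot S) := quot_pi S @` @gm_comp _ _ _ _ _ M x.

Fact grquot_dsum : direct_sum grquot_comp.
Proof.
have c0 x : grquot_comp x 0 by exists 0 => //; apply: ds0 dM _.
have cB x q r : grquot_comp x q -> grquot_comp x r -> grquot_comp x (q - r).
  move=> [u xu <-] [v xv <-]; exists (u - v); first exact: dsB dM _ _ _ xu xv.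
  exact: (amB (@quot_piD _ _ S)).
(* Components are read off a representative; homogeneity of [S] makes the result independent of the
   choice. *)
pose pr x (q : quot S) := quot_pi S (dscomp (@gm_comp _ _ _ _ _ M) x (quot_repr q)).
have prE x u : pr x (quot_pi S u) = quot_pi S (dscomp (@gm_comp _ _ _ _ _ M) x u).
  by apply/quot_piP; rewrite -(amB (dscompD dM x)); apply/S_homog/quot_repr_pi.
apply: (direct_sum_proj c0 cB (vl := id) (pr := pr)) => // [|x q r|x y _ [u xu <-]].
- elim/quot_ind => u; move: u; apply: (ds_ind dM) => [|u v|x u xu].
  + exact: sum_of0.
  + by rewrite quot_piD; apply: sum_ofD.
  + by apply: (sum_of_in c0 (i := x)); exists u.
- elim/quot_ind: q => u; elim/quot_ind: r => v.
  by rewrite -quot_piD !prE -quot_piD dscompD.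
- by rewrite prE (dscomp_hom dM _ xu); case: ifP.
Qed.

Fact grquot_act i x r (q : quot S) :
  Rh i r -> grquot_comp x q -> grquot_comp (act x i) (r *: q).
Proof.
move=> ri [u xu <-]; exists (r *: u); first exact: gm_act.
exact: quot_piZ.
Qed.

Definition grquot : grmod Rh act := GrMod grquot_dsum grquot_act.

Definition grquot_pi : grhom M grquot.
Proof.
exists (quot_pi S : M -> grquot).
- by apply: linearP_of; [apply: quot_piD|apply: quot_piZ].
- by move=> x m xm; exists m.
Defined.

Lemma grquot_pi0P m : grquot_pi m = 0 <-> sm_set S m.
Proof. exact: quot_pi0P. Qed.

End GradedQuotient.

(** * Graded maps and traces *)

Section Graded.
Variables (R : pzRingType) (I : choiceType) (Rh : I -> set R).
Variables (X : choiceType) (act : X -> I -> X).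
Hypotheses (dR : direct_sum Rh) (actI : forall i, injective (act^~ i)).
Implicit Types M N : grmod Rh act.

Local Notation pt M := (dscomp (@gm_comp _ _ _ _ _ M)).

(** As [act] is injective in the degree, only the component of m of degree x reaches degree
    [act x i]. *)
Lemma dscomp_act M i x (r : R) (m : M) : Rh i r -> pt M (act x i) (r *: m) = r *: pt M x m.
Proof.
move=> ri; have dM := gm_dsum M; move: m; apply: (ds_ext dM) => [u v|u v|y u yu].
- by rewrite scalerDr dscompD.
- by rewrite dscompD // scalerDr.
- rewrite (dscomp_hom dM _ (gm_act ri yu)) (dscomp_hom dM _ yu) (inj_eq (@actI i)).
  by case: ifP; rewrite ?scaler0.
Qed.

Lemma grhom_dscomp M N (f : grhom M N) x m : pt N x (f m) = f (pt M x m).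
Proof.
move: m; apply: (ds_ext (gm_dsum M)) => [u v|u v|y u yu].
- by rewrite gh_D (dscompD (gm_dsum N)).
- by rewrite (dscompD (gm_dsum M)) gh_D.
- rewrite (dscomp_hom (gm_dsum M) _ yu) (dscomp_hom (gm_dsum N) _ (gh_comp f yu)).
  by case: ifP; rewrite ?(am0 (gh_D f)).
Qed.

(* An R-linear map of graded modules is made graded by keeping its part of degree zero. *)
Section Regrade.
Variables (M N : grmod Rh act) (f : M -> N).
Hypotheses (fD : {morph f : u v / u + v}) (fZ : forall a u, f (a *: u) = a *: f u).

Definition regrade_fun (m : M) : N :=
  dsext (@gm_comp _ _ _ _ _ M) (fun x u => pt N x (f u)) m.

Let rgD x : {morph (fun u => pt N x (f u)) : u v / u + v}.
Proof. by move=> u v; rewrite fD (dscompD (gm_dsum N)). Qed.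

Lemma regrade_funE x m : gm_comp x m -> regrade_fun m = pt N x (f m).
Proof. by move=> xm; apply: (dsext_hom (gm_dsum M) rgD xm). Qed.

Lemma regrade_funD : {morph regrade_fun : u v / u + v}.
Proof. exact: (dsextD (gm_dsum M)). Qed.

Lemma regrade_funZ a m : regrade_fun (a *: m) = a *: regrade_fun m.
Proof.
move: a; apply: (ds_ext dR) => [a b|a b|i a ia].
- by rewrite scalerDl regrade_funD.
- by rewrite scalerDl.
move: m; apply: (ds_ext (gm_dsum M)) => [u v|u v|x u xu].
- by rewrite scalerDr regrade_funD.
- by rewrite regrade_funD scalerDr.
- by rewrite (regrade_funE (gm_act ia xu)) (regrade_funE xu) fZ dscomp_act.
Qed.

Definition regrade : grhom M N.
Proof.
exists regrade_fun; first exact: linearP_of regrade_funD regrade_funZ.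
by move=> x m xm; rewrite (regrade_funE xm); apply: dscomp_in (gm_dsum N) _ _.
Defined.

Lemma regradeE x m : gm_comp x m -> regrade m = pt N x (f m).
Proof. exact: regrade_funE. Qed.
End Regrade.

Lemma grhom_inj M N (f : grhom M N) :
  (forall x m, gm_comp x m -> f m = 0 -> m = 0) -> injective f.
Proof.
move=> h u v /eqP; rewrite -subr_eq0 -(amB (gh_D f)) => /eqP fuv.
apply/eqP; rewrite -subr_eq0; apply/eqP/(dscomp_eq0 (gm_dsum M)) => x.
apply: (h x); first exact: dscomp_in (gm_dsum M) _ _.
by rewrite -grhom_dscomp fuv (am0 (dscompD (gm_dsum N) x)).
Qed.

(** The inverse is graded for free: f is injective and commutes with components, so g of a
    homogeneous element equals its own component. *)
Lemma grhom_inv M N (f : grhom M N) : bijective f ->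
  exists g : grhom N M, cancel f g /\ cancel g f.
Proof.
case=> g fK gK.
have g_lin : linear g by move=> a u v; apply: (can_inj fK); rewrite gh_lin !gK.
suff gc x n : gm_comp x n -> gm_comp x (g n) by exists (GrHom g_lin gc).
move=> xn; have -> : g n = pt M x (g n).
  by apply: (can_inj fK); rewrite -grhom_dscomp gK (dscomp_hom (gm_dsum N) _ xn) eqxx.
exact: dscomp_in (gm_dsum M) _ _.
Qed.

Definition trace M N : set N :=
  [set n | exists s : seq (grhom M N * M), n = \sum_(u <- s) u.1 u.2].
Arguments trace : clear implicits.

Lemma trace0 M N : trace M N 0.
Proof. by exists [::]; rewrite big_nil. Qed.
Lemma traceD M N u v : trace M N u -> trace M N v -> trace M N (u + v).
Proof. by move=> [s ->] [t ->]; exists (s ++ t); rewrite big_cat. Qed.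
Lemma trace_in M N (f : grhom M N) m : trace M N (f m).
Proof. by exists [:: (f, m)]; rewrite big_seq1. Qed.

Lemma trace_hom M N (Q : grmod Rh act) (f : grhom N Q) n : trace M N n -> trace M Q (f n).
Proof.
move=> [s ->]; rewrite (am_sum (gh_D f)); elim/big_rec: _ => [|u v _]; first exact: trace0.
by apply: traceD; apply: (trace_in (grhom_cmp f u.1)).
Qed.

Lemma traceZ M N a n : trace M N n -> trace M N (a *: n).
Proof.
move=> [s ->]; rewrite scaler_sumr; elim/big_rec: _ => [|u v _]; first exact: trace0.
by apply: traceD; rewrite -gh_Z; apply: trace_in.
Qed.

Lemma trace_homog M N x n : trace M N n -> trace M N (pt N x n).
Proof.
move=> [s ->]; rewrite (am_sum (dscompD (gm_dsum N) x)).
elim/big_rec: _ => [|u v _]; first exact: trace0.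
by apply: traceD; rewrite grhom_dscomp; apply: trace_in.
Qed.

(** The projection of N onto its quotient by the trace of M vanishes after every map M -> N, hence
    is zero. *)
Lemma generator_trace M : @generator (gr_cat Rh act) M -> forall N n, trace M N n.
Proof.
move=> gM N n.
pose S := Submod (@trace0 M N) (@traceD M N) (@traceZ M N).
have Sh x m : sm_set S m -> sm_set S (pt N x m) := @trace_homog M N x m.
apply/(grquot_pi0P Sh).
have -> // : grquot_pi Sh = grhom_zero N (grquot Sh).
apply: (gM N (grquot Sh)) => h; apply: grhom_eq => m /=.
by apply/quot_pi0P; apply: trace_in.
Qed.

Lemma trace_generator M :
  (forall N x n, gm_comp x n -> trace M N n) -> @generator (gr_cat Rh act) M.
Proof.
move=> h N Q f g fg; apply: grhom_eq; apply: (ds_ext (gm_dsum N)) => [||x n xn].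
- exact: gh_D.
- exact: gh_D.
have [s ->] := h N x n xn; rewrite !(am_sum (gh_D _)); apply: eq_bigr => u _.
exact: (congr1 (fun k : grhom M Q => k u.2) (fg u.1)).
Qed.

End Graded.
Arguments trace {R I Rh X act} M N _.

(** * The bimodule A^ *)

Section AhatTheory.
Variables (k : comPzRingType) (G : groupType) (A : grAlg k G) (X : gset G).

Local Notation Ah := (Ahat A X).
Local Notation mk := (@Ahat_mk k G A X).
Local Notation pt M := (dscomp (@gm_comp _ _ _ _ _ M)).

Lemma gs_act_inj g : injective (@gs_act G X ^~ g).
Proof. exact: can_inj (gs_actK g). Qed.
Lemma gs_actV_inj (g : G) : injective (fun x => @gs_act G X x g^-1%g).
Proof. exact: gs_act_inj. Qed.

Lemma Ahat_ext (W : zmodType) (f h : Ah -> W) :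
  {morph f : u v / u + v} -> {morph h : u v / u + v} ->
  (forall a x, f (mk a x) = h (mk a x)) -> f =1 h.
Proof.
move=> fD hD fh; apply: tens_ext => // a v; move: v; apply: kfree_ext => [u v|u v|c x].
- by rewrite tmkDr fD.
- by rewrite tmkDr hD.
- by rewrite -[c *: _]/(kla c _) -tmk_bal; apply: fh.
Qed.

Lemma Ahat_mkD x : {morph mk^~ x : a b / a + b}.
Proof. by move=> a b; apply: tmkDl. Qed.

Lemma Ahat_scale_mk b a x : b *: mk a x = mk (b * a) x.
Proof. exact: Ahat_scale_tmk. Qed.

Lemma Ahat_r_mk g b a x : ga_comp g b -> bm_r (mk a x) b = mk (a * b) (gs_act x g).
Proof. exact: Ahat_r_tmk. Qed.

Lemma Ahat_mk_lpart g a x : ga_comp g a -> lpart (gs_act x g^-1%g) (mk a x).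
Proof. by move=> ga; apply: (@lpart_in _ _ _ _ _ _ _ Ah _ x); apply: Ahat_comp_tmk. Qed.

Lemma Ahat_mk1_lpart x : lpart x (mk 1 x).
Proof.
by have := Ahat_mk_lpart x (ga_one A); rewrite -[X in gs_act x X]mul1g mulgV gs_act1.
Qed.

Lemma Ahat_mk_rpart a x : rpart x (mk a x).
Proof.
move: a; apply: (ds_ind (ga_dsum A)) => [|a b ha hb|g a ga].
- by rewrite (am0 (Ahat_mkD x)); apply: ds0 (rpart_dsum Ah) _.
- by rewrite Ahat_mkD; apply: rpartD.
- by apply: (@rpart_in _ _ _ _ _ _ _ Ah (gs_act x g^-1%g)); apply: Ahat_comp_tmk.
Qed.

(** The coordinate at x when A^ is seen as the free left A-module on X. *)
Definition Ahat_pi (x : X) : Ah -> A :=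
  tlift (fun a (v : kfree k X) => a * ga_alg A (coef v x)).

Let piDl x (v : kfree k X) : {morph (fun a : A => a * ga_alg A (coef v x)) : a b / a + b}.
Proof. by move=> a b; rewrite mulrDl. Qed.
Let piDr x (a : A) : {morph (fun v : kfree k X => a * ga_alg A (coef v x)) : u v / u + v}.
Proof. by move=> u v; rewrite coefD rmorphD mulrDr. Qed.
Let pib x (a : A) c (v : kfree k X) :
  kra a c * ga_alg A (coef v x) = a * ga_alg A (coef (kla c v) x).
Proof. by rewrite /kra /kla coefZ rmorphM mulrA. Qed.

Lemma Ahat_piD x : {morph Ahat_pi x : t u / t + u}.
Proof. by apply: tliftD; [apply: piDl|apply: piDr|apply: pib]. Qed.

Lemma Ahat_pi_mk x a y : Ahat_pi x (mk a y) = if x == y then a else 0.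
Proof.
rewrite /Ahat_pi tlift_tmk; [|exact: piDl|exact: piDr|exact: pib].
by rewrite coef_base; case: ifP; rewrite ?rmorph1 ?mulr1 // rmorph0 mulr0.
Qed.

Lemma Ahat_comp_mk x t : dscomp (@rpart _ _ _ _ _ _ _ Ah) x t = mk (Ahat_pi x t) x.
Proof.
move: t; apply: Ahat_ext => [||a y].
- exact: dscompD (rpart_dsum _) _.
- by move=> t u; rewrite Ahat_piD Ahat_mkD.
- rewrite (dscomp_hom (rpart_dsum _) _ (Ahat_mk_rpart a y)) Ahat_pi_mk eq_sym.
  by case: eqP => [->//|]; rewrite (am0 (Ahat_mkD x)).
Qed.

Lemma Ahat_pi_inj t : (forall x, Ahat_pi x t = 0) -> t = 0.
Proof.
move=> h; apply: (dscomp_eq0 (rpart_dsum Ah)) => x.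
by rewrite Ahat_comp_mk h (am0 (Ahat_mkD x)).
Qed.

Lemma Ahat_mk_inj x a : mk a x = 0 -> a = 0.
Proof. by move/(congr1 (Ahat_pi x)); rewrite Ahat_pi_mk eqxx (am0 (@Ahat_piD x)). Qed.

Section Lambda.
Variable M : grR A X.
Let dM := gm_dsum M.

(* a (x) y |-> the component of degree y of m a. For m of degree x it is, in *)
(* the paper's notation, the map from A graded by the orbit of x, 1 |-> m,   *)
(* extended by zero to the rest of Ah.                                       *)
Definition lam_fun (m : M) (t : Ah) : M :=
  dsext (@rpart _ _ _ _ _ _ _ Ah) (fun y s => pt M y (rac m (Ahat_pi y s))) t.

Let lam_morph (m : M) y : {morph (fun s => pt M y (rac m (Ahat_pi y s))) : t u / t + u}.
Proof. by move=> t u; rewrite Ahat_piD /rac scalerDl dscompD. Qed.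

Lemma lam_funD m : {morph lam_fun m : t u / t + u}.
Proof. exact: dsextD (rpart_dsum Ah) _ _ _. Qed.

Lemma lam_fun_mk m a y : lam_fun m (mk a y) = pt M y (rac m a).
Proof.
rewrite /lam_fun (dsext_hom (rpart_dsum Ah) (lam_morph m) (Ahat_mk_rpart a y)).
by rewrite Ahat_pi_mk eqxx.
Qed.

Lemma rac_comp g y (m : M) a : ga_comp g a -> pt M (gs_act y g) (rac m a) = rac (pt M y m) a.
Proof. exact: (@dscomp_act _ _ _ _ _ gs_act_inj M g y a m). Qed.

Lemma lam_funZ m b t : lam_fun m (bm_r t b) = rac (lam_fun m t) b.
Proof.
move: b; apply: (ds_ext (ga_dsum A)) => [b c|b c|g b gb].
- by rewrite bm_rDr lam_funD.
- by rewrite /rac scalerDl.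
move: t; apply: Ahat_ext => [t u|t u|a y].
- by rewrite bm_rDl lam_funD.
- by rewrite lam_funD /rac scalerDr.
- by rewrite (Ahat_r_mk _ _ gb) !lam_fun_mk -(rac_comp _ _ gb) /rac scalerA.
Qed.

Definition lam (m : M) : grhom (bmR Ah) M.
Proof.
exists (lam_fun m : rmod_of Ah -> M).
- by apply: linearP_of; [apply: lam_funD|move=> a t; apply: lam_funZ].
- move=> x t /= xt.
  rewrite /lam_fun (dsext_hom (rpart_dsum Ah) (lam_morph m) xt); exact: dscomp_in.
Defined.

Lemma lam_mk m a y : lam m (mk a y) = pt M y (rac m a).
Proof. exact: lam_fun_mk. Qed.

Lemma lam_mk1 x m : gm_comp x m -> lam m (mk 1 x) = m.
Proof. by move=> xm; rewrite lam_mk /rac scale1r (dscomp_hom dM _ xm) eqxx. Qed.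

Lemma lamD t : {morph (fun m => lam m t) : m n / m + n}.
Proof.
move=> m n; move: t; apply: Ahat_ext => [t u|t u|a y].
- exact: gh_D.
- by rewrite !gh_D addrACA.
- by rewrite !lam_mk /rac scalerDr dscompD.
Qed.

Lemma lam_rac m b t : lam (rac m b) t = lam m (b *: t).
Proof.
move: t; apply: Ahat_ext => [t u|t u|a y].
- exact: gh_D.
- by rewrite scalerDr gh_D.
- by rewrite Ahat_scale_mk !lam_mk /rac scalerA.
Qed.

End Lambda.

Lemma grhom_lam (M N : grR A X) (f : grhom M N) m t : f (lam m t) = lam (f m) t.
Proof.
move: t; apply: Ahat_ext => [t u|t u|a y].
- by rewrite !gh_D.
- by rewrite !gh_D.
- by rewrite !lam_mk -grhom_dscomp /rac gh_Z.
Qed.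

Lemma rac_in (M : grR A X) g x (m : M) a :
  ga_comp g a -> gm_comp x m -> gm_comp (gs_act x g) (rac m a).
Proof. exact: (@gm_act _ _ _ _ _ M g x a m). Qed.

(** The part of [a] that carries degree x to degree y. *)
Definition orb_part (x y : X) (a : A) : A :=
  dsext (@ga_comp k G A) (fun g b => if gs_act x g == y then b else 0) a.

Let orb_morph (x y : X) (g : G) :
  {morph (fun b : A => if gs_act x g == y then b else 0) : a b / a + b}.
Proof. by move=> a b; case: ifP; rewrite ?addr0. Qed.

Lemma orb_partD x y : {morph orb_part x y : a b / a + b}.
Proof. exact: dsextD (ga_dsum A) _ _ _. Qed.

Lemma orb_part_hom (x y : X) g a : ga_comp g a -> orb_part x y a = if gs_act x g == y then a else 0.
Proof. exact: (dsext_hom (ga_dsum A) (orb_morph x y)). Qed.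

Lemma rac_orb (M : grR A X) x y (m : M) a : gm_comp x m -> pt M y (rac m a) = rac m (orb_part x y a).
Proof.
move=> xm; move: a; apply: (ds_ext (ga_dsum A)) => [a b|a b|g a ga].
- by rewrite /rac scalerDl (dscompD (gm_dsum M)).
- by rewrite orb_partD /rac scalerDl.
- rewrite (orb_part_hom _ _ ga) (dscomp_hom (gm_dsum M) _ (rac_in ga xm)).
  by case: ifP; rewrite /rac ?scale0r.
Qed.

(** The right A-linear map A^ -> A through which [lam m] factors for every m of degree x
    ([lam_rho]). It turns graded maps into A^ into functionals with values in A. *)
Definition rho (x : X) (t : Ah) : A :=
  dsext (@rpart _ _ _ _ _ _ _ Ah) (fun y s => orb_part x y (Ahat_pi y s)) t.

Let rho_morph x y : {morph (fun s => orb_part x y (Ahat_pi y s)) : t u / t + u}.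
Proof. by move=> t u; rewrite Ahat_piD orb_partD. Qed.

Lemma rhoD x : {morph rho x : t u / t + u}.
Proof. exact: dsextD (rpart_dsum Ah) _ _ _. Qed.

Lemma rho_mk x a y : rho x (mk a y) = orb_part x y a.
Proof.
rewrite /rho (dsext_hom (rpart_dsum Ah) (rho_morph x) (Ahat_mk_rpart a y)).
by rewrite Ahat_pi_mk eqxx.
Qed.

Lemma rho_r x t b : rho x (bm_r t b) = rho x t * b.
Proof.
move: b; apply: (ds_ext (ga_dsum A)) => [b c|b c|g b gb].
- by rewrite bm_rDr rhoD.
- by rewrite mulrDr.
move: t; apply: Ahat_ext => [t u|t u|a y].
- by rewrite bm_rDl rhoD.
- by rewrite rhoD mulrDl.
rewrite (Ahat_r_mk _ _ gb) !rho_mk; move: a; apply: (ds_ext (ga_dsum A)) => [a c|a c|h a ha].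
- by rewrite mulrDl orb_partD.
- by rewrite orb_partD mulrDl.
rewrite (orb_part_hom _ _ (ga_compM ha gb)) (orb_part_hom _ _ ha) gs_actM.
by rewrite (inj_eq (@gs_act_inj g)); case: ifP; rewrite ?mul0r.
Qed.

Lemma lam_rho (M : grR A X) x (m : M) t : gm_comp x m -> lam m t = rac m (rho x t).
Proof.
move=> xm; move: t; apply: Ahat_ext => [t u|t u|a y].
- exact: gh_D.
- by rewrite rhoD /rac scalerDl.
- by rewrite lam_mk rho_mk; apply: rac_orb.
Qed.

End AhatTheory.

(** * The maps psi and psi' *)

Section PsiBijective.
Variables (k : comPzRingType) (G G' : groupType).
Variables (A : grAlg k G) (A' : grAlg k G') (X : gset G) (X' : gset G').
Variable (P : grbimod A A' X X').

Local Notation lp := (@lpart _ _ _ _ _ _ _ P).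
Local Notation rp := (@rpart _ _ _ _ _ _ _ P).

Definition lfaithful : Prop :=
  forall x (b : A), (forall p, lp x p -> b *: p = 0) -> b = 0.
(** No finiteness is asked of [f], since only its restriction to a single _xP matters. *)
Definition lfull : Prop :=
  forall x (f : grhom (bmR P) (bmR P)), exists b : A, forall p, lp x p -> f p = b *: p :> P.
Definition rfaithful : Prop :=
  forall x' (b : A'), (forall p, rp x' p -> bm_r p b = 0) -> b = 0.
Definition rfull : Prop :=
  forall x' (f : grhom (bmL P) (bmL P)), exists b : A', forall p, rp x' p -> f p = bm_r p b :> P.

Lemma psi_pi x t p : lp x p -> hh (psi P t) p = Ahat_pi x t *: p :> P.
Proof.
move=> xp; move: t; apply: Ahat_ext => [t u|t u|a y].
- by rewrite psiD.
- by rewrite Ahat_piD scalerDl.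
- rewrite psiE (dscomp_hom (lpart_dsum P) _ xp) Ahat_pi_mk.
  by case: ifP; rewrite ?scaler0 ?scale0r.
Qed.

Lemma psi'_pi x t p : rp x p -> hh (psi' P t) p = bm_r p (Ahat_pi x t) :> P.
Proof.
move=> xp; move: t; apply: Ahat_ext => [t u|t u|a y].
- by rewrite psi'D.
- by rewrite Ahat_piD bm_rDr.
- rewrite psi'E (dscomp_hom (rpart_dsum P) _ xp) Ahat_pi_mk.
  by case: ifP; rewrite ?bm_r0r ?bm_r0l.
Qed.

Definition lproj (x : X) : grhom (bmR P) (bmR P).
Proof.
exists (dscomp lp x : rmod_of P -> rmod_of P).
- by apply: linearP_of => [|a p]; [apply: (dscompD (lpart_dsum P))|apply: lcomp_r].
- by move=> x' p; apply: lcomp_rpart.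
Defined.

Definition rproj (x : X') : grhom (bmL P) (bmL P).
Proof.
exists (dscomp rp x : P -> P).
- by apply: linearP_of => [|a p]; [apply: (dscompD (rpart_dsum P))|apply: rcomp_l].
- by move=> x' p; apply: rcomp_lpart.
Defined.

Section Restrict.
Variables (M : grR A' X') (x : X) (f : grhom (bmR P) M).

Fact H_res_fin : finite_set [set y | ~ forall p, lp y p -> grhom_cmp f (lproj x) p = 0].
Proof.
apply: (sub_finite_set (B := [set x])); last exact: finite_set1.
move=> y /= h; apply: contrapT => yx; apply: h => p yp.
rewrite (dscomp_hom (lpart_dsum P) x yp); case: eqP => // _; exact: am0 (gh_D f).
Qed.

(** Cutting a graded map down to _xP gives it the finite support that H(P, M) requires. *)
Definition H_res : H_obj P M := @HatHom _ _ _ _ _ (bmR P) M X lp _ H_res_fin.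

Lemma H_resE p : hh H_res p = f (dscomp lp x p). Proof. by []. Qed.

Lemma H_res_comp : gm_comp x H_res.
Proof.
move=> y yx p yp; rewrite H_resE (dscomp_hom (lpart_dsum P) x yp) (negbTE yx).
exact: am0 (gh_D f).
Qed.
End Restrict.

Lemma H_res_id M x (f : H_obj P M) : gm_comp x f -> H_res x (hh f) = f.
Proof.
move=> fx; apply: hh_eq; apply: (ds_ext (lpart_dsum P)) => [||y p yp].
- exact: (gh_D (hh (H_res x (hh f)))).
- exact: (gh_D (hh f)).
rewrite H_resE (dscomp_hom (lpart_dsum P) x yp).
by case: eqP => [//|/eqP yx]; rewrite (fx y yx p yp); apply: am0 (gh_D (hh f)).
Qed.

Fact HL_res_fin x (f : grhom (bmL P) (bmL P)) :
  finite_set [set y | ~ forall p, rp y p -> grhom_cmp f (rproj x) p = 0].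
Proof.
apply: (sub_finite_set (B := [set x])); last exact: finite_set1.
move=> y /= h; apply: contrapT => yx; apply: h => p yp.
rewrite (dscomp_hom (rpart_dsum P) x yp); case: eqP => // _; exact: am0 (gh_D f).
Qed.

Definition HL_res x f : HL P := @HatHom _ _ _ _ _ (bmL P) (bmL P) X' rp _ (@HL_res_fin x f).

Lemma HL_resE x f p : hh (HL_res x f) p = f (dscomp rp x p). Proof. by []. Qed.

(** This stands in for a homogeneous decomposition, [HL] being a bare abelian group; finite support
    leaves finitely many nonzero restrictions. *)
Lemma HL_sum_res (f : HL P) : exists s : seq X', f = \sum_(x <- s) HL_res x (hh f).
Proof.
have dP := rpart_dsum P.
have /finite_seqP[s sE] := hh_fin f; exists (undup s); apply: hh_eq.
apply: (ds_ext dP) => [||y p yp].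
- exact: (gh_D (hh f)).
- exact: (gh_D (hh (\sum_(x <- undup s) HL_res x (hh f)))).
rewrite hh_sumE; under eq_bigr do rewrite HL_resE (dscomp_hom dP _ yp).
have [ys|ys] := boolP (y \in undup s).
  rewrite (bigD1_seq y) ?undup_uniq //= eqxx big1 ?addr0 // => x.
  by rewrite eq_sym => /negbTE ->; apply: am0 (gh_D (hh f)).
rewrite big_seq big1 => [|x xs].
  apply: contrapT => fy; have : [set` s] y by rewrite -sE => /= h; apply/fy/h.
  by rewrite /= -mem_undup (negbTE ys).
by case: eqP => [e|_]; [rewrite e xs in ys|apply: am0 (gh_D (hh f))].
Qed.

Lemma psi_surj_lfull : (forall f, exists t, psi P t = f) -> lfull.
Proof.
move=> ps x f; have [t tE] := ps (H_res x f); exists (Ahat_pi x t) => p xp.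
by rewrite -(psi_pi _ xp) tE H_resE (dscomp_hom (lpart_dsum P) _ xp) eqxx.
Qed.

Lemma psi'_surj_rfull : (forall f, exists t, psi' P t = f) -> rfull.
Proof.
move=> ps x f; have [t tE] := ps (HL_res x f); exists (Ahat_pi x t) => p xp.
by rewrite -(psi'_pi _ xp) tE HL_resE (dscomp_hom (rpart_dsum P) _ xp) eqxx.
Qed.

(** On _xP the map [psi P t] acts as the coordinate of t at x ([psi_pi]). So injectivity is tested
    coordinate by coordinate, and surjectivity on homogeneous members of H(P, P), each determined by
    a single _xP. *)
Lemma psi_bijP : bijective (psi P) <-> lfaithful /\ lfull.
Proof.
split=> [[g psiK gK]|[fa fu]].
  split; last by apply: psi_surj_lfull => f; exists (g f).
  move=> x b b0; apply: (@Ahat_mk_inj _ _ _ X x); apply: (can_inj psiK).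
  rewrite (am0 (@psiD _ _ _ _ _ _ _ P)); apply: hh_eq => p; rewrite psiE hh_zeroE.
  by apply: b0; apply: dscomp_in (lpart_dsum P) _ _.
have inj : injective (psi P).
  move=> t u /eqP; rewrite -subr_eq0 -(amB (@psiD _ _ _ _ _ _ _ P)) => /eqP tu.
  apply/eqP; rewrite -subr_eq0; apply/eqP/Ahat_pi_inj => x; apply: (fa x) => p xp.
  by rewrite -(psi_pi _ xp) tu.
have surj f : exists t, psi P t = f.
  move: f; apply: (ds_ind (@H_dsum _ _ _ _ _ _ _ P (bmR P))) => [|f g [t <-] [u <-]|x f fx].
  - by exists 0; apply: am0 (@psiD _ _ _ _ _ _ _ P).
  - by exists (t + u); apply: psiD.
  - have [b bE] := fu x (hh f); exists (Ahat_mk b x); rewrite -(H_res_id fx).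
    apply: hh_eq => p; rewrite psiE H_resE bE //; apply: dscomp_in (lpart_dsum P) _ _.
have /choice[g gK] := surj; exists g => // t; exact: inj.
Qed.

Lemma psi'_bijP : bijective (psi' P) <-> rfaithful /\ rfull.
Proof.
split=> [[g psiK gK]|[fa fu]].
  split; last by apply: psi'_surj_rfull => f; exists (g f).
  move=> x b b0; apply: (@Ahat_mk_inj _ _ _ X' x); apply: (can_inj psiK).
  rewrite (am0 (@psi'D _ _ _ _ _ _ _ P)); apply: hh_eq => p; rewrite psi'E hh_zeroE.
  by apply: b0; apply: dscomp_in (rpart_dsum P) _ _.
have inj : injective (psi' P).
  move=> t u /eqP; rewrite -subr_eq0 -(amB (@psi'D _ _ _ _ _ _ _ P)) => /eqP tu.
  apply/eqP; rewrite -subr_eq0; apply/eqP/Ahat_pi_inj => x; apply: (fa x) => p xp.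
  by rewrite -(psi'_pi _ xp) tu.
have surj f : exists t, psi' P t = f.
  have [s ->] := HL_sum_res f; elim/big_rec: _ => [|x g _ [u <-]].
    by exists 0; apply: am0 (@psi'D _ _ _ _ _ _ _ P).
  have [b bE] := fu x (hh f); exists (Ahat_mk b x + u); rewrite psi'D; congr (_ + _).
  apply: hh_eq => p; rewrite psi'E HL_resE bE //; apply: dscomp_in (rpart_dsum P) _ _.
have /choice[g gK] := surj; exists g => // t; exact: inj.
Qed.

End PsiBijective.

(** * The completed tensor product and the unit *)

Lemma racDl (A : pzRingType) (M : lmodType A^c) (m : M) : {morph rac m : a b / a + b}.
Proof. by move=> a b; apply: scalerDl. Qed.

Section HatTheory.
Variables (k : comPzRingType) (G G' : groupType).
Variables (A : grAlg k G) (A' : grAlg k G') (X : gset G) (X' : gset G').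
Variable (P : grbimod A A' X X').

Local Notation lp := (@lpart _ _ _ _ _ _ _ P).
Local Notation rp := (@rpart _ _ _ _ _ _ _ P).
Local Notation pt M := (dscomp (@gm_comp _ _ _ _ _ M)).

Lemma lcomp_scale g x (a : A) (p : P) : ga_comp g a ->
  dscomp lp x (a *: p) = a *: dscomp lp (gs_act x g) p.
Proof.
move=> ga; rewrite -[x in LHS](gs_actK g).
exact: (@dscomp_act _ _ _ _ _ (@gs_actV_inj G X) (bmL P) g (gs_act x g) a p).
Qed.

Lemma lcomp_bm_comp x x' p : rp x' p -> bm_comp (x, x') (dscomp lp x p).
Proof.
have dP := bm_dsum P.
have D0 : bm_comp (x, x') (0 : P) by apply: ds0 dP _.
move: p; apply: rpart_ind => [|p q hp hq|y p yp].
- by rewrite (am0 (dscompD (lpart_dsum P) x)).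
- by rewrite (dscompD (lpart_dsum P)); apply: (dD (ds0 dP) (dsB dP)).
- by rewrite (dscomp_hom (lpart_dsum P) _ (lpart_in yp)); case: eqP yp => [<-|].
Qed.

Section HatPair.
Variable M : grR A X.

(* m_x (x) _xp: total in m and p, of which only the x-components count. *)
Definition hmk (x : X) (m : M) (p : P) : hatP P M :=
  sm_mk (S := hatP_sub P M) (hat_tmk (dscomp_in (gm_dsum M) x m) (dscomp_in (lpart_dsum P) x p)).

Lemma hmkE x m p : sm_val (hmk x m p) = tmkA (pt M x m) (dscomp lp x p).
Proof. by []. Qed.

Lemma hmk_val x m p : gm_comp x m -> lp x p -> sm_val (hmk x m p) = tmkA m p.
Proof.
by move=> xm xp; rewrite hmkE (dscomp_hom (gm_dsum M) x xm) (dscomp_hom (lpart_dsum P) x xp) eqxx.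
Qed.

Lemma hmkDl x p : {morph (fun m => hmk x m p) : m n / m + n}.
Proof.
by move=> m n; apply: sm_val_inj; rewrite sm_valD !hmkE (dscompD (gm_dsum M)) tmkDl.
Qed.

Lemma hmkDr x m : {morph hmk x m : p q / p + q}.
Proof.
by move=> p q; apply: sm_val_inj; rewrite sm_valD !hmkE (dscompD (lpart_dsum P)) tmkDr.
Qed.

Lemma hmk_r x m p a' : hmk x m (bm_r p a') = (a' : A'^c) *: hmk x m p.
Proof.
apply: sm_val_inj; rewrite sm_valZ !hmkE lcomp_r.
by rewrite [RHS]tensP_scale_tmk.
Qed.

Lemma hmk_bal g x m (a : A) p : ga_comp g a ->
  hmk (gs_act x g) (rac m a) p = hmk x m (a *: p).
Proof.
move=> ga; apply: sm_val_inj; rewrite !hmkE (rac_comp _ _ ga) (lcomp_scale _ _ ga).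
exact: tmk_bal.
Qed.

Lemma hatP_ind (Q : hatP P M -> Prop) : Q 0 ->
  (forall u v, Q u -> Q v -> Q (u + v)) ->
  (forall x m p, gm_comp x m -> lp x p -> Q (hmk x m p)) -> forall u, Q u.
Proof.
move=> Q0 QD Qm u.
(* Quantifying over the membership proof lets an induction on bare tensors speak about elements of
   the submodule. *)
pose Q' t := forall h : hat M (bmL P) t, Q (sm_mk (S := hatP_sub P M) h).
have -> : u = sm_mk (S := hatP_sub P M) (sm_valP u) by apply: sm_val_inj.
suff : Q' (sm_val u) by apply.
apply: hat_ind (sm_valP u) => [h|t v ht hv Qt Qv h|x m p mx px h].
- by rewrite (_ : sm_mk _ = 0) //; apply: sm_val_inj.
- rewrite (_ : sm_mk _ = sm_mk (S := hatP_sub P M) ht + sm_mk (S := hatP_sub P M) hv).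
    by apply: QD; [apply: Qt|apply: Qv].
  exact: sm_val_inj.
- rewrite (_ : sm_mk _ = hmk x m p); first exact: Qm.
  by apply: sm_val_inj; rewrite (hmk_val mx px).
Qed.

Lemma hatP_ext (W : zmodType) (f g : hatP P M -> W) :
  {morph f : u v / u + v} -> {morph g : u v / u + v} ->
  (forall x m p, gm_comp x m -> lp x p -> f (hmk x m p) = g (hmk x m p)) -> f =1 g.
Proof.
move=> fD gD fg; apply: hatP_ind => [|u v|//]; first by rewrite !am0.
by rewrite fD gD => -> ->.
Qed.

Lemma hmk_comp (x : X) (x' : X') (m : M) (p : P) : rp x' p -> gm_comp x' (hmk x m p).
Proof.
move=> x'p; apply: kspan_in; exists x, (pt M x m), (dscomp lp x p); split=> //.
- exact: dscomp_in (gm_dsum M) _ _.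
- exact: lcomp_bm_comp.
Qed.

Definition hmk_hom (x : X) (m : M) : grhom (bmR P) (hatP P M).
Proof.
exists (hmk x m : rmod_of P -> hatP P M).
- by apply: linearP_of => [|a p]; [apply: hmkDr|apply: hmk_r].
- by move=> x' p; apply: hmk_comp.
Defined.

Lemma hatP_trace (u : hatP P M) : trace (bmR P) (hatP P M) u.
Proof.
move: u; apply: hatP_ind => [|u v|x m p _ _]; [exact: trace0|exact: traceD|].
exact: (trace_in (hmk_hom x m)).
Qed.

(** The value at p of the unit of the adjunction at m: the diagonal sum of the m_x (x) _xp. *)
Definition eta_sum (m : M) (p : P) : hatP P M := dsext lp (fun x q => hmk x m q) p.

Lemma eta_sumD m : {morph eta_sum m : p q / p + q}.
Proof. by apply: (dsextD (lpart_dsum P)) => x; apply: hmkDr. Qed.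

Lemma eta_sum_hom m x p : lp x p -> eta_sum m p = hmk x m p.
Proof. by move=> xp; apply: (dsext_hom (lpart_dsum P) _ xp) => y; apply: hmkDr. Qed.

Definition eta_gr (m : M) : grhom (bmR P) (hatP P M).
Proof.
exists (eta_sum m : rmod_of P -> hatP P M).
- apply: linearP_of => [|a p]; first exact: eta_sumD.
  move: p; apply: (ds_ext (lpart_dsum P)) => [p q|p q|x p xp].
  + by rewrite scalerDr; apply: eta_sumD.
  + by rewrite eta_sumD scalerDr.
  + by rewrite (eta_sum_hom _ xp) (eta_sum_hom _ (lpart_r a xp)) hmk_r.
- move=> x' p x'p; rewrite /= /eta_sum /dsext.
  elim/big_rec: _ => [|x u _]; first exact: ds0 (gm_dsum (hatP P M)) _.
  apply: (dD (ds0 (gm_dsum (hatP P M))) (dsB (gm_dsum (hatP P M)))).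
  by apply: hmk_comp; apply: lcomp_rpart.
Defined.

Lemma eta_grE m x p : lp x p -> eta_gr m p = hmk x m p.
Proof. exact: eta_sum_hom. Qed.

Fact eta_fin m : finite_set [set x | ~ forall p, lp x p -> eta_gr m p = 0].
Proof.
have [_ m0 _] := dssuppP (gm_dsum M) m.
apply: (sub_finite_set (B := [set` dssupp (@gm_comp _ _ _ _ _ M) m])); last exact: finite_seq.
move=> x /= h; apply/negPn/negP => /m0 xm; apply: h => p xp.
by rewrite (eta_sum_hom _ xp); apply: sm_val_inj; rewrite hmkE xm tmk0l.
Qed.

Definition eta_fun (m : M) : H_obj P (hatP P M) :=
  @HatHom _ _ _ _ _ (bmR P) (hatP P M) X lp _ (@eta_fin m).

Lemma eta_funE m x p : lp x p -> hh (eta_fun m) p = hmk x m p.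
Proof. exact: eta_grE. Qed.

Fact eta_funD : {morph eta_fun : m n / m + n}.
Proof.
move=> m n; apply: hh_eq; apply: (ds_ext (lpart_dsum P)) => [||x p xp].
- exact: (gh_D (hh (eta_fun (m + n)))).
- exact: (gh_D (hh (eta_fun m + eta_fun n))).
- by rewrite hh_addE !(eta_funE _ xp) hmkDl.
Qed.

Fact eta_fun_rac m (a : A) : eta_fun (rac m a) = rac (eta_fun m : H_obj P (hatP P M)) a.
Proof.
move: a; apply: (ds_ext (ga_dsum A)) => [a b|a b|g a ga].
- by rewrite racDl eta_funD.
- exact: racDl.
apply: hh_eq; apply: (ds_ext (lpart_dsum P)) => [||x p xp].
- exact: (gh_D (hh (eta_fun (rac m a)))).
- exact: (gh_D (hh (rac (eta_fun m : H_obj P (hatP P M)) a))).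
rewrite (eta_funE _ xp) /= (eta_sum_hom _ (lpart_l ga xp)) -(hmk_bal _ _ _ ga).
by rewrite gs_actVK.
Qed.

Definition eta : grhom M (H_obj P (hatP P M)).
Proof.
exists eta_fun; first (apply: linearP_of => [|a m]; [exact: eta_funD|exact: eta_fun_rac]).
move=> x m xm y yx p yp; rewrite (eta_funE _ yp); apply: sm_val_inj.
by rewrite hmkE (dscomp_hom (gm_dsum M) _ xm) eq_sym (negbTE yx) tmk0l.
Defined.

Lemma etaE m x p : lp x p -> hh (eta m) p = hmk x m p.
Proof. exact: eta_grE. Qed.

End HatPair.

Lemma hatP_hom_mk (M N : grR A X) (f : grhom M N) x m p :
  hatP_hom P f (hmk x m p) = hmk x (f m) p.
Proof.
by apply: sm_val_inj; rewrite hmkE grhom_dscomp; apply: (hatP_fun0_tmk f).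
Qed.

Lemma ev_mk (M : grR A' X') x (f : H_obj P M) p : gm_comp x f -> lp x p ->
  ev P M (hmk x f p) = hh f p.
Proof. by move=> xf xp; rewrite /= /evf (hmk_val xf xp); apply: ev0_tmk. Qed.

Lemma tensor_ext (M N : grR A X) (f g : grhom M N) :
  (forall x m p, gm_comp x m -> lp x p -> hmk x (f m) p = hmk x (g m) p) ->
  fmap (tensor_functor P) f = fmap (tensor_functor P) g.
Proof.
move=> fg; apply: grhom_eq; apply: hatP_ext => [||x m p xm xp].
- exact: (gh_D (hatP_hom P f)).
- exact: (gh_D (hatP_hom P g)).
- by rewrite [LHS]hatP_hom_mk [RHS]hatP_hom_mk; apply: fg.
Qed.

(** The functor cannot tell the projection M -> M/S from the zero map, so the two coincide. *)
Lemma faithful_quot0 : faithful (tensor_functor P) ->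
  forall (M : grR A X) (S : submod M)
    (Sh : forall x m, sm_set S m -> sm_set S (dscomp (@gm_comp _ _ _ _ _ M) x m)),
  (forall x m p, gm_comp x m -> lp x p -> hmk x (grquot_pi Sh m) p = 0) ->
  forall m, sm_set S m.
Proof.
move=> Ff M S Sh h m; apply/(grquot_pi0P Sh).
have -> // : grquot_pi Sh = grhom_zero M (grquot Sh).
apply: (Ff M (grquot Sh)); apply: tensor_ext => x n p xn xp.
by rewrite h //; apply: sm_val_inj; rewrite hmkE (am0 (dscompD (gm_dsum _) x)) tmk0l.
Qed.

End HatTheory.

(** * From an equivalence to dual bases *)

Lemma naturally_isomorphic_sym (C D : category) (F K : functor C D) :
  naturally_isomorphic F K -> naturally_isomorphic K F.
Proof.
move=> [u [v [nat vu uv]]]; exists v, u; split=> // a b f.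
have e : cmp (cmp (v b) (cmp (u b) (fmap F f))) (v a)
       = cmp (cmp (v b) (cmp (fmap K f) (u a))) (v a) by rewrite nat.
by move: e; rewrite cmpA vu cmp1m cmpA -cmpA uv cmpm1 => <-.
Qed.

Lemma naturally_isomorphic_faithful (C D : category) (F : functor C D) (H : functor D C) :
  naturally_isomorphic (compF H F) (idF C) -> faithful F.
Proof.
move=> [u [v [nat _ uv]]] a b f g fg.
have fu : cmp f (u a) = cmp g (u a) by have := nat _ _ f; rewrite /= fg => <-; have := nat _ _ g.
by rewrite -(cmpm1 f) -(cmpm1 g) -uv !cmpA [LHS](congr1 (cmp^~ (v a)) fu).
Qed.

(** The candidate f is H h conjugated by the isomorphism of HF with the identity. H is faithful,
    because FH is isomorphic to the identity, so F f = h may be checked after applying H. *)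
Lemma inverse_equivalences_full (C D : category) (F : functor C D) (H : functor D C) :
  inverse_equivalences F H -> forall (a b : C) (h : hom (F a) (F b)), exists f, fmap F f = h.
Proof.
move=> [[u [v [nat vu uv]]] iFH] a b h.
have fH := naturally_isomorphic_faithful iFH.
pose f : hom a b := cmp (u b) (cmp (fmap H h) (v a)).
exists f; apply: fH.
have e := congr1 (cmp (v b)) (nat _ _ f); rewrite cmpA vu cmp1m in e.
transitivity (cmp (v b) (cmp f (u a))); first exact: e.
by rewrite /f -!cmpA vu cmpm1 cmpA vu cmp1m.
Qed.

Lemma gr_cat_natural_iso (C : category) (R : pzRingType) (I : choiceType) (Rh : I -> set R)
    (Y : choiceType) (act : Y -> I -> Y) (F K : functor C (gr_cat Rh act))
    (phi : forall a, hom (F a) (K a)) :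
  (forall (a b : C) (f : hom a b), cmp (phi b) (fmap F f) = cmp (fmap K f) (phi a)) ->
  (forall a, bijective (gh_fun (phi a : grhom _ _))) -> naturally_isomorphic F K.
Proof.
move=> nat bij.
have h : forall a, exists u : hom (K a) (F a),
    cancel (gh_fun (phi a : grhom _ _)) (gh_fun (u : grhom _ _)) /\
    cancel (gh_fun (u : grhom _ _)) (gh_fun (phi a : grhom _ _)).
  by move=> a; apply: grhom_inv (bij a).
exists phi, (fun a => sval (cid (h a))); split=> // a; have [uK Ku] := svalP (cid (h a)); apply: grhom_eq => m; [exact: uK|exact: Ku].
Qed.

Section Equivalence.
Variables (k : comPzRingType) (G G' : groupType).
Variables (A : grAlg k G) (A' : grAlg k G') (X : gset G) (X' : gset G').
Variable (P : grbimod A A' X X').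

Local Notation lp := (@lpart _ _ _ _ _ _ _ P).
Local Notation rp := (@rpart _ _ _ _ _ _ _ P).
Local Notation pt M := (dscomp (@gm_comp _ _ _ _ _ M)).
Local Notation F := (tensor_functor P).
Local Notation H := (H_functor P).
Local Notation Ah := (Ahat A X).
Local Notation Ah' := (Ahat A' X').
Local Notation mk := (@Ahat_mk k G A X).
Local Notation mk' := (@Ahat_mk k G' A' X').

(** For b homogeneous of degree g this is balancing when z g = x, and both sides vanish
    otherwise. *)
Lemma hmk_scale (M : grR A X) x z (m : M) b p : gm_comp z m -> lp x p ->
  hmk z m (b *: p) = hmk x (rac m b) p.
Proof.
move=> zm xp; move: b; apply: (ds_ext (ga_dsum A)) => [a b|a b|g b gb].
- by rewrite scalerDl hmkDr.
- by rewrite racDl hmkDl.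
rewrite -(hmk_bal _ _ _ gb); have [<-//|zx] := eqVneq (gs_act z g) x.
apply: sm_val_inj; rewrite !hmkE (dscomp_hom (lpart_dsum P) _ xp) eq_sym (negbTE zx).
by rewrite (dscomp_hom (gm_dsum M) x (rac_in gb zm)) (negbTE zx) tmk0r tmk0l.
Qed.

Lemma hmk_comp_eq (M : grR A X) x (m n : M) (p : P) : pt M x m = pt M x n -> hmk x m p = hmk x n p.
Proof. by move=> e; apply: sm_val_inj; rewrite !hmkE e. Qed.

Lemma hmk0l (M : grR A X) x (p : P) : hmk x (0 : M) p = 0.
Proof. exact: (am0 (@hmkDl _ _ _ _ _ _ _ P M x p)). Qed.

(** The functor kills [lam m] : A^ -> M, because (m a)_y (x) p = m (x) (a p)_x for p in _yP; hence
    [lam m] is zero, and so is its value m at 1 (x) x. *)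
Lemma faithful_hmk : faithful F -> forall (M : grR A X) x (m : M), gm_comp x m ->
  (forall p, lp x p -> hmk x m p = 0) -> m = 0.
Proof.
move=> Ff M x m xm m0; rewrite -(lam_mk1 xm).
have -> // : lam m = grhom_zero (bmR Ah) M.
apply: (Ff (bmR Ah) M); apply: tensor_ext => y t p yt yp.
rewrite [RHS]hmk0l; have := dscomp_hom (rpart_dsum Ah) y yt; rewrite eqxx => <-.
rewrite Ahat_comp_mk lam_mk; set a := Ahat_pi y t.
rewrite -(@hmk_comp_eq M y (rac m a)); last first.
  by rewrite (dscomp_hom (gm_dsum M) y (dscomp_in (gm_dsum M) y _)) eqxx.
rewrite -(hmk_scale a xm yp) -[RHS](m0 (dscomp lp x (a *: p))).
  apply: sm_val_inj; rewrite !hmkE; congr (tmk _ _ _ _).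
  by rewrite (dscomp_hom (lpart_dsum P) x (dscomp_in (lpart_dsum P) x _)) eqxx.
exact: dscomp_in (lpart_dsum P) _ _.
Qed.

(* M (x)^ P is the sum of the images of the maps p |-> m_x (x) _xp. *)
Lemma equivalence_trace : inverse_equivalences F H -> forall M m, trace (bmR P) M m.
Proof.
move=> [_ [u [v [_ _ uv]]]] M m.
have -> : m = gh_fun (u M : grhom _ _) (gh_fun (v M : grhom _ _) m).
  by have := congr1 (fun f : grhom M M => f m) (uv M).
exact: trace_hom (hatP_trace _).
Qed.

Lemma psi_r t b p : hh (psi P (bm_r t b)) p = hh (psi P t) (b *: p) :> P.
Proof.
move: b; apply: (ds_ext (ga_dsum A)) => [a b|a b|g b gb].
- by rewrite bm_rDr psiD.
- by rewrite scalerDl; apply: (gh_D (hh (psi P t))).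
move: t; apply: Ahat_ext => [t u|t u|a y].
- by rewrite bm_rDl psiD.
- by rewrite psiD.
- by rewrite (Ahat_r_mk _ _ gb) !psiE (lcomp_scale _ _ gb) scalerA.
Qed.

Definition psi_hom : grhom (bmR Ah) (HR P).
Proof.
exists (psi P : rmod_of Ah -> HR P).
- apply: linearP_of => [|b t]; first exact: psiD.
  by apply: hh_eq => p; apply: psi_r.
- move=> x t xt y yx p yp; have := dscomp_hom (rpart_dsum Ah) x xt; rewrite eqxx => <-.
  by rewrite Ahat_comp_mk psiE (dscomp_hom (lpart_dsum P) x yp) (negbTE yx) scaler0.
Defined.

(** The isomorphism from A^ (x)^ P to P, with t (x) p going to psi(t)(p); its inverse sends p to the
    sum of the (1 (x) x) (x) _xp. *)
Definition theta : grhom (hatP P (bmR Ah)) (bmR P) :=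
  grhom_cmp (ev P (bmR P)) (hatP_hom P psi_hom).

Lemma theta_mk x t p : rpart x t -> lp x p -> theta (hmk x (t : bmR Ah) p) = hh (psi P t) p.
Proof.
move=> xt xp.
have e := hatP_hom_mk psi_hom x t p.
transitivity (ev P (bmR P) (hmk x (psi_hom t) p)); first by rewrite -e.
by apply: ev_mk xp; apply: (gh_comp psi_hom xt).
Qed.

Definition theta_inv_fun (p : P) : hatP P (bmR Ah) :=
  dsext lp (fun x q => hmk x (mk 1 x : bmR Ah) q) p.

Lemma theta_inv_funD : {morph theta_inv_fun : p q / p + q}.
Proof. by apply: (dsextD (lpart_dsum P)) => x; apply: hmkDr. Qed.

Lemma theta_inv_funE x p : lp x p -> theta_inv_fun p = hmk x (mk 1 x : bmR Ah) p.
Proof. by move=> xp; apply: (dsext_hom (lpart_dsum P) _ xp) => y; apply: hmkDr. Qed.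

Definition theta_inv : grhom (bmR P) (hatP P (bmR Ah)).
Proof.
exists (theta_inv_fun : rmod_of P -> hatP P (bmR Ah)).
- apply: linearP_of => [|a p]; first exact: theta_inv_funD.
  move: p; apply: (ds_ext (lpart_dsum P)) => [p q|p q|x p xp].
  + by rewrite scalerDr; apply: theta_inv_funD.
  + by rewrite theta_inv_funD scalerDr.
  + by rewrite (theta_inv_funE xp) (theta_inv_funE (lpart_r a xp)) hmk_r.
- move=> x' p x'p; rewrite /= /theta_inv_fun /dsext.
  elim/big_rec: _ => [|x u _]; first exact: ds0 (gm_dsum (hatP P (bmR Ah))) _.
  apply: (dD (ds0 (gm_dsum (hatP P (bmR Ah)))) (dsB (gm_dsum (hatP P (bmR Ah))))).
  by apply: hmk_comp; apply: lcomp_rpart.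
Defined.

Lemma thetaK : cancel theta theta_inv.
Proof.
apply: hatP_ext => [u v|//|x t p xt xp].
  by rewrite !gh_D.
rewrite (theta_mk xt xp) (psi_pi _ xp).
have := dscomp_hom (rpart_dsum Ah) x xt; rewrite eqxx Ahat_comp_mk => tE.
rewrite -[in RHS]tE; move: (Ahat_pi x t) => {xt tE} {}t.
move: t; apply: (ds_ext (ga_dsum A)) => [a b|a b|g b gb].
- by rewrite scalerDl gh_D.
- by rewrite Ahat_mkD hmkDl.
(* For b of degree g, the element b p has degree x g^-1, and (1 (x) x g^-1) b = b (x) x. *)
rewrite [LHS](theta_inv_funE (lpart_l gb xp)) -(hmk_bal _ _ _ gb) gs_actVK.
by congr (hmk x _ p); rewrite [LHS](Ahat_r_mk _ _ gb) mul1r gs_actVK.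
Qed.

Lemma theta_mk1 x p : lp x p -> theta (hmk x (mk 1 x : bmR Ah) p) = p.
Proof.
move=> xp; rewrite (theta_mk (Ahat_mk_rpart _ _) xp) psiE scale1r.
by rewrite (dscomp_hom (lpart_dsum P) x xp) eqxx.
Qed.

Lemma theta_invK : cancel theta_inv theta.
Proof.
apply: (ds_ext (lpart_dsum P)) => [p q|//|x p xp]; first by rewrite !gh_D.
by rewrite [theta_inv p](theta_inv_funE xp) theta_mk1.
Qed.

Lemma faithful_lfaithful : faithful F -> lfaithful P.
Proof.
move=> Ff x b b0; apply: (@Ahat_mk_inj _ _ _ X x).
apply: (faithful_hmk Ff (M := bmR Ah) (x := x)) => [|p xp]; first exact: Ahat_mk_rpart.
rewrite -[LHS]thetaK (theta_mk (Ahat_mk_rpart _ _) xp) (psi_pi _ xp) Ahat_pi_mk eqxx b0 //.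
exact: (am0 (gh_D theta_inv)).
Qed.

(** Transported along [theta], f becomes F(phi) for some phi : A^ -> A^; the coordinate at x of
    phi(1 (x) x) is the element by which f acts on _xP. *)
Lemma equivalence_lfull : inverse_equivalences F H -> lfull P.
Proof.
move=> FH x f.
have [phi phiE] := inverse_equivalences_full FH (grhom_cmp theta_inv (grhom_cmp f theta)).
exists (Ahat_pi x (gh_fun (phi : grhom (bmR Ah) (bmR Ah)) (mk 1 x))) => p xp.
have e : hatP_hom P phi (hmk x (mk 1 x : bmR Ah) p) = theta_inv (f p).
  have -> : hatP_hom P phi = grhom_cmp theta_inv (grhom_cmp f theta) := phiE.
  by rewrite -[in RHS](theta_mk1 xp).
rewrite -(theta_invK (f p)) -e hatP_hom_mk.
rewrite theta_mk ?(psi_pi _ xp) //.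
exact: (gh_comp (phi : grhom (bmR Ah) (bmR Ah)) (Ahat_mk_rpart 1 x)).
Qed.

(** * Consequences of generation by P: the P_x' and psi' *)

Section Morita.
Hypothesis trP : forall M m, trace (bmR P) M m.

Lemma trace_lpart (M : grR A' X') (m : M) : trace (bmR P) M m ->
  exists (n : nat) (x : 'I_n -> X) (f : 'I_n -> grhom (bmR P) M) (p : 'I_n -> P),
    (forall i, lp (x i) (p i)) /\ m = \sum_i f i (p i).
Proof.
move=> [s ->].
suff [t ->] : exists t : seq (X * (grhom (bmR P) M * P)),
    \sum_(u <- s) u.1 u.2 = \sum_(u <- t) u.2.1 (dscomp lp u.1 u.2.2).
  exists (size t), (fun i => (tnth (in_tuple t) i).1), (fun i => (tnth (in_tuple t) i).2.1),
    (fun i => dscomp lp (tnth (in_tuple t) i).1 (tnth (in_tuple t) i).2.2).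
  by split=> [i|]; [apply: dscomp_in (lpart_dsum P) _ _|rewrite big_tnth].
elim: s => [|[f p] s [t IH]]; first by exists [::]; rewrite !big_nil.
have [_ _ pE] := dssuppP (lpart_dsum P) p.
exists (map (fun x => (x, (f, p))) (dssupp lp p) ++ t).
rewrite big_cons big_cat /= IH big_map /= {1}pE; congr (_ + _).
exact: (am_sum (gh_D f)).
Qed.

(** Graded maps preserve degrees, so each p_i may be replaced by its component of degree x'. *)
Lemma trace_rpart (M : grR A' X') x' (m : M) : gm_comp x' m -> trace (bmR P) M m ->
  exists (n : nat) (x : 'I_n -> X) (f : 'I_n -> grhom (bmR P) M) (p : 'I_n -> P),
    (forall i, bm_comp (x i, x') (p i)) /\ m = \sum_i f i (p i).
Proof.
move=> xm /trace_lpart[n [x [f [p [xp mE]]]]].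
exists n, x, f, (fun i => dscomp rp x' (p i)); split=> [i|].
  have := lcomp_bm_comp (x i) (dscomp_in (rpart_dsum P) x' (p i)).
  by rewrite (dscomp_hom (lpart_dsum P) _ (rcomp_lpart x' (xp i))) eqxx.
have := dscomp_hom (gm_dsum M) x' xm; rewrite eqxx => <-; rewrite {1}mE.
rewrite (am_sum (dscompD (gm_dsum M) x')); apply: eq_bigr => i _; exact: grhom_dscomp.
Qed.

Lemma lam_scale a (p : P) t : lam (a *: p : bmR P) t = a *: (lam (p : bmR P) t : P).
Proof.
move: t; apply: Ahat_ext => [t u|t u|b y].
- exact: gh_D.
- by rewrite gh_D scalerDr.
- by rewrite !lam_mk -rcomp_l; congr (dscomp _ _ _); apply: bm_lr.
Qed.

(** If P_x' b = 0, then (1 (x) x') b = sum f_i(p_i b) = 0, and [rho] reads b off the left side. *)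
Lemma trace_rfaithful : rfaithful P.
Proof.
move=> x' b b0.
have [n [x [f [p [xp e]]]]] := @trace_rpart (bmR Ah') x' _ (Ahat_mk_rpart 1 x') (trP _).
have : rho x' (bm_r (mk' 1 x') b) = 0.
  rewrite e -[bm_r _ b]/(rac (\sum_i f i (p i)) b) /rac scaler_sumr big1 ?(am0 (rhoD x')) // => i _.
  by rewrite -gh_Z [_ *: _]b0 ?(am0 (gh_D (f i))) //; apply: rpart_in (xp i).
by rewrite rho_r rho_mk (orb_part_hom _ _ (ga_one A')) gs_act1 eqxx mul1r.
Qed.

Hypothesis lfuP : lfull P.

(* Dual basis of P_x': q = lam q (1 (x) x') is expanded along 1 (x) x' = sum f_i(p_i), *)
(* and by fullness each lam q \o f_i acts on a part of P as an element c_i(q) of A. *)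
Lemma rpart_expansion x' :
  exists (n : nat) (x : 'I_n -> X) (f : 'I_n -> grhom (bmR P) (bmR Ah')) (p : 'I_n -> P)
    (c : 'I_n -> P -> A),
  [/\ forall i, bm_comp (x i, x') (p i),
      mk' 1 x' = \sum_i f i (p i),
      forall i q r, lp (x i) r -> lam (q : bmR P) (f i r) = c i q *: r
    & forall q, rp x' q -> q = \sum_i c i q *: p i].
Proof.
have [n [x [f [p [xp e]]]]] := @trace_rpart (bmR Ah') x' _ (Ahat_mk_rpart 1 x') (trP _).
have /choice[c cE] : forall iq : 'I_n * P, exists b : A, forall r, lp (x iq.1) r ->
    lam (iq.2 : bmR P) (f iq.1 r) = b *: r :> P.
  by move=> [i q]; apply: (lfuP (x i) (grhom_cmp (lam (q : bmR P)) (f i))).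
exists n, x, f, p, (fun i q => c (i, q)); split=> // [i q|q x'q]; first exact: cE (i, q).
rewrite -{1}(@lam_mk1 _ _ _ _ (bmR P) x' q x'q) e (am_sum (gh_D _)).
by apply: eq_bigr => i _; apply: (cE (i, q)); apply: lpart_in (xp i).
Qed.

Lemma trace_rfull : rfull P.
Proof.
move=> x' phi; have [n [x [f [p [c [xp e cE cp]]]]]] := rpart_expansion x'.
(* From q = sum c_i(q) p_i follows phi(q) = sum c_i(q) phi(p_i) = [lam q] (sum f_i(phi(p_i))), which
   is q times the [rho] of that sum. *)
exists (rho x' (\sum_i f i (phi (p i)))) => q x'q.
rewrite -[RHS]/(rac (q : bmR P) _) -(@lam_rho _ _ _ _ (bmR P) x' q _ x'q).
rewrite (am_sum (gh_D _)) {1}(cp q x'q) (am_sum (gh_D phi)); apply: eq_bigr => i _.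
rewrite gh_Z cE //; apply: (gh_comp phi); exact: lpart_in (xp i).
Qed.

(** The c_i(q) were merely chosen; faithfulness of A on the part of P of degree x_i makes them
    unique, hence additive and A-linear in q. *)
Lemma rpart_fg_projective x' : lfaithful P -> fg_projective (sm_type (rpart_sub P x')).
Proof.
move=> lfaP; have [n [x [f [p [c [xp e cE cp]]]]]] := rpart_expansion x'.
apply: dual_basis_fg_projective.
exists n, (fun i => sm_mk (S := rpart_sub P x') (rpart_in (xp i))), (fun i v => c i (sm_val v)).
split=> [i u v|i a v|v].
- apply/eqP; rewrite -subr_eq0; apply/eqP/(lfaP (x i)) => r xr.
  by rewrite scalerBl scalerDl -!cE // sm_valD lamD subrr.
- apply/eqP; rewrite -subr_eq0; apply/eqP/(lfaP (x i)) => r xr.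
  by rewrite scalerBl -scalerA -!cE // sm_valZ lam_scale subrr.
- apply: sm_val_inj; rewrite (am_sum (@sm_valD _ _ _)) [LHS](cp _ (sm_valP v)).
  by apply: eq_bigr.
Qed.

End Morita.

End Equivalence.

(** * Projectivity of the _xP, and P as a generator on both sides *)

Section Generators.
Variables (k : comPzRingType) (G G' : groupType).
Variables (A : grAlg k G) (A' : grAlg k G') (X : gset G) (X' : gset G').
Variable (P : grbimod A A' X X').

Local Notation lp := (@lpart _ _ _ _ _ _ _ P).
Local Notation rp := (@rpart _ _ _ _ _ _ _ P).
Local Notation pt M := (dscomp (@gm_comp _ _ _ _ _ M)).
Local Notation F := (tensor_functor P).
Local Notation Ah' := (Ahat A' X').

Lemma H_comp_eq (M : grR A' X') x (f g : H_obj P M) : gm_comp x f -> gm_comp x g ->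
  (forall x' p, bm_comp (x, x') p -> hh f p = hh g p) -> f = g.
Proof.
move=> xf xg fg; apply: hh_eq; apply: (ds_ext (lpart_dsum P)) => [||y p yp].
- exact: (gh_D (hh f)).
- exact: (gh_D (hh g)).
have [yx|yx] := eqVneq y x; last by rewrite (xf y yx p yp) (xg y yx p yp).
move: p yp; rewrite {}yx; apply: lpart_ind => [|p q ep eq|]; last exact: fg.
  by rewrite (am0 (gh_D (hh f))) (am0 (gh_D (hh g))).
by rewrite (gh_D (hh f)) (gh_D (hh g)) ep eq.
Qed.

Lemma H_ptE (M : grR A' X') x (f : H_obj P M) : pt (H_obj P M) x f = H_res x (hh f).
Proof.
move: f; apply: (ds_ext (gm_dsum (H_obj P M))) => [||y f yf].
- exact: (dscompD (gm_dsum (H_obj P M))).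
- by move=> f g; apply: hh_eq.
rewrite (dscomp_hom (gm_dsum (H_obj P M)) x yf).
have [<-|yx] := eqVneq y x; first by rewrite H_res_id.
apply: hh_eq => p; rewrite H_resE; apply/esym; apply: (yf x); first by rewrite eq_sym.
exact: dscomp_in (lpart_dsum P) _ _.
Qed.

Section LpartProjective.
Hypotheses (Ff : faithful F) (trP : forall M m, trace (bmR P) M m) (lfuP : lfull P).

(** Sums of composites P -> A'^ -> P whose second map is [lam p] with p homogeneous. Projecting an
    arbitrary p avoids a side condition on the list. *)
Definition factor_set : set (H_obj P (bmR P)) :=
  [set h | exists s : seq (X' * P * H_obj P (bmR Ah')),
    h = \sum_(u <- s) H_hom P (lam (dscomp rp u.1.1 u.1.2 : bmR P)) u.2].

Lemma factor_set_in x' (p : P) (f : H_obj P (bmR Ah')) : rp x' p ->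
  factor_set (H_hom P (lam (p : bmR P)) f).
Proof.
move=> x'p; exists [:: (x', p, f)]; rewrite big_seq1 /=.
by have := dscomp_hom (rpart_dsum P) x' x'p; rewrite eqxx => ->.
Qed.

Lemma factor_set0 : factor_set 0.
Proof. by exists [::]; rewrite big_nil. Qed.

Lemma factor_setD g h : factor_set g -> factor_set h -> factor_set (g + h).
Proof. by move=> [s ->] [t ->]; exists (s ++ t); rewrite big_cat. Qed.

Lemma factor_set_stable (phi : H_obj P (bmR P) -> H_obj P (bmR P)) :
  {morph phi : g h / g + h} ->
  (forall x' p f, rp x' p -> factor_set (phi (H_hom P (lam (p : bmR P)) f))) ->
  forall h, factor_set h -> factor_set (phi h).
Proof.
move=> phiD phiS h [s ->]; rewrite (am_sum phiD).
elim/big_rec: _ => [|u g _ gS]; first exact: factor_set0.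
by apply: factor_setD gS; apply: phiS; apply: dscomp_in (rpart_dsum P) _ _.
Qed.

Definition factor_sub : submod (H_obj P (bmR P)).
Proof.
exists factor_set; [exact: factor_set0|exact: factor_setD|move=> a; apply: factor_set_stable].
  by move=> g h; apply: scalerDr.
by move=> x' p f x'p; rewrite -gh_Z; apply: factor_set_in x'p.
Defined.

Lemma factor_homog x h :
  sm_set factor_sub h -> sm_set factor_sub (pt (H_obj P (bmR P)) x h).
Proof.
move: h; apply: (@factor_set_stable (pt (H_obj P (bmR P)) x)) => [|x' p f x'p].
  exact: (dscompD (gm_dsum (H_obj P (bmR P)))).
by rewrite grhom_dscomp; apply: factor_set_in x'p.
Qed.

(* The quotient of H(P, P) by the maps factoring through sums of copies of Ah' *)
(* is killed by - (x)^ P, hence is zero when that functor is faithful.        *)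
Lemma factor_all h : factor_set h.
Proof.
apply: (faithful_quot0 Ff (S := factor_sub) (Sh := factor_homog)) => z {}h p zh.
move: p; apply: lpart_ind => [|p q ep eq|x' p zp].
- exact: (am0 (hmkDr z _)).
- by rewrite hmkDr ep eq addr0.
have [n [x [f [q [c [xq e cE cq]]]]]] := rpart_expansion trP lfuP x'.
rewrite (cq p (rpart_in zp)) (am_sum (hmkDr z _)) big1 // => i _.
rewrite (hmk_scale _ (gh_comp (grquot_pi factor_homog) zh) (lpart_in (xq i))).
rewrite -[RHS](hmk0l _ (x i) (q i)); apply: hmk_comp_eq.
rewrite /rac -gh_Z grhom_dscomp (am0 (dscompD (gm_dsum _) (x i))); apply/grquot_pi0P.
rewrite H_ptE; set g := H_res _ _.
have -> : g = H_hom P (lam (hh h p : bmR P)) (H_res (x i) (f i)).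
  apply: (H_comp_eq (x := x i)) => [||y r yr]; first exact: H_res_comp.
    by apply: gh_comp; apply: H_res_comp.
  have := dscomp_hom (lpart_dsum P) (x i) (lpart_in yr); rewrite eqxx => er.
  rewrite H_resE er; transitivity (hh h (lam (p : bmR P) (f i r))).
    by rewrite (cE i) //; apply: lpart_in yr.
  by rewrite grhom_lam [RHS]/= er.
by apply: (@factor_set_in x'); apply: (gh_comp (hh h) (x := x')); apply: rpart_in zp.
Qed.

(** By [factor_all] the projection onto _xP is a sum of maps [lam p_i] after h_i, and [lam_rho]
    rewrites this as v = sum p_i rho(h_i(v)) on _xP. Cutting the p_i down to _xP gives the dual
    basis. *)
Lemma lpart_fg_projective x : fg_projective (sm_type (lpart_sub P x)).
Proof.
have [s sE] := factor_all (H_res x (grhom_id (bmR P))).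
pose t i := tnth (in_tuple s) i.
apply: dual_basis_fg_projective.
exists (size s), (fun i => sm_mk (S := lpart_sub P x)
    (dscomp_in (lpart_dsum P) x (dscomp rp (t i).1.1 (t i).1.2))),
  (fun i v => rho (t i).1.1 (hh (t i).2 (sm_val v))).
split=> [i u v|i a v|v].
- by rewrite sm_valD (gh_D (hh (t i).2)) rhoD.
- by rewrite sm_valZ (gh_Z (hh (t i).2)); apply: rho_r.
apply: sm_val_inj; rewrite (am_sum (@sm_valD _ _ _)) /=.
have xv : lp x (sm_val v) := sm_valP v.
have vx : dscomp lp x (sm_val v) = sm_val v by rewrite (dscomp_hom (lpart_dsum P) x xv) eqxx.
transitivity (dscomp lp x (hh (H_res x (grhom_id (bmR P))) (sm_val v))).
  by rewrite H_resE [RHS]/= !vx.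
rewrite sE hh_sumE (am_sum (dscompD (lpart_dsum P) x)) [LHS]big_tnth; apply: eq_bigr => i _.
rewrite -[RHS]lcomp_r; congr (dscomp _ _ _).
by apply: (@lam_rho _ _ _ _ (bmR P)); apply: dscomp_in (rpart_dsum P) _ _.
Qed.

End LpartProjective.

(** Take a dual basis e_i, c_i of _xP. The degree-preserving part of q |-> p c_i(_xq) acts on _xP as
    an element b_i(p) of A, which is unique and so A-linear in p. Since sum e_i c_i(q) = q on _xP,
    sum b_i(e_i) = 1 and m = sum b_i(e_i) m. *)
Lemma lpart_generator : lfaithful P -> lfull P ->
  (forall x, fg_projective (sm_type (lpart_sub P x))) -> @generator (grL_cat A X) (bmL P).
Proof.
move=> fa fu pr; apply: trace_generator => M x m xm.
have dl := lpart_dsum P; have dr := rpart_dsum P.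
have [n [e [c [cD cZ ce]]]] := fg_projective_dual_basis (pr x).
pose cut q : sm_type (lpart_sub P x) := sm_mk (S := lpart_sub P x) (dscomp_in dl x q).
have cutD : {morph cut : p q / p + q}.
  by move=> p q; apply: sm_val_inj; apply: (dscompD dl).
have cutZ (a : A'^c) (q : rmod_of P) : cut (a *: q) = a *: cut q.
  by apply: sm_val_inj; apply: lcomp_r.
pose zf i p (q : bmR P) : bmR P := bm_r (p : P) (c i (cut q)).
have zfD i p : {morph zf i p : q r / q + r}.
  by move=> q r; rewrite /zf cutD cD bm_rDr.
have zfZ i p (a : A'^c) q : zf i p (a *: q) = a *: zf i p q.
  by rewrite /zf cutZ cZ [LHS]bm_rM.
(* The functional c_i need not respect degrees, so the map is regraded before fullness is
   applied. *)
pose z (i : 'I_n) (p : P) : grhom (bmR P) (bmR P) :=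
  @regrade A'^c G' (@ga_comp k G' A') X' (@gs_act G' X') (ga_dsum A') (@gs_act_inj G' X')
    (bmR P) (bmR P) (zf i p) (zfD i p) (zfZ i p).
have /choice[b bE] : forall ip : 'I_n * P, exists b : A, forall q, lp x q ->
    z ip.1 ip.2 q = b *: q :> P by move=> ip; apply: fu.
have bC i p y q : bm_comp (x, y) q -> b (i, p) *: q = dscomp rp y (bm_r p (c i (cut q))).
  move=> yq; rewrite -(bE (i, p)); last exact: lpart_in yq.
  exact: (@regradeE _ _ _ _ _ _ _ (bmR P) (bmR P) _ (zfD i p) (zfZ i p) y q (rpart_in yq)).
have uniq a a' : (forall y (q : P), bm_comp (x, y) q -> a *: q = a' *: q) -> a = a'.
  move=> h; apply/eqP; rewrite -subr_eq0; apply/eqP/(fa x).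
  apply: lpart_ind => [|p q hp hq|y q /h aq]; first exact: scaler0.
    by rewrite scalerDr hp hq addr0.
  by rewrite scalerBl aq subrr.
have bD i : {morph (fun p : bmL P => b (i, p)) : p q / p + q}.
  by move=> p q; apply: uniq => y r yr; rewrite scalerDl !(bC _ _ y) // bm_rDl dscompD.
have bZ i a (p : bmL P) : b (i, a *: p) = a * b (i, p).
  by apply: uniq => y r yr; rewrite -scalerA !(bC _ _ y) // bm_lr rcomp_l.
pose hf i (p : bmL P) : M := b (i, p) *: m.
have hfD i : {morph hf i : p q / p + q} by move=> p q; rewrite /hf bD scalerDl.
have hfZ i a (p : bmL P) : hf i (a *: p) = a *: hf i p by rewrite /hf bZ scalerA.
(* Here too degrees may mix. At e_i, which has degree x, regrading keeps the component of degree x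
   of b_i(e_i) m, and these components add up to m. *)
pose h (i : 'I_n) : grhom (bmL P) M := @regrade A G (@ga_comp k G A) X (fun x g => @gs_act G X x g^-1%g) (ga_dsum A) (@gs_actV_inj G X)
    (bmL P) M (hf i) (hfD i) (hfZ i).
have b1 : \sum_i b (i, sm_val (e i) : P) = 1.
  apply: uniq => y q yq; rewrite scale1r scaler_suml; under eq_bigr do rewrite (bC _ _ y) //.
  rewrite -(am_sum (dscompD dr y)).
  transitivity (dscomp rp y (sm_val (cut q))).
    by rewrite [in RHS](ce (cut q)) (am_sum (@sm_valD _ _ _)).
  have xq := lpart_in yq; have yq' := rpart_in yq.
  by rewrite [sm_val _](dscomp_hom dl x xq) eqxx (dscomp_hom dr y yq') eqxx.
have -> : m = \sum_i h i (sm_val (e i) : P).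
  transitivity (pt M x m); first by rewrite (dscomp_hom (gm_dsum M) x xm) eqxx.
  rewrite -{1}(scale1r m) -b1 scaler_suml (am_sum (dscompD (gm_dsum M) x)).
  apply: eq_bigr => i _; apply/esym; apply: (@regradeE _ _ _ _ _ _ _ (bmL P) M _ (hfD i) (hfZ i) x).
  exact: (sm_valP (e i)).
elim/big_rec: _ => [|i u _ hu]; first exact: trace0.
by apply: traceD hu; apply: trace_in.
Qed.

(** The mirror image of [lpart_generator]: with a dual basis of P_x, the regraded map q |-> c_i(q_x)
    p is left A-linear and acts on P_x as an element of A'. *)
Lemma rpart_generator : rfaithful P -> rfull P ->
  (forall x', fg_projective (sm_type (rpart_sub P x'))) -> @generator (grR_cat A' X') (bmR P).
Proof.
move=> fa fu pr; apply: trace_generator => M x m xm.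
have dl := lpart_dsum P; have dr := rpart_dsum P.
have [n [e [c [cD cZ ce]]]] := fg_projective_dual_basis (pr x).
pose cut q : sm_type (rpart_sub P x) := sm_mk (S := rpart_sub P x) (dscomp_in dr x q).
have cutD : {morph cut : p q / p + q}.
  by move=> p q; apply: sm_val_inj; apply: (dscompD dr).
have cutZ a (q : P) : cut (a *: q) = a *: cut q.
  by apply: sm_val_inj; apply: rcomp_l.
pose zf i (p : P) (q : bmL P) : bmL P := c i (cut q) *: p.
have zfD i p : {morph zf i p : q r / q + r}.
  by move=> q r; rewrite /zf cutD cD scalerDl.
have zfZ i p a q : zf i p (a *: q) = a *: zf i p q by rewrite /zf cutZ cZ scalerA.
pose z (i : 'I_n) (p : P) : grhom (bmL P) (bmL P) :=
  @regrade A G (@ga_comp k G A) X (fun x g => @gs_act G X x g^-1%g) (ga_dsum A) (@gs_actV_inj G X)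
    (bmL P) (bmL P) (zf i p) (zfD i p) (zfZ i p).
have /choice[b bE] : forall ip : 'I_n * P, exists b : A', forall q, rp x q ->
    z ip.1 ip.2 q = bm_r q b :> P by move=> ip; apply: fu.
have bC i p y q : bm_comp (y, x) q -> bm_r q (b (i, p)) = dscomp lp y (c i (cut q) *: p).
  move=> yq; rewrite -(bE (i, p)); last exact: rpart_in yq.
  exact: (@regradeE _ _ _ _ _ _ _ (bmL P) (bmL P) _ (zfD i p) (zfZ i p) y q (lpart_in yq)).
have uniq a a' : (forall y (q : P), bm_comp (y, x) q -> bm_r q a = bm_r q a') -> a = a'.
  move=> h; apply/eqP; rewrite -subr_eq0; apply/eqP/(fa x).
  apply: rpart_ind => [|p q hp hq|y q /h aq]; first exact: bm_r0l.
    by rewrite bm_rDl hp hq addr0.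
  by rewrite (amB (@bm_rDr _ _ _ _ _ _ _ P q)) aq subrr.
have bD i : {morph (fun p : bmR P => b (i, p)) : p q / p + q}.
  by move=> p q; apply: uniq => y r yr; rewrite bm_rDr !(bC _ _ y) // scalerDr dscompD.
have bZ i a (p : P) : b (i, bm_r p a) = b (i, p) * a.
  by apply: uniq => y r yr; rewrite bm_rM !(bC _ _ y) // -bm_lr lcomp_r.
pose hf i (p : bmR P) : M := rac m (b (i, p)).
have hfD i : {morph hf i : p q / p + q} by move=> p q; rewrite /hf bD racDl.
have hfZ i (a : A'^c) (p : bmR P) : hf i (a *: p) = a *: hf i p.
  by rewrite /hf [b _](bZ i a p) /rac scalerA.
pose h (i : 'I_n) : grhom (bmR P) M := @regrade A'^c G' (@ga_comp k G' A') X' (@gs_act G' X') (ga_dsum A') (@gs_act_inj G' X')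
    (bmR P) M (hf i) (hfD i) (hfZ i).
have b1 : \sum_i b (i, sm_val (e i) : P) = 1.
  apply: uniq => y q yq; rewrite bm_r1 (am_sum (@bm_rDr _ _ _ _ _ _ _ P q)).
  under eq_bigr do rewrite (bC _ _ y) //.
  rewrite -(am_sum (dscompD dl y)).
  transitivity (dscomp lp y (sm_val (cut q))).
    by rewrite [in RHS](ce (cut q)) (am_sum (@sm_valD _ _ _)).
  have xq := rpart_in yq; have yq' := lpart_in yq.
  by rewrite [sm_val _](dscomp_hom dr x xq) eqxx (dscomp_hom dl y yq') eqxx.
have -> : m = \sum_i h i (sm_val (e i) : P).
  transitivity (pt M x m); first by rewrite (dscomp_hom (gm_dsum M) x xm) eqxx.
  have -> : m = \sum_i hf i (sm_val (e i) : P).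
    by rewrite -(am_sum (@racDl _ _ m)) b1 /rac scale1r.
  rewrite (am_sum (dscompD (gm_dsum M) x)).
  apply: eq_bigr => i _; apply/esym; apply: (@regradeE _ _ _ _ _ _ _ (bmR P) M _ (hfD i) (hfZ i) x).
  exact: (sm_valP (e i)).
elim/big_rec: _ => [|i u _ hu]; first exact: trace0.
by apply: traceD hu; apply: trace_in.
Qed.

End Generators.

(** * Evaluation and faithfulness *)

Section Evaluation.
Variables (k : comPzRingType) (G G' : groupType).
Variables (A : grAlg k G) (A' : grAlg k G') (X : gset G) (X' : gset G').
Variable (P : grbimod A A' X X').

Local Notation lp := (@lpart _ _ _ _ _ _ _ P).
Local Notation F := (tensor_functor P).
Local Notation Ah := (Ahat A X).
Local Notation Ah' := (Ahat A' X').
Local Notation mk := (@Ahat_mk k G A X).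
Local Notation mk' := (@Ahat_mk k G' A' X').

Lemma bijectiveP (T U : Type) (f : T -> U) :
  injective f -> (forall u, exists t, f t = u) -> bijective f.
Proof. by move=> fI /choice[g gK]; exists g => // t; apply: fI. Qed.

(** As [lam m] carries 1 (x) x' to m, it is enough to treat 1 (x) x', which by assumption is a sum
    of values of graded maps on P. *)
Lemma ev_surj_trace : (forall t, exists u, ev P (bmR Ah') u = t) ->
  forall (M : grR A' X') (m : M), trace (bmR P) M m.
Proof.
move=> evS M; apply: (ds_ind (gm_dsum M)) => [|m n|x' m x'm]; [exact: trace0|exact: traceD|].
rewrite -(lam_mk1 x'm); have [u <-] := evS (mk' 1 x'); apply: trace_hom.
move: u; apply: hatP_ind => [|u v hu hv|x f p xf xp].
- by rewrite (am0 (gh_D (ev P (bmR Ah')))); apply: trace0.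
- by rewrite gh_D; apply: traceD.
- by rewrite (ev_mk xf xp); apply: trace_in.
Qed.

Lemma trace_ev_surj : (forall (M : grR A' X') (m : M), trace (bmR P) M m) ->
  forall (M : grR A' X') (m : M), exists u, ev P M u = m.
Proof.
move=> trP M m; have [n [x [f [p [xp ->]]]]] := trace_lpart (trP M m).
exists (\sum_i hmk (x i) (H_res (x i) (f i)) (p i)).
rewrite (am_sum (gh_D (ev P M))); apply: eq_bigr => i _.
rewrite (ev_mk _ (xp i)) ?H_resE; last exact: H_res_comp.
by rewrite (dscomp_hom (lpart_dsum P) _ (xp i)) eqxx.
Qed.

Section Inverse.
Variables (n : nat) (x : 'I_n -> X) (f : 'I_n -> grhom (bmR P) (bmR Ah')) (p : 'I_n -> P).

(* When 1 (x) x' = sum_i f_i(p_i), this inverts the evaluation map in degree x'. *)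
Definition ev_inv (M : grR A' X') (m : M) : hatP P (H_obj P M) :=
  \sum_i hmk (x i) (H_res (x i) (grhom_cmp (lam m) (f i))) (p i).

Lemma ev_invD (M : grR A' X') : {morph @ev_inv M : m m' / m + m'}.
Proof.
move=> m m'; rewrite /ev_inv -big_split /=; apply: eq_bigr => i _.
rewrite -hmkDl; congr (hmk _ _ _); apply: hh_eq => q.
by rewrite hh_addE !H_resE; apply: lamD.
Qed.

Lemma ev_inv_hom (M N : grR A' X') (g : grhom M N) m :
  hatP_hom P (H_hom P g) (ev_inv m) = ev_inv (g m).
Proof.
rewrite (am_sum (gh_D (hatP_hom P (H_hom P g)))); apply: eq_bigr => i _.
rewrite hatP_hom_mk; congr (hmk _ _ _); apply: hh_eq => q.
by rewrite [RHS]H_resE -[RHS]grhom_lam.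
Qed.

Variable x' : X'.
Hypotheses (xp : forall i, bm_comp (x i, x') (p i)) (e : mk' 1 x' = \sum_i f i (p i)).

Lemma ev_ev_inv (M : grR A' X') (m : M) : gm_comp x' m -> ev P M (ev_inv m) = m.
Proof.
move=> x'm; rewrite (am_sum (gh_D (ev P M))) -[RHS](lam_mk1 x'm) e (am_sum (gh_D (lam m))).
apply: eq_bigr => i _; have xpi := lpart_in (xp i).
rewrite (ev_mk _ xpi) ?H_resE; last exact: H_res_comp.
by rewrite (dscomp_hom (lpart_dsum P) _ xpi) eqxx.
Qed.

(** Degree x' is spanned by the h (x) q with q in some P_(y, x'), so the identity need only be known
    for these. *)
Lemma ev_invK (M : grR A' X') :
  (forall y (h : H_obj P M) q, gm_comp y h -> bm_comp (y, x') q -> hmk y h q = ev_inv (hh h q)) ->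
  forall u : hatP P (H_obj P M), gm_comp x' u -> u = ev_inv (ev P M u).
Proof.
move=> key u x'u; apply: sm_val_inj; move: u x'u.
apply: (hatc_ind (Q := fun t => t = sm_val (ev_inv (ev0 (M' := M) t)))).
- rewrite (am0 (@ev0D _ _ _ _ _ _ _ P M)); have := am0 (@ev_invD M).
  by move=> ->.
- by move=> t u ht hu; rewrite ev0D ev_invD {1}ht {1}hu.
- move=> y h q yh yq; rewrite ev0_tmk -(key y) // hmk_val //; exact: lpart_in yq.
Qed.

End Inverse.

Lemma ev_inj_of_inv (M : grR A' X') :
  (forall x', exists n (x : 'I_n -> X) (f : 'I_n -> grhom (bmR P) (bmR Ah')) (p : 'I_n -> P),
    forall y (h : H_obj P M) q, gm_comp y h -> bm_comp (y, x') q ->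
      hmk y h q = ev_inv x f p (hh h q)) ->
  injective (ev P M).
Proof.
move=> key; apply: grhom_inj => x' u x'u u0; have [n [x [f [p kE]]]] := key x'.
by rewrite (ev_invK kE x'u) u0; apply: am0 (ev_invD x f p (M := M)).
Qed.

(** Expanding q along the p_i gives h (x) q = sum h c_i(q) (x) p_i. Moreover h(c_i(q) r) = h([lam q]
    (f_i(r))) = [lam (h q)] (f_i(r)), which matches [ev_inv] term by term. *)
Lemma ev_bij : (forall (M : grR A' X') (m : M), trace (bmR P) M m) -> lfull P ->
  forall M, bijective (ev P M).
Proof.
move=> trP lfuP M; apply: bijectiveP; last exact: trace_ev_surj.
apply: ev_inj_of_inv => x'.
have [n [x [f [p [c [xp e cE cp]]]]]] := rpart_expansion trP lfuP x'.
exists n, x, f, p => y h q yh yq.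
rewrite {1}(cp q (rpart_in yq)) (am_sum (hmkDr y h)); apply: eq_bigr => i _.
rewrite (hmk_scale _ yh (lpart_in (xp i))); apply: hmk_comp_eq.
rewrite !H_ptE; apply: (H_comp_eq (x := x i)) => [||z r zr]; [exact: H_res_comp..|].
have xr := lpart_in zr; have := dscomp_hom (lpart_dsum P) (x i) xr; rewrite eqxx => er.
rewrite !H_resE [RHS]/= !er; transitivity (hh h (lam (q : bmR P) (f i r))).
  by rewrite (cE i).
exact: grhom_lam.
Qed.

(* The pairing M x Ah -> M, (m, t) |-> lam m t, is balanced, so it detects M (x) P *)
(* as soon as P generates Ah on the left. *)
Lemma generator_faithful : @generator (grL_cat A X) (bmL P) -> faithful F.
Proof.
move=> /generator_trace trP M N g h gh.
apply: grhom_eq; apply: (ds_ext (gm_dsum M)) => [||x m xm]; [exact: gh_D..|].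
have gx : gm_comp x (g m) := gh_comp g xm.
have hx : gm_comp x (h m) := gh_comp h xm.
have e1 : lpart x (mk 1 x) := Ahat_mk1_lpart A x.
have [s sE] := trP (bmL Ah) (mk 1 x).
have eP : mk 1 x = \sum_(u <- s) u.1 (dscomp lp x u.2).
  have := dscomp_hom (lpart_dsum Ah) x e1; rewrite eqxx => <-; rewrite {1}sE.
  rewrite (am_sum (dscompD (lpart_dsum Ah) x)); apply: eq_bigr => u _.
  exact: (grhom_dscomp u.1).
rewrite -(lam_mk1 gx) -(lam_mk1 hx) eP !(am_sum (gh_D _)); apply: eq_bigr => u _.
set p := dscomp lp x u.2; have xp : lp x p := dscomp_in (lpart_dsum P) x _.
pose b (n : N) (q : P) : N := lam n (u.1 q : Ah).
have bDl q : {morph b^~ q : n n' / n + n'} by apply: lamD.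
have bDr n : {morph b n : q r / q + r} by move=> q r; rewrite /b (gh_D u.1) gh_D.
have bb n a q : b (rac n a) q = b n (lac a q) by rewrite /b lam_rac (gh_Z u.1).
rewrite -!/(b _ _) -!(tlift_tmk bDl bDr bb); congr (tlift _ _).
rewrite -(hmk_val gx xp) -(hmk_val hx xp) -!(hatP_hom_mk (P := P)).
by have -> : hatP_hom P g = hatP_hom P h := gh.
Qed.

End Evaluation.

(** * From evaluation at A'^ and faithfulness to an equivalence *)

Section Converse.
Variables (k : comPzRingType) (G G' : groupType).
Variables (A : grAlg k G) (A' : grAlg k G') (X : gset G) (X' : gset G').
Variable (P : grbimod A A' X X').

Local Notation lp := (@lpart _ _ _ _ _ _ _ P).
Local Notation rp := (@rpart _ _ _ _ _ _ _ P).
Local Notation pt M := (dscomp (@gm_comp _ _ _ _ _ M)).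
Local Notation F := (tensor_functor P).
Local Notation H := (H_functor P).
Local Notation Ah' := (Ahat A' X').
Local Notation mk' := (@Ahat_mk k G' A' X').

Section Cofree.
Variable c : P -> A'.
Hypotheses (cD : {morph c : p q / p + q}) (cr : forall p a, c (bm_r p a) = c p * a).

(* Graded maps P -> Ah' correspond to A'-linear maps P -> A'. *)
Definition cofree_fun (p : P) : Ah' := dsext rp (fun y q => mk' (c q) y) p.

Let cofree_morph y : {morph (fun q => mk' (c q) y) : p q / p + q}.
Proof. by move=> p q; rewrite cD Ahat_mkD. Qed.

Lemma cofree_funE y p : rp y p -> cofree_fun p = mk' (c p) y.
Proof. exact: (dsext_hom (rpart_dsum P) cofree_morph). Qed.

Lemma cofree_funD : {morph cofree_fun : p q / p + q}.
Proof. exact: (dsextD (rpart_dsum P) cofree_morph). Qed.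

Lemma cofree_fun_r a p : cofree_fun (bm_r p a) = bm_r (cofree_fun p) a.
Proof.
move: a; apply: (ds_ext (ga_dsum A')) => [a b|a b|g a ga].
- by rewrite bm_rDr cofree_funD.
- by rewrite bm_rDr.
move: p; apply: (ds_ext (rpart_dsum P)) => [p q|p q|y p yp].
- by rewrite bm_rDl cofree_funD.
- by rewrite cofree_funD bm_rDl.
- by rewrite (cofree_funE yp) (cofree_funE (rpart_r ga yp)) cr (Ahat_r_mk _ _ ga).
Qed.

Definition cofree : grhom (bmR P) (bmR Ah').
Proof.
exists (cofree_fun : rmod_of P -> rmod_of Ah').
- by apply: linearP_of => [|a p]; [apply: cofree_funD|apply: cofree_fun_r].
- by move=> y p yp; rewrite (cofree_funE yp); apply: Ahat_mk_rpart.
Defined.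

Lemma lam_cofree (M : grR A' X') (m : M) y p : rp y p ->
  lam m (cofree p) = pt M y (rac m (c p)).
Proof. by move=> yp; rewrite [cofree p](cofree_funE yp) lam_mk. Qed.
End Cofree.

(** With a dual basis b_i, c_i of _yP, a map h in H(P, M)_y is the sum of the [lam (h b_i)] after
    g_i, where g_i : P -> A'^ comes from c_i. Injectivity of evaluation at A'^ gives g_i (x) q =
    [ev_inv] (g_i(q)), and naturality of [ev_inv] carries this over to h. *)
Lemma ev_bij_of_Ahat : (forall x, fg_projective (sm_type (lpart_sub P x))) ->
  bijective (ev P (bmR Ah')) -> forall M, bijective (ev P M).
Proof.
move=> pr evA M.
have evS t : exists u, ev P (bmR Ah') u = t by case: evA => g _ gK; exists (g t).
have trP := ev_surj_trace evS.
apply: bijectiveP; last exact: trace_ev_surj.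
apply: ev_inj_of_inv => x'.
have [n [x [f [p [xp e]]]]] := @trace_rpart _ _ _ _ _ _ _ P (bmR Ah') x' _ (Ahat_mk_rpart 1 x') (trP _ _).
exists n, x, f, p => y h q yh yq.
have dl := lpart_dsum P; have yq' := lpart_in yq.
have [d [b [c [cD cZ cb]]]] := fg_projective_dual_basis (pr y).
pose cut r : sm_type (lpart_sub P y) := sm_mk (S := lpart_sub P y) (dscomp_in dl y r).
have cutD : {morph cut : r s / r + s}.
  by move=> r s; apply: sm_val_inj; apply: (dscompD dl).
have cutr r (a : A') : cut (bm_r r a) = (a : A'^c) *: cut r.
  by apply: sm_val_inj; apply: lcomp_r.
pose cc i r : A' := c i (cut r).
have ccD i : {morph cc i : r s / r + s} by move=> r s; rewrite /cc cutD cD.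
have ccr i r a : cc i (bm_r r a) = cc i r * a by rewrite /cc cutr cZ.
pose g i : H_obj P (bmR Ah') := H_res y (cofree (ccD i) (ccr i)).
have cutE r : lp y r -> r = \sum_i bm_r (sm_val (b i) : P) (cc i r).
  move=> yr; transitivity (sm_val (cut r)).
    by rewrite [RHS](dscomp_hom dl y yr) eqxx.
  by rewrite [LHS](congr1 (@sm_val _ _ _) (cb (cut r))) (am_sum (@sm_valD _ _ _)).
have lam_sum z r : lp y r -> rp z r ->
    hh h r = \sum_i lam (hh h (sm_val (b i) : P)) (cofree (ccD i) (ccr i) r).
  move=> yr zr; have := dscomp_hom (gm_dsum M) z (gh_comp (hh h) zr); rewrite eqxx => <-.
  rewrite [X in hh h X](cutE _ yr) (am_sum (gh_D (hh h))) (am_sum (dscompD (gm_dsum M) z)).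
  apply: eq_bigr => i _; rewrite (lam_cofree _ _ _ zr); congr (dscomp _ _ _).
  exact: (gh_Z (hh h)).
have hE : h = \sum_i H_hom P (lam (hh h (sm_val (b i) : P))) (g i).
  apply: (H_comp_eq yh) => [|z r zr].
    elim/big_rec: _ => [|i s _ ys]; first exact: ds0 (gm_dsum (H_obj P M)) _.
    apply: (dD (ds0 (gm_dsum (H_obj P M))) (dsB (gm_dsum (H_obj P M)))) ys.
    by apply: gh_comp; apply: H_res_comp.
  rewrite (lam_sum z r (lpart_in zr) (rpart_in zr)) [RHS]hh_sumE; apply: eq_bigr => i _.
  by rewrite /= (dscomp_hom dl y (lpart_in zr)) eqxx.
have gE i : hmk y (g i) q = ev_inv x f p (cofree (ccD i) (ccr i) q).
  apply: (bij_inj evA).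
  rewrite (ev_ev_inv xp e (gh_comp (cofree (ccD i) (ccr i)) (rpart_in yq))).
  rewrite (ev_mk _ yq'); last exact: H_res_comp.
  by rewrite H_resE (dscomp_hom dl y yq') eqxx.
rewrite (lam_sum x' q yq' (rpart_in yq)) (am_sum (ev_invD x f p (M := M))).
rewrite {1}hE (am_sum (@hmkDl _ _ _ _ _ _ _ P _ y q)); apply: eq_bigr => i _.
by rewrite -hatP_hom_mk gE ev_inv_hom.
Qed.

(** One of the triangle identities of the adjunction. *)
Lemma ev_eta (M : grR A X) (u : hatP P M) : ev P (hatP P M) (hatP_hom P (eta P M) u) = u.
Proof.
move: u; apply: hatP_ext => [u v|//|x m p xm xp]; first by rewrite !gh_D.
by rewrite hatP_hom_mk (ev_mk (gh_comp (eta P M) xm) xp) (etaE _ xp).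
Qed.

(** An m in the kernel satisfies m (x) p = 0 for all p, so [faithful_hmk] applies. By [ev_eta] the
    functor makes the unit a right inverse of a bijective evaluation, hence surjective; so the
    functor kills the cokernel, which is therefore zero. *)
Lemma eta_bij : faithful F -> (forall M, bijective (ev P M)) -> forall M, bijective (eta P M).
Proof.
move=> Ff evB M; apply: bijectiveP.
  apply: grhom_inj => x m xm m0; apply: (faithful_hmk Ff xm) => p xp.
  by have := etaE m xp; rewrite m0 => <-.
pose S : set (H_obj P (hatP P M)) := [set h | exists m, eta P M m = h].
have S0 : S 0 by exists 0; apply: am0 (gh_D (eta P M)).
have SD g h : S g -> S h -> S (g + h) by move=> [m <-] [n <-]; exists (m + n); apply: gh_D.
have SZ a h : S h -> S (a *: h) by move=> [m <-]; exists (a *: m); apply: gh_Z.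
pose Ssub := Submod S0 SD SZ.
have Sh x h : sm_set Ssub h -> sm_set Ssub (pt (H_obj P (hatP P M)) x h).
  by move=> [m <-]; exists (pt M x m); rewrite grhom_dscomp.
apply: (faithful_quot0 Ff (Sh := Sh)) => x h p xh xp.
rewrite -hatP_hom_mk; set v := hmk x h p.
(* Both sides have the same evaluation, and evaluation is injective. *)
have -> : v = hatP_hom P (eta P M) (ev P (hatP P M) v).
  by apply: (bij_inj (evB (hatP P M))); rewrite ev_eta.
move: (ev P (hatP P M) v) => u; move: u; apply: hatP_ind => [|u w hu hw|y m q ym yq].
- by rewrite !(am0 (gh_D _)).
- by rewrite !gh_D hu hw addr0.
- rewrite !hatP_hom_mk (_ : grquot_pi Sh _ = 0) ?hmk0l //.
  by apply/grquot_pi0P; exists m.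
Qed.

Lemma ev_eta_inverse_equivalences : (forall M, bijective (ev P M)) ->
  (forall M, bijective (eta P M)) -> inverse_equivalences F H.
Proof.
move=> evB etaB; split.
  apply: naturally_isomorphic_sym.
  apply: (@gr_cat_natural_iso _ _ _ _ _ _ (idF _) (compF H F) (eta P)) => // M N f.
  apply: grhom_eq => m; apply: hh_eq; apply: (ds_ext (lpart_dsum P)) => [||x p xp].
  - exact: (gh_D (hh (eta P N (gh_fun (f : grhom M N) m)))).
  - exact: (gh_D (hh (H_hom P (hatP_hom P f) (eta P M m)))).
  - rewrite [LHS](etaE _ xp) [RHS]/= (eta_sum_hom _ xp); exact/esym/hatP_hom_mk.
apply: (@gr_cat_natural_iso _ _ _ _ _ _ (compF F H) (idF _) (ev P)) => // M N f.
apply: grhom_eq; apply: hatP_ext => [||x h p xh xp].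
- exact: (gh_D (grhom_cmp (ev P N) (hatP_hom P (H_hom P f)))).
- exact: (gh_D (grhom_cmp (f : grhom M N) (ev P M))).
have e1 : hatP_hom P (H_hom P f) (hmk x h p) = hmk x (H_hom P f h) p := hatP_hom_mk _ _ _ _.
transitivity (ev P N (hmk x (H_hom P f h) p)); first by rewrite -e1.
rewrite (ev_mk (gh_comp (H_hom P f) xh) xp).
by transitivity (gh_fun (f : grhom M N) (ev P M (hmk x h p))); first by rewrite (ev_mk xh xp).
Qed.

End Converse.

Theorem theorem3p4p4 (k : comPzRingType) (G G' : groupType)
    (A : grAlg k G) (A' : grAlg k G') (X : gset G) (X' : gset G')
    (P : grbimod A A' X X') :
  [<-> (* (1) *)
       inverse_equivalences (tensor_functor P) (H_functor P);
       (* (2) *)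
       [/\ forall x : X, fg_projective (sm_type (lpart_sub P x)),
           forall x' : X', fg_projective (sm_type (rpart_sub P x')),
           bijective (psi P)
         & bijective (psi' P)];
       (* (2), resp. *)
       [/\ (forall x : X, fg_projective (sm_type (lpart_sub P x))) /\
           (forall x' : X', fg_projective (sm_type (rpart_sub P x'))),
           @generator (grR_cat A' X') (bmR P) /\
           @generator (grL_cat A X) (bmL P),
           forall f, exists t, psi P t = f
         & forall f, exists t, psi' P t = f];
       (* (3) *)
       [/\ forall x : X, fg_projective (sm_type (lpart_sub P x)),
           bijective (ev P (bmR (Ahat A' X')))
         & faithful (tensor_functor P)]].
Proof.
split=> [FH|].
  have [[iHF iFH] lfuP] := (FH, equivalence_lfull FH).
  have Ff := naturally_isomorphic_faithful iHF.
  have trP := equivalence_trace FH; have lfaP := faithful_lfaithful Ff.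
  split.
  - by move=> x; apply: lpart_fg_projective.
  - by move=> x'; apply: rpart_fg_projective.
  - exact/psi_bijP.
  - by apply/psi'_bijP; split; [apply: trace_rfaithful|apply: trace_rfull].
split=> [[lP rP psiB psi'B]|].
  have [lfaP lfuP] := (psi_bijP P).1 psiB; have [rfaP rfuP] := (psi'_bijP P).1 psi'B.
  split=> //.
  - by split; [apply: rpart_generator|apply: lpart_generator].
  - by move=> f; case: psiB => g _ gK; exists (g f).
  - by move=> f; case: psi'B => g _ gK; exists (g f).
split=> [[[lP _] [gR gL] psiS _]|[lP evB Ff]].
  split=> //; last exact: generator_faithful.
  by apply: ev_bij; [apply: generator_trace|apply: psi_surj_lfull].
have evAll := ev_bij_of_Ahat lP evB.
exact: ev_eta_inverse_equivalences evAll (eta_bij Ff evAll).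
Qed.
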